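(* Let $0<p\le q<\infty$ and let $C_\varphi$ be a bounded composition operator from $\mathcal F^p(\mathbb C)$ into $\mathcal F^q(\mathbb C)$ induced by $\varphi(z)=az+b$ with $a,b\in\mathbb C$, $|a|\le1$. The following conditions are equivalent: (i) $C_\varphi$ is isolated in $\mathcal C\big(\mathcal F^p(\mathbb C),\mathcal F^q(\mathbb C)\big)$; (ii) $C_\varphi:\mathcal F^p(\mathbb C)\to\mathcal F^q(\mathbb C)$ is non-compact, that is, $|a|=1$ and $b=0$; (iii) $\|C_\varphi-C_\phi\|\ge1$ for all affine functions $\phi(z)=cz+d$ with $\phi\ne\varphi$ such that $C_\phi\in\mathcal C\big(\mathcal F^p(\mathbb C),\mathcal F^q(\mathbb C)\big)$.
   Context: $dA$ is Lebesgue measure on $\mathbb C$. For $0<p<\infty$, the Fock space $\mathcal F^p(\mathbb C)$ is the set of entire functions $f$ with $\|f\|_p=\left(\frac{p}{2\pi}\int_{\mathbb C}|f(z)|^pe^{-\frac{p|z|^2}{2}}\,dA(z)\right)^{1/p}<\infty$ (a Banach space if $p\ge1$; a complete metric space with distance $\|f-g\|_p^p$ if $0<p<1$). For an entire function $\varphi$, the composition operator is $C_\varphi f=f\circ\varphi$. A linear operator $T:\mathcal F^p(\mathbb C)\to\mathcal F^q(\mathbb C)$ is bounded if it maps $\mathcal F^p(\mathbb C)$ into $\mathcal F^q(\mathbb C)$ and $\|T\|=\sup_{\|f\|_p\le1}\|Tf\|_q<\infty$; it is compact if it maps bounded sets to relatively compact sets. $\mathcal C(\mathcal F^p(\mathbb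 C),\mathcal F^q(\mathbb C))$ is the set of all bounded composition operators from $\mathcal F^p(\mathbb C)$ into $\mathcal F^q(\mathbb C)$ with the operator norm topology, i.e. the topology of the metric $\|S-T\|^{\min(1,q)}$. *)

(* Defs.v *)
From HB Require Import structures.
From mathcomp Require Import all_boot all_order all_algebra.
From mathcomp Require Import all_classical all_reals all_analysis.
From mathcomp Require Import complex.
Import Order.TTheory GRing.Theory Num.Theory.
Import numFieldNormedType.Exports.

Set Implicit Arguments.
Unset Strict Implicit.
Unset Printing Implicit Defensive.

Local Open Scope classical_set_scope.
Local Open Scope ring_scope.
Local Open Scope complex_scope.

(* Each [d] used below is, for positive exponents, finite-valued and satisfies
   the metric axioms; defining the topology by its open sets makes it available
   without a proof of the triangle inequality. *)
Definition metric_open (R : realType) (T : Type) (d : T -> T -> \bar R)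
    (U : set T) : Prop :=
  forall x, U x -> exists2 e : R, 0 < e & forall y, (d x y < e%:E)%E -> U y.

Lemma metric_openT (R : realType) (T : Type) (d : T -> T -> \bar R) :
  metric_open d setT.
Proof. by move=> x _; exists 1. Qed.

Lemma metric_openI (R : realType) (T : Type) (d : T -> T -> \bar R) :
  setI_closed (metric_open d).
Proof.
move=> A B oA oB x [/oA[e e0 eA] /oB[r r0 rB]].
exists (Num.min e r); first by rewrite lt_min e0.
by move=> y; rewrite EFin_min lt_min => /andP[/eA ? /rB].
Qed.

Lemma metric_open_bigU (R : realType) (T : Type) (d : T -> T -> \bar R)
    (I : Type) (F : I -> set T) :
  (forall i, metric_open d (F i)) -> metric_open d (\bigcup_i F i).
Proof.
move=> oF x [i _ /oF[e e0 eF]]; exists e => // y /eF Fy; by exists i.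
Qed.

Section Fock.
Variable R : realType.

Definition entire (f : R[i] -> R[i]) : Prop :=
  forall z : R[i], derivable (f : R[i]^o -> R[i]^o) z 1.

(* dA is the product Lebesgue measure, with [x +i* y] identified with [(x, y)]. *)
Definition fock_norm (p : R) (f : R[i] -> R[i]) : \bar R :=
  (((p / (2 * pi))%:E *
    \int[(@lebesgue_measure R \x @lebesgue_measure R)%E]_(w in [set: _])
      ((Normc.normc (f (w.1 +i* w.2)) `^ p
        * expR (- (p * Normc.normc (w.1 +i* w.2) ^+ 2 / 2)))%:E)) `^ p^-1)%E.

Record fock (p : R) := Fock {
  fock_fun :> R[i] -> R[i];
  fock_entire : entire fock_fun;
  fock_norm_fin : (fock_norm p fock_fun < +oo)%E }.

HB.instance Definition _ (p : R) := gen_eqMixin (fock p).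
HB.instance Definition _ (p : R) := gen_choiceMixin (fock p).

(* [||f - g||_p] if [1 <= p], and [||f - g||_p ^ p] if [p < 1]. *)
Definition fock_dist (p : R) (f g : fock p) : \bar R :=
  (fock_norm p (f \- g)%R `^ (Num.min 1 p)%R)%E.

HB.instance Definition _ (p : R) := isOpenTopological.Build (fock p)
  (metric_openT (@fock_dist p)) (metric_openI (d := @fock_dist p))
  (metric_open_bigU (d := @fock_dist p)).

(* Taking arbitrary functions as values lets this apply to [T] and to
   [S - T] alike. *)
Definition op_norm (p q : R) (T : fock p -> (R[i] -> R[i])) : \bar R :=
  ereal_sup [set fock_norm q (T f) | f in [set f : fock p | (fock_norm p f <= 1)%E]].

Definition op_diff (p q : R) (S T : fock p -> fock q) (f : fock p) :
  R[i] -> R[i] := (S f \- T f)%R.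

Definition induced_by (p q : R) (T : fock p -> fock q) (phi : R[i] -> R[i]) :
  Prop := forall f : fock p, (T f : R[i] -> R[i]) = f \o phi.

Record comp_op (p q : R) := CompOp {
  comp_op_fun :> fock p -> fock q;
  comp_op_symbol : exists2 phi, entire phi & induced_by comp_op_fun phi;
  comp_op_bounded : (op_norm q comp_op_fun < +oo)%E }.

HB.instance Definition _ (p q : R) := gen_eqMixin (comp_op p q).
HB.instance Definition _ (p q : R) := gen_choiceMixin (comp_op p q).

Definition comp_op_dist (p q : R) (S T : comp_op p q) : \bar R :=
  (op_norm q (op_diff S T) `^ (Num.min 1 q)%R)%E.

HB.instance Definition _ (p q : R) := isOpenTopological.Build (comp_op p q)
  (metric_openT (@comp_op_dist p q)) (metric_openI (d := @comp_op_dist p q))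
  (metric_open_bigU (d := @comp_op_dist p q)).

Definition fock_bounded (p : R) (B : set (fock p)) : Prop :=
  exists M : R, forall f, B f -> (fock_norm p f <= M%:E)%E.

Definition compact_op (p q : R) (T : fock p -> fock q) : Prop :=
  forall B : set (fock p), fock_bounded B -> compact (closure (T @` B)).

Definition affine (a b : R[i]) : R[i] -> R[i] := fun z => a * z + b.

End Fock.

(* Main.v *)
Require Import Defs.
From mathcomp Require Import all_boot all_order all_algebra.
From mathcomp Require Import all_classical all_reals all_analysis.
From mathcomp Require Import measurable_realfun complex.
From mathcomp Require Import ring lra.
Import Order.TTheory GRing.Theory Num.Theory.
Import numFieldNormedType.Exports.
Local Open Scope classical_set_scope.
Local Open Scope ring_scope.
Local Open Scope complex_scope.
Set Implicit Arguments.
Unset Strict Implicit.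
Unset Printing Implicit Defensive.

(** Write [phi z = a z + b].  The cases [|a| = 1] and [|a| < 1] are treated
separately, and each of them decides all three conditions at once.

Both cases rest on a pointwise bound: an entire [f] satisfies
[|f z| <= C exp ((|z| + 8)^2 / 2) * |f|_p] ([fock_eval]).  It holds because
[|f|^p] is dominated, up to a constant, by its area means for every [p > 0]
([submean_powR]); for [|f|] itself this is Cauchy's formula on rectangles,
averaged over the positions of the four sides, and a maximal point argument
transfers it to [|f|^p].  Cauchy's formula also bounds the second order Taylor
remainder of [f] by the maximum of [|f|] nearby ([cauchy_taylor]).  That single
estimate yields a Liouville theorem, Lipschitz bounds, and the fact that a
pointwise limit of entire functions with a common bound is entire.

Suppose [|a| = 1].  The test functions are the normalized reproducing kernels
[kern w z = exp (conj w * z - |w|^2 / 2)].  They have norm 1 for every exponent,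
and [kern w (c z + d)] is, in modulus,
[exp (Re (conj w * d) - (1 - |c|^2) |w|^2 / 2)] times a kernel.  If [|c| = 1],
this factor is bounded in [w] only for [d = 0]; hence [b = 0].  The operator maps
kernels to functions of norm 1 which tend to 0 pointwise as [w] tends to
infinity, so their images have no cluster point and the operator is not compact.
If [c <> a], then [kern w (a z)] and [kern w (c z + d)] have, after
multiplication by the weight, the moduli of a Gaussian and of a bounded multiple
of a Gaussian whose centres move apart as [w] grows, so the difference of the two
operators has norm at least 1 ([diff_norm_ge1]).  Every bounded composition
operator has an affine symbol: bounding [kern (phi z) \o phi] at the point [z]
gives [|phi z| <= |z| + K], and Liouville's theorem applies.  So the open unit
ball around the operator contains no other composition operator.

Suppose [|a| < 1].  Then [exp ((|a z + b| + r)^2 / 2)] is bounded by a multiple of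
[exp ((1/2 - dl) |z|^2)] for some [dl > 0], and the Gaussian that is gained makes
all integrals converge.  The composition operator of [a z + b'] is therefore
bounded, and its distance to the given one is at most [K |b' - b|] by the local
Lipschitz bounds; so the operator is not isolated and (iii) fails.  It is compact
because entire functions with a fixed bound form a normal family: along an
ultrafilter they converge to an entire function, uniformly on bounded sets, and
the contribution of large [|z|] is uniformly small. *)

Notation nrm := Normc.normc.

(** * The modulus of a complex number *)

Section Modulus.
Variable R : realType.
Implicit Types (z w : R[i]) (x y : R).

Lemma normr_nrm z : `|z| = (nrm z)%:C. Proof. by []. Qed.

Lemma nrm_ge0 z : 0 <= nrm z. Proof. by case: z => x y; exact: sqrtr_ge0. Qed.

Lemma nrm_sqr z : nrm z ^+ 2 = complex.Re z ^+ 2 + complex.Im z ^+ 2.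
Proof. by case: z => x y /=; rewrite sqr_sqrtr // addr_ge0 ?sqr_ge0. Qed.

Lemma nrmD z w : nrm (z + w) <= nrm z + nrm w.
Proof. exact: le_normcD. Qed.

Lemma nrmN z : nrm (- z) = nrm z. Proof. exact: normcN. Qed.

Lemma nrmB z w : nrm (z - w) <= nrm z + nrm w.
Proof. by rewrite -(nrmN w) nrmD. Qed.

Lemma nrmBC z w : nrm (z - w) = nrm (w - z).
Proof. by rewrite -nrmN opprB. Qed.

Lemma nrmM z w : nrm (z * w) = nrm z * nrm w. Proof. exact: Normc.normcM. Qed.
Lemma nrmV z : nrm z^-1 = (nrm z)^-1. Proof. exact: Normc.normcV. Qed.
Lemma nrm0 : nrm (0 : R[i]) = 0. Proof. exact: Normc.normc0. Qed.
Lemma nrm1 : nrm (1 : R[i]) = 1. Proof. exact: Normc.normc1. Qed.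

Lemma nrm_eq0 z : (nrm z == 0) = (z == 0).
Proof. by apply/eqP/eqP => [/Normc.eq0_normc//|->]; exact: nrm0. Qed.

Lemma nrm_gt0 z : (0 < nrm z) = (z != 0).
Proof. by rewrite lt_neqAle nrm_ge0 andbT eq_sym nrm_eq0. Qed.

Lemma nrmR x : nrm x%:C = `|x|.
Proof. by rewrite /= expr0n addr0 sqrtr_sqr. Qed.

Lemma nrm_i : nrm ('i : R[i]) = 1.
Proof. by rewrite /= expr0n add0r expr1n sqrtr1. Qed.

Lemma nrmJ z : nrm z^* = nrm z.
Proof. by case: z => x y /=; rewrite sqrrN. Qed.

Lemma Re_le_nrm z : `|complex.Re z| <= nrm z.
Proof.
rewrite -ler_sqr ?nnegrE ?nrm_ge0 // nrm_sqr real_normK ?num_real //.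
by rewrite lerDl sqr_ge0.
Qed.

Lemma Im_le_nrm z : `|complex.Im z| <= nrm z.
Proof.
rewrite -ler_sqr ?nnegrE ?nrm_ge0 // nrm_sqr real_normK ?num_real //.
by rewrite lerDr sqr_ge0.
Qed.

Lemma nrm_le_ReIm z : nrm z <= `|complex.Re z| + `|complex.Im z|.
Proof.
case: z => x y; have -> : x +i* y = x%:C + Complex 0 y.
  by apply/eqP; rewrite eq_complex /= addr0 add0r !eqxx.
apply: le_trans (nrmD _ _) _; rewrite nrmR /= addr0 add0r lerD2l.
by rewrite expr0n add0r sqrtr_sqr.
Qed.

Lemma nrm_pair x y : nrm (x +i* y) <= `|x| + `|y|.
Proof. exact: nrm_le_ReIm. Qed.

Lemma ler_nrmB z w : nrm z - nrm w <= nrm (z - w).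
Proof. by rewrite lerBlDr -{1}(subrK w z) nrmD. Qed.

Lemma ler_dist_nrm z w : `|nrm z - nrm w| <= nrm (z - w).
Proof.
rewrite ler_norml ler_nrmB andbT lerNl opprB nrmBC; exact: ler_nrmB.
Qed.

Lemma mulJ_nrm z : z^* * z = (nrm z ^+ 2)%:C.
Proof.
by rewrite nrm_sqr; case: z => x y /=; apply/eqP; rewrite eq_complex /=;
  apply/andP; split; apply/eqP; ring.
Qed.

End Modulus.

(** * Complex differentiability and the exponential *)

Section ComplexDerivative.
Variable R : realType.
Implicit Types (f g : R[i] -> R[i]) (z w h d : R[i]).

Definition cdiff f z := derivable (f : R[i]^o -> R[i]^o) z 1.

(** Radii and errors are real here, so that estimates take place in the ordered
    field [R] and not in [R[i]], which is only partially ordered. *)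
Definition has_cderiv f z d := forall e : R, 0 < e ->
  exists2 r : R, 0 < r & forall h, nrm h < r ->
    nrm (f (z + h) - f z - d * h) <= e * nrm h.

Lemma cdiffP f z : cdiff f z <-> exists d, has_cderiv f z d.
Proof.
split.
- move=> /cvg_ex[/= d /cvgrPdist_lt cd]; exists d => e e0.
  have /cd : 0 < (e%:C : R[i]) by rewrite ltcR.
  rewrite near_withinE => -[] /= r; rewrite ltcE /= => /andP[/eqP r2 r1] H.
  exists (complex.Re r) => // h hr.
  have [->|h0] := eqVneq h 0; first by rewrite addr0 subrr mulr0 subr0 nrm0 mulr0.
  have := H h; rewrite /ball_ /= sub0r normrN => /(_ _ h0).
  have -> : `|h| < r.
    by case: r r1 r2 hr {H} => ? ? /= _ -> hr; rewrite ltcE /= eqxx.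
  move=> /(_ isT); rewrite normr_nrm ltcR => H1.
  have -> : f (z + h) - f z - d * h = - (d - h^-1 * (f (z + h) - f z)) * h.
    by rewrite opprB mulrBl mulrAC mulVf // mul1r.
  rewrite nrmM nrmN ler_wpM2r ?nrm_ge0 // ltW //.
  by move: H1; rewrite /GRing.scale /= mulr1 (addrC h z).
- case=> d H; apply/cvg_ex; exists d; apply/cvgrPdist_le => /= e.
  rewrite ltcE /= => /andP[/eqP e2 e1].
  have [r r0 Hr] := H _ e1.
  rewrite near_withinE; exists r%:C; first by rewrite /= ltcR.
  move=> h /=; rewrite sub0r normrN normr_nrm ltcR => hr h0.
  have -> : e = (complex.Re e)%:C by case: e e1 e2 {Hr} => ? ? /= _ ->.
  rewrite normr_nrm lecR.
  have -> : d - h^-1 *: (f (h *: 1 + z) - f z) =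
            - (f (z + h) - f z - d * h) * h^-1.
    rewrite /GRing.scale /= mulr1 (addrC h) opprB mulrBl -mulrA divff // mulr1.
    by rewrite mulrC.
  rewrite nrmM nrmN nrmV ler_pdivrMr ?nrm_gt0 //; exact: Hr.
Qed.

(** A difference quotient bounded near [z] makes [f] continuous there. *)
Lemma cdiff_cont f z : cdiff f z -> forall e : R, 0 < e ->
  exists2 r : R, 0 < r & forall h, nrm h < r -> nrm (f (z + h) - f z) < e.
Proof.
case/cdiffP => d /(_ _ ltr01)[r r0 H] e e0.
have c0 : 0 < 1 + nrm d by rewrite ltr_pwDl ?nrm_ge0.
exists (Num.min r (e / (1 + nrm d))); first by rewrite lt_min r0 divr_gt0.
move=> h; rewrite lt_min ltr_pdivlMr // => /andP[/H H1 H2].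
rewrite (le_lt_trans _ H2) // mulrDr mulr1 -[f (z + h) - _](subrK (d * h)).
by rewrite (le_trans (nrmD _ _)) // nrmM (mulrC (nrm h)) lerD // -[leRHS]mul1r.
Qed.

Lemma cdiff_cst c z : cdiff (fun=> c) z.
Proof. exact: derivable_cst. Qed.

Lemma cdiff_id z : cdiff id z.
Proof. exact: derivable_id. Qed.

Lemma cdiffD f g z : cdiff f z -> cdiff g z -> cdiff (fun w => f w + g w) z.
Proof. exact: derivableD. Qed.

Lemma cdiffB f g z : cdiff f z -> cdiff g z -> cdiff (fun w => f w - g w) z.
Proof. exact: derivableB. Qed.

Lemma cdiffM f g z : cdiff f z -> cdiff g z -> cdiff (fun w => f w * g w) z.
Proof. exact: derivableM. Qed.

Lemma cdiffV f z : f z != 0 -> cdiff f z -> cdiff (fun w => (f w)^-1) z.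
Proof. exact: derivableV. Qed.

Lemma cdiff_comp f g z : cdiff g z -> cdiff f (g z) -> cdiff (f \o g) z.
Proof.
case/cdiffP => d1 Hg /cdiffP[d2 Hf]; apply/cdiffP; exists (d2 * d1) => e e0.
have n1 : 0 < 1 + nrm d1 by rewrite ltr_pwDl ?nrm_ge0.
have n2 : 0 < 1 + nrm d2 by rewrite ltr_pwDl ?nrm_ge0.
have e20 : 0 < e / 2 by rewrite divr_gt0.
have [r2 r20 H2] := Hf _ (divr_gt0 e20 n1).
have m0 : 0 < Num.min 1 (e / 2 / (1 + nrm d2)) by rewrite lt_min ltr01 divr_gt0.
have [r1 r10 H1] := Hg _ m0.
exists (Num.min r1 (r2 / (1 + nrm d1))); first by rewrite lt_min r10 divr_gt0.
move=> h; rewrite lt_min ltr_pdivlMr // => /andP[/H1 {}H1 hr2].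
set k := g (z + h) - g z.
have kh : nrm k <= (1 + nrm d1) * nrm h.
  rewrite -(subrK (d1 * h) k) mulrDl mul1r (le_trans (nrmD _ _)) // nrmM lerD2r.
  by rewrite (le_trans H1) // ler_piMl ?nrm_ge0 // ge_min lexx.
have kr : nrm k < r2 by rewrite (le_lt_trans kh) // mulrC.
have := H2 k kr; rewrite {1}/k addrCA subrr addr0 => {}H2.
have -> : (f \o g) (z + h) - (f \o g) z - d2 * d1 * h =
    (f (g (z + h)) - f (g z) - d2 * k) + d2 * (k - d1 * h) by rewrite /=; ring.
rewrite (le_trans (nrmD _ _)) // [e](splitr e) mulrDl lerD //.
  rewrite (le_trans H2) // mulrAC ler_pdivrMr //.
  by rewrite (le_trans (ler_wpM2l (ltW e20) kh)) // (mulrC (1 + _)) mulrA.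
rewrite nrmM (le_trans (ler_wpM2l (nrm_ge0 _) H1)) // mulrA ler_wpM2r ?nrm_ge0 //.
apply: (@le_trans _ _ ((1 + nrm d2) * (e / 2 / (1 + nrm d2)))); last first.
  by rewrite mulrC divfK // lt0r_neq0.
by apply: ler_pM; rewrite ?nrm_ge0 ?(ltW m0) ?ge_min ?lexx ?orbT ?lerDr ?ler01.
Qed.

Lemma entire_affine (a b : R[i]) : entire (affine a b).
Proof.
move=> z; apply: (@cdiffD (fun w => a * w) (fun=> b)); last exact: cdiff_cst.
by apply: (@cdiffM (fun=> a) id); [exact: cdiff_cst|exact: cdiff_id].
Qed.

Lemma entire_comp f g : entire f -> entire g -> entire (f \o g).
Proof. by move=> ef eg z; apply: cdiff_comp; [exact: eg|exact: ef]. Qed.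

Lemma entireB f g : entire f -> entire g -> entire (f \- g)%R.
Proof. by move=> ef eg z; apply: cdiffB; [exact: ef|exact: eg]. Qed.

Definition cexp z : R[i] :=
  (expR (complex.Re z) * cos (complex.Im z)) +i* (expR (complex.Re z) * sin (complex.Im z)).

Lemma cexpD z w : cexp (z + w) = cexp z * cexp w.
Proof.
case: z => a b; case: w => c d; rewrite /cexp /= expRD cosD sinD.
by apply/eqP; rewrite eq_complex /=; apply/andP; split; apply/eqP; ring.
Qed.

Lemma nrm_cexp z : nrm (cexp z) = expR (complex.Re z).
Proof.
rewrite /cexp /= !exprMn -mulrDr cos2Dsin2 mulr1 sqrtr_sqr ger0_norm //.
Qed.

(** Real counterpart of [has_cderiv], to be applied to [expR], [cos] and [sin] at 0. *)
Lemma deriv_eps (u : R -> R) (x l : R) : is_derive x (1 : R) u l ->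
  forall e : R, 0 < e -> exists2 r : R, 0 < r & forall h : R, `|h| < r ->
    `|u (h + x) - u x - l * h| <= e * `|h|.
Proof.
move=> [du <-] e e0.
have /cvgrPdist_lt/(_ e e0) := du; rewrite near_withinE => -[] /= r r0 H.
exists r => // h hr.
have [->|h0] := eqVneq h 0; first by rewrite add0r subrr mulr0 subr0 normr0 mulr0.
have := H h; rewrite /ball_ /= sub0r normrN => /(_ hr h0) /ltW.
set l' := lim _; have -> : l' = 'D_1 u x by [].
rewrite /GRing.scale /= mulr1 => H1.
have -> : u (h + x) - u x - 'D_1 u x * h = - ('D_1 u x - h^-1 * (u (h + x) - u x)) * h.
  by rewrite opprB mulrBl mulrAC mulVf // mul1r.
by rewrite normrM normrN ler_wpM2r.
Qed.

Lemma has_cderiv_cexp0 : has_cderiv cexp 0 1.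
Proof.
move=> e e0.
have [e1 [e10 e11 e1e]] : exists e1 : R, [/\ 0 < e1, e1 <= 1 & 9 * e1 <= e].
  exists (Num.min 1 (e / 9)); rewrite lt_min ltr01 divr_gt0 // ge_min lexx; split=> //.
  by rewrite mulrC -ler_pdivlMr // ge_min lexx orbT.
have [r1 r10 H1] := deriv_eps (is_derive_expR (0 : R)) e10.
have [r2 r20 H2] := deriv_eps (is_derive_cos (0 : R)) e10.
have [r3 r30 H3] := deriv_eps (is_derive_sin (0 : R)) e10.
exists (Num.min e1 (Num.min r1 (Num.min r2 r3))).
  by rewrite !lt_min e10 r10 r20 r30.
move=> h; rewrite !lt_min => /and4P[h0 h1 h2 h3].
have hx := Re_le_nrm h; have hy := Im_le_nrm h.
have {H1} := H1 _ (le_lt_trans hx h1).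
have {H2} := H2 _ (le_lt_trans hy h2).
have {H3} := H3 _ (le_lt_trans hy h3).
move: (le_lt_trans hx h0) => hx1.
have -> : cexp (0 + h) - cexp 0 - 1 * h =
    (expR (complex.Re h) * cos (complex.Im h) - 1 - complex.Re h) +i*
    (expR (complex.Re h) * sin (complex.Im h) - complex.Im h).
  rewrite add0r mul1r /cexp /= expR0 cos0 sin0 mulr1 mulr0.
  by apply/eqP; case: (h) => ? ?; rewrite eq_complex /= subr0 !eqxx.
move: (complex.Re h) (complex.Im h) (nrm h) (nrm_ge0 h) hx hy h0 h1 h2 h3 hx1.
move=> x y n n0 hx hy h0 h1 h2 h3 hx1.
rewrite !addr0 sin0 cos0 expR0 oppr0 mul0r !subr0 addr0 !mul1r => Hs Hc He.
apply: le_trans (nrm_pair _ _) _.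
have Ex3 : expR x <= 3.
  move: He; rewrite ler_norml => /andP[_]; move: (ler_norm x) => xx He.
  have : e1 * `|x| <= 1 by rewrite mulr_ile1 // ?(ltW e10) // ltW // (lt_le_trans hx1).
  by lra.
have Ex0 := expR_ge0 x.
have R1 : `|expR x * cos y - 1 - x| <= e1 * `|x| + 3 * (e1 * `|y|).
  have -> : expR x * cos y - 1 - x = (expR x - 1 - x) + expR x * (cos y - 1) by ring.
  rewrite (le_trans (ler_normD _ _)) // lerD // normrM ger0_norm //.
  by apply: ler_pM.
have R2 : `|expR x * sin y - y| <= 3 * (e1 * `|y|) + (2 * e1) * `|y|.
  have -> : expR x * sin y - y = expR x * (sin y - y) + (expR x - 1) * y by ring.
  apply: le_trans (ler_normD _ _) _; apply: lerD; rewrite normrM.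
    rewrite ger0_norm //; apply: ler_pM => //.
  rewrite ler_wpM2r //.
  have -> : expR x - 1 = (expR x - 1 - x) + x by ring.
  apply: le_trans (ler_normD _ _) _; rewrite mulrDl !mul1r; apply: lerD; last exact: ltW.
  by apply: le_trans He _; rewrite ler_piMr ?(ltW e10) // ltW // (lt_le_trans hx1).
apply: le_trans (lerD R1 R2) _.
apply: (@le_trans _ _ (9 * e1 * n)); last by rewrite ler_wpM2r.
have : e1 * `|x| <= e1 * n by rewrite ler_pM2l.
have : e1 * `|y| <= e1 * n by rewrite ler_pM2l.
by lra.
Qed.

Lemma cexp0 : cexp 0 = 1.
Proof. by rewrite /cexp /= expR0 cos0 sin0 mulr1 mulr0. Qed.

(** The functional equation transports the derivative at 0 to any point. *)
Lemma entire_cexp : entire cexp.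
Proof.
move=> z; apply/cdiffP; exists (cexp z) => e e0.
have c0 : 0 < nrm (cexp z) by rewrite nrm_cexp expR_gt0.
have [r r0 H] := has_cderiv_cexp0 (divr_gt0 e0 c0).
exists r => // h /H; rewrite add0r cexp0 mul1r => {}H.
have -> : cexp (z + h) - cexp z - cexp z * h = cexp z * (cexp h - 1 - h).
  by rewrite cexpD; ring.
by rewrite nrmM mulrC -ler_pdivlMr // mulrAC.
Qed.

End ComplexDerivative.

(** * Complex integrals over segments *)

Section SegmentIntegral.
Variable R : realType.
Notation mu := (@lebesgue_measure R).
Notation Re := (@complex.Re R).
Notation Im := (@complex.Im R).
Implicit Types (g h : R -> R[i]) (a b c t : R) (k : R[i]).

Definition seg_int a b g : R[i] :=
  (\int[mu]_(t in `[a, b]) Re (g t)) +i* (\int[mu]_(t in `[a, b]) Im (g t)).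

Definition seg_integrable a b g :=
  mu.-integrable `[a, b] (EFin \o (Re \o g)) /\
  mu.-integrable `[a, b] (EFin \o (Im \o g)).

Definition cont_at g t := forall e : R, 0 < e -> exists2 r : R, 0 < r &
  forall s, `|s - t| < r -> nrm (g s - g t) < e.

Lemma Re_subc (z w : R[i]) : Re (z - w) = Re z - Re w. Proof. by case: z w => ? ? []. Qed.
Lemma Im_subc (z w : R[i]) : Im (z - w) = Im z - Im w. Proof. by case: z w => ? ? []. Qed.
Lemma Re_addc (z w : R[i]) : Re (z + w) = Re z + Re w. Proof. by case: z w => ? ? []. Qed.
Lemma Im_addc (z w : R[i]) : Im (z + w) = Im z + Im w. Proof. by case: z w => ? ? []. Qed.
Lemma Re_mulc (z w : R[i]) : Re (z * w) = Re z * Re w - Im z * Im w.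
Proof. by case: z w => ? ? []. Qed.
Lemma Im_mulc (z w : R[i]) : Im (z * w) = Re z * Im w + Im z * Re w.
Proof. by case: z w => ? ? []. Qed.

Lemma complex_eta (z : R[i]) : z = Re z +i* Im z. Proof. by case: z. Qed.

Lemma complex_ext (z w : R[i]) : Re z = Re w -> Im z = Im w -> z = w.
Proof. by case: z w => ? ? [? ?] /= -> ->. Qed.

Lemma cont_at_integrable a b g :
  (forall t, a <= t <= b -> cont_at g t) -> seg_integrable a b g.
Proof.
move=> cg; split; apply: continuous_compact_integrable; try exact: segment_compact.
- apply: continuous_in_subspaceT => t /set_mem /=; rewrite in_itv /= => /cg H.
  apply/cvgrPdist_lt => e /H[r r0 K]; exists r => //= s sr.
  apply: le_lt_trans (K s _); last by rewrite distrC.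
  by rewrite distrC -Re_subc Re_le_nrm.
- apply: continuous_in_subspaceT => t /set_mem /=; rewrite in_itv /= => /cg H.
  apply/cvgrPdist_lt => e /H[r r0 K]; exists r => //= s sr.
  apply: le_lt_trans (K s _); last by rewrite distrC.
  by rewrite distrC -Im_subc Im_le_nrm.
Qed.

Lemma eq_seg_int a b g h : (forall t, a <= t <= b -> g t = h t) ->
  seg_int a b g = seg_int a b h.
Proof.
by move=> gh; congr Complex; apply: eq_Rintegral => t /set_mem /=;
  rewrite in_itv /= => /gh ->.
Qed.

Lemma seg_integrableD a b g h : seg_integrable a b g -> seg_integrable a b h ->
  seg_integrable a b (fun t => g t + h t).
Proof.
move=> [g1 g2] [h1 h2]; split.
- by apply: eq_integrable (integrableD _ g1 h1) => // t _; rewrite /= Re_addc.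
- by apply: eq_integrable (integrableD _ g2 h2) => // t _; rewrite /= Im_addc.
Qed.

Lemma seg_intD a b g h : seg_integrable a b g -> seg_integrable a b h ->
  seg_int a b (fun t => g t + h t) = seg_int a b g + seg_int a b h.
Proof.
move=> [g1 g2] [h1 h2]; apply: complex_ext => /=.
- rewrite -RintegralD //; apply: eq_Rintegral => t _; exact: Re_addc.
- rewrite -RintegralD //; apply: eq_Rintegral => t _; exact: Im_addc.
Qed.

Let integrableZ a b (f : R -> R) c : mu.-integrable `[a, b] (EFin \o f) ->
  mu.-integrable `[a, b] (EFin \o (fun t => c * f t)).
Proof.
move=> fi; by apply: eq_integrable (integrableZl _ c fi) => // t _.
Qed.

Lemma seg_integrableZ a b k g : seg_integrable a b g -> seg_integrable a b (fun t => k * g t).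
Proof.
move=> [g1 g2]; split.
- apply: eq_integrable (integrableB _ (integrableZ (Re k) g1) (integrableZ (Im k) g2)) => //.
  by move=> t _; rewrite /= Re_mulc.
- apply: eq_integrable (integrableD _ (integrableZ (Re k) g2) (integrableZ (Im k) g1)) => //.
  by move=> t _; rewrite /= Im_mulc.
Qed.

Lemma seg_intZ a b k g : seg_integrable a b g ->
  seg_int a b (fun t => k * g t) = k * seg_int a b g.
Proof.
move=> [g1 g2]; apply: complex_ext; rewrite ?Re_mulc ?Im_mulc /=.
- rewrite -!RintegralZl // -RintegralB ?integrableZ //.
  by apply: eq_Rintegral => t _; rewrite Re_mulc.
- rewrite -!RintegralZl // -RintegralD ?integrableZ //.
  by apply: eq_Rintegral => t _; rewrite Im_mulc.
Qed.

Lemma seg_int_split a c b g : a <= c -> c <= b -> seg_integrable a b g ->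
  seg_int a b g = seg_int a c g + seg_int c b g.
Proof.
move=> ac cb [g1 g2].
have H (f : R -> R) : mu.-integrable `[a, b] (EFin \o f) ->
    \int[mu]_(t in `[a, b]) f t =
    \int[mu]_(t in `[a, c]) f t + \int[mu]_(t in `[c, b]) f t.
  move=> fi; have := @Rintegral_itvB R f (BLeft a) (BRight b) c fi.
  rewrite !bnd_simp => /(_ ac cb) E; rewrite -[LHS](subrK (\int[mu]_(t in `[a, c]) f t)).
  rewrite E addrC; congr (_ + _); apply: Rintegral_itv_obnd_cbnd.
  apply: integrableS fi => //; apply: subset_itv; rewrite bnd_simp //.
by apply: complex_ext; rewrite /= H.
Qed.

(** Estimating the real and imaginary parts separately costs the factor 2; the
    estimates built on this one only need some constant. *)
Lemma nrm_seg_int_le_cst a b g (M : R) : a <= b -> seg_integrable a b g ->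
  (forall t, a <= t <= b -> nrm (g t) <= M) -> nrm (seg_int a b g) <= 2 * M * (b - a).
Proof.
move=> ab [g1 g2] gM.
have H (f : R -> R) : mu.-integrable `[a, b] (EFin \o f) ->
    (forall t, a <= t <= b -> `|f t| <= M) -> `|\int[mu]_(t in `[a, b]) f t| <= M * (b - a).
  move=> fi fM; apply: le_trans (le_normr_Rintegral _ fi) _ => //.
  have -> : M * (b - a) = \int[mu]_(t in `[a, b]) M.
    rewrite Rintegral_cst //= lebesgue_measure_itv /= lte_fin.
    by case: ltgtP ab => // -> _; rewrite subrr.
  apply: le_Rintegral => //; first exact: integrable_norm.
  apply: continuous_compact_integrable; first exact: segment_compact.
  by apply: continuous_subspaceT => x; exact: cvg_cst.
apply: le_trans (nrm_le_ReIm _) _; rewrite /= -mulrA [leRHS]mulr_natl mulr2n.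
apply: lerD; apply: H => // t /gM; apply: le_trans; [exact: Re_le_nrm|exact: Im_le_nrm].
Qed.

Lemma nrm_seg_int_le a b g (G : R -> R) : seg_integrable a b g ->
  mu.-integrable `[a, b] (EFin \o G) ->
  (forall t, a <= t <= b -> nrm (g t) <= G t) ->
  nrm (seg_int a b g) <= 2 * \int[mu]_(t in `[a, b]) G t.
Proof.
move=> [g1 g2] Gi gG.
have H (f : R -> R) : mu.-integrable `[a, b] (EFin \o f) ->
    (forall t, a <= t <= b -> `|f t| <= G t) ->
    `|\int[mu]_(t in `[a, b]) f t| <= \int[mu]_(t in `[a, b]) G t.
  move=> fi fM; apply: le_trans (le_normr_Rintegral _ fi) _ => //.
  by apply: le_Rintegral => //; exact: integrable_norm.
apply: le_trans (nrm_le_ReIm _) _; rewrite /= mulr_natl mulr2n.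
apply: lerD; apply: H => // t /gG; apply: le_trans; [exact: Re_le_nrm|exact: Im_le_nrm].
Qed.

End SegmentIntegral.

(** * Integrals over the boundary of a rectangle *)

Section RectangleIntegral.
Variable R : realType.
Notation Re := (@complex.Re R).
Notation Im := (@complex.Im R).
Implicit Types (g h : R[i] -> R[i]) (x y a b : R) (k w z : R[i]).

(** The contour runs counterclockwise: bottom, right, top and left sides. *)
Definition rect_int g x1 x2 y1 y2 : R[i] :=
  seg_int x1 x2 (fun x => g (x +i* y1)) + 'i * seg_int y1 y2 (fun y => g (x2 +i* y))
  - seg_int x1 x2 (fun x => g (x +i* y2)) - 'i * seg_int y1 y2 (fun y => g (x1 +i* y)).

Definition rect_integrable g x1 x2 y1 y2 :=
  [/\ seg_integrable x1 x2 (fun x => g (x +i* y1)),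
      seg_integrable y1 y2 (fun y => g (x2 +i* y)),
      seg_integrable x1 x2 (fun x => g (x +i* y2)) &
      seg_integrable y1 y2 (fun y => g (x1 +i* y))].

Definition in_rect x1 x2 y1 y2 w := (x1 <= Re w <= x2) && (y1 <= Im w <= y2).

(** A predicate on points of the plane rather than four parametrized sides, so
    that hypotheses on the integrand can be stated once. *)
Definition on_bdry x1 x2 y1 y2 w := in_rect x1 x2 y1 y2 w &&
  [|| Re w == x1, Re w == x2, Im w == y1 | Im w == y2].

Lemma cdiff_cont_horiz g x y : cdiff g (x +i* y) -> cont_at (fun t => g (t +i* y)) x.
Proof.
move=> dg e e0; have [r r0 H] := cdiff_cont dg e0; exists r => // s sx.
have E : s +i* y = x +i* y + (s - x)%:C.
  by apply: complex_ext => /=; ring.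
by rewrite E; apply: H; rewrite nrmR.
Qed.

Lemma cdiff_cont_vert g x y : cdiff g (x +i* y) -> cont_at (fun t => g (x +i* t)) y.
Proof.
move=> dg e e0; have [r r0 H] := cdiff_cont dg e0; exists r => // s sx.
have E : x +i* s = x +i* y + 'i * (s - y)%:C.
  by apply: complex_ext => /=; ring.
by rewrite E; apply: H; rewrite nrmM nrm_i mul1r nrmR.
Qed.

Lemma rect_integrable_cdiff g x1 x2 y1 y2 : x1 <= x2 -> y1 <= y2 ->
  (forall w, on_bdry x1 x2 y1 y2 w -> cdiff g w) -> rect_integrable g x1 x2 y1 y2.
Proof.
move=> x12 y12 dg; split; apply: cont_at_integrable => t tI.
- by apply: cdiff_cont_horiz; apply: dg; rewrite /on_bdry /in_rect /= tI lexx y12 eqxx !orbT.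
- by apply: cdiff_cont_vert; apply: dg; rewrite /on_bdry /in_rect /= tI lexx x12 eqxx !orbT.
- by apply: cdiff_cont_horiz; apply: dg; rewrite /on_bdry /in_rect /= tI lexx y12 eqxx !orbT.
- by apply: cdiff_cont_vert; apply: dg; rewrite /on_bdry /in_rect /= tI lexx x12 eqxx.
Qed.

Lemma eq_rect_int g h x1 x2 y1 y2 : x1 <= x2 -> y1 <= y2 ->
  (forall w, on_bdry x1 x2 y1 y2 w -> g w = h w) ->
  rect_int g x1 x2 y1 y2 = rect_int h x1 x2 y1 y2.
Proof.
move=> x12 y12 gh; rewrite /rect_int; congr (_ + 'i * _ - _ - 'i * _);
  apply: eq_seg_int => t tI; apply: gh;
  by rewrite /on_bdry /in_rect /= tI lexx ?x12 ?y12 eqxx ?orbT.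
Qed.

Lemma rect_intD g h x1 x2 y1 y2 : rect_integrable g x1 x2 y1 y2 -> rect_integrable h x1 x2 y1 y2 ->
  rect_int (fun w => g w + h w) x1 x2 y1 y2 = rect_int g x1 x2 y1 y2 + rect_int h x1 x2 y1 y2.
Proof.
by move=> [g1 g2 g3 g4] [h1 h2 h3 h4]; rewrite /rect_int !seg_intD //; ring.
Qed.

Lemma rect_intZ k g x1 x2 y1 y2 : rect_integrable g x1 x2 y1 y2 ->
  rect_int (fun w => k * g w) x1 x2 y1 y2 = k * rect_int g x1 x2 y1 y2.
Proof. by move=> [g1 g2 g3 g4]; rewrite /rect_int !seg_intZ //; ring. Qed.

Lemma rect_integrableD g h x1 x2 y1 y2 : rect_integrable g x1 x2 y1 y2 ->
  rect_integrable h x1 x2 y1 y2 -> rect_integrable (fun w => g w + h w) x1 x2 y1 y2.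
Proof.
by move=> [g1 g2 g3 g4] [h1 h2 h3 h4]; split; exact: seg_integrableD.
Qed.

Lemma rect_integrableZ k g x1 x2 y1 y2 : rect_integrable g x1 x2 y1 y2 ->
  rect_integrable (fun w => k * g w) x1 x2 y1 y2.
Proof. by move=> [g1 g2 g3 g4]; split; exact: seg_integrableZ. Qed.

Lemma nrm_rect_int_le g x1 x2 y1 y2 (M : R) : x1 <= x2 -> y1 <= y2 ->
  rect_integrable g x1 x2 y1 y2 ->
  (forall w, on_bdry x1 x2 y1 y2 w -> nrm (g w) <= M) ->
  nrm (rect_int g x1 x2 y1 y2) <= 4 * M * ((x2 - x1) + (y2 - y1)).
Proof.
move=> x12 y12 [g1 g2 g3 g4] gM.
have H : nrm (rect_int g x1 x2 y1 y2) <=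
    nrm (seg_int x1 x2 (fun x => g (x +i* y1))) + nrm (seg_int y1 y2 (fun y => g (x2 +i* y)))
  + nrm (seg_int x1 x2 (fun x => g (x +i* y2))) + nrm (seg_int y1 y2 (fun y => g (x1 +i* y))).
  rewrite /rect_int; apply: le_trans (nrmB _ _) _; rewrite nrmM nrm_i mul1r lerD2r.
  apply: le_trans (nrmB _ _) _; rewrite lerD2r.
  by apply: le_trans (nrmD _ _) _; rewrite nrmM nrm_i mul1r.
apply: le_trans H _.
have -> : 4 * M * (x2 - x1 + (y2 - y1)) =
  2 * M * (x2 - x1) + 2 * M * (y2 - y1) + 2 * M * (x2 - x1) + 2 * M * (y2 - y1) by ring.
by do 3 ?apply: lerD; apply: nrm_seg_int_le_cst => // t tI; apply: gM;
  rewrite /on_bdry /in_rect /= tI lexx ?x12 ?y12 eqxx ?orbT.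
Qed.

Lemma rect_int_splitx g x1 x2 x3 y1 y2 : x1 <= x2 -> x2 <= x3 ->
  seg_integrable x1 x3 (fun x => g (x +i* y1)) -> seg_integrable x1 x3 (fun x => g (x +i* y2)) ->
  rect_int g x1 x3 y1 y2 = rect_int g x1 x2 y1 y2 + rect_int g x2 x3 y1 y2.
Proof.
move=> x12 x23 g1 g2; rewrite /rect_int (seg_int_split x12 x23 g1) (seg_int_split x12 x23 g2).
by ring.
Qed.

Lemma rect_int_splity g x1 x2 y1 y2 y3 : y1 <= y2 -> y2 <= y3 ->
  seg_integrable y1 y3 (fun y => g (x1 +i* y)) -> seg_integrable y1 y3 (fun y => g (x2 +i* y)) ->
  rect_int g x1 x2 y1 y3 = rect_int g x1 x2 y1 y2 + rect_int g x1 x2 y2 y3.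
Proof.
move=> y12 y23 g1 g2; rewrite /rect_int (seg_int_split y12 y23 g1) (seg_int_split y12 y23 g2).
by ring.
Qed.

Lemma seg_int_cst a b k : a <= b -> seg_int a b (fun=> k) = k * (b - a)%:C.
Proof.
move=> ab; rewrite /seg_int !Rintegral_cst //= lebesgue_measure_itv /= lte_fin.
have -> : fine (if a < b then (b%:E - a%:E)%E else 0%E) = b - a.
  by case: ltgtP ab => // -> _; rewrite subrr.
by apply: complex_ext; rewrite ?Re_mulc ?Im_mulc /=; ring.
Qed.

(** On opposite sides the values of an affine function differ by a constant, so
    pairing the sides leaves only integrals of constants, which cancel. *)
Lemma rect_int_affine k1 k2 x1 x2 y1 y2 : x1 <= x2 -> y1 <= y2 ->
  rect_int (fun w => k1 + k2 * w) x1 x2 y1 y2 = 0.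
Proof.
move=> x12 y12.
have [i1 i2 i3 i4] : rect_integrable (fun w => k1 + k2 * w) x1 x2 y1 y2.
  apply: rect_integrable_cdiff => // w _; apply: cdiffD; first exact: cdiff_cst.
  by apply: cdiffM; [exact: cdiff_cst|exact: cdiff_id].
have H : seg_int x1 x2 (fun x => k1 + k2 * (x +i* y1)) - seg_int x1 x2 (fun x => k1 + k2 * (x +i* y2))
    = k2 * 'i * (y1 - y2)%:C * (x2 - x1)%:C.
  rewrite -(mulN1r (seg_int x1 x2 (fun x => k1 + k2 * (x +i* y2)))) -(seg_intZ _ i3).
  rewrite -seg_intD //; last exact: seg_integrableZ.
  rewrite -seg_int_cst //; apply: eq_seg_int => t _.
  by apply: complex_ext; rewrite !(Re_addc,Im_addc,Re_mulc,Im_mulc) /=; ring.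
have V : seg_int y1 y2 (fun y => k1 + k2 * (x2 +i* y)) - seg_int y1 y2 (fun y => k1 + k2 * (x1 +i* y))
    = k2 * (x2 - x1)%:C * (y2 - y1)%:C.
  rewrite -(mulN1r (seg_int y1 y2 (fun x => k1 + k2 * (x1 +i* x)))) -(seg_intZ _ i4).
  rewrite -seg_intD //; last exact: seg_integrableZ.
  rewrite -seg_int_cst //; apply: eq_seg_int => t _.
  by apply: complex_ext; rewrite !(Re_addc,Im_addc,Re_mulc,Im_mulc) /=; ring.
rewrite /rect_int; transitivity (
  seg_int x1 x2 (fun x => k1 + k2 * (x +i* y1)) - seg_int x1 x2 (fun x => k1 + k2 * (x +i* y2))
  + 'i * (seg_int y1 y2 (fun y => k1 + k2 * (x2 +i* y)) - seg_int y1 y2 (fun y => k1 + k2 * (x1 +i* y)))).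
  by ring.
rewrite H V; have -> : (y1 - y2)%:C = - (y2 - y1)%:C :> R[i] by apply: complex_ext => /=; ring.
by ring.
Qed.

End RectangleIntegral.

(** * Goursat's theorem *)

Section Goursat.
Variable R : realType.
Implicit Types (g h : R[i] -> R[i]) (x y a b s : R) (k w z : R[i]).

(** The supremum of the left end points lies in every interval. *)
Lemma nested_intervals (u v : nat -> R) : (forall n, u n <= v n) ->
  (forall n, u n <= u n.+1) -> (forall n, v n.+1 <= v n) ->
  exists x, forall n, u n <= x <= v n.
Proof.
move=> uv /nondecreasing_seqP iu /nonincreasing_seqP dv.
have ub m : ubound (range u) (v m).
  move=> _ [n _ <-]; apply: (@le_trans _ _ (u (maxn n m))); first by rewrite iu // leq_maxl.
  by rewrite (le_trans (uv _)) // dv // leq_maxr.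
exists (sup (range u)) => n; apply/andP; split.
  by apply: ub_le_sup; [exists (v 0%N)|exists n].
by apply: ge_sup; [exists (u 0%N), 0%N|exact: ub].
Qed.

Lemma exists_small_pow2 (c r : R) : 0 < r -> exists n, c / 2 ^+ n < r.
Proof.
move=> r0; exists (Num.truncn (`|c| / r)).+1.
rewrite ltr_pdivrMr ?exprn_gt0 // mulrC -ltr_pdivrMr //.
apply: le_lt_trans (ler_norm _) _; rewrite normrM normfV (gtr0_norm r0).
apply: lt_trans (truncnS_gt _) _; rewrite -natrX ltr_nat.
exact: ltn_expl.
Qed.

(** The contributions of the inner sides of four quarters cancel, so one quarter
    carries at least a fourth of the integral. *)
Lemma goursat_step g x y l m : 0 <= l -> 0 <= m ->
  (forall w, in_rect x (x + (l + l)) y (y + (m + m)) w -> cdiff g w) ->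
  exists p, [/\ x <= p.1, p.1 + l <= x + (l + l), y <= p.2, p.2 + m <= y + (m + m) &
    nrm (rect_int g x (x + (l + l)) y (y + (m + m))) <=
    4 * nrm (rect_int g p.1 (p.1 + l) p.2 (p.2 + m))].
Proof.
move=> l0 m0 dg.
have E : rect_int g x (x + (l + l)) y (y + (m + m)) =
  (rect_int g x (x + l) y (y + m) + rect_int g x (x + l) (y + m) (y + m + m)) +
  (rect_int g (x + l) (x + l + l) y (y + m) + rect_int g (x + l) (x + l + l) (y + m) (y + m + m)).
  rewrite [x + (l + l)]addrA [y + (m + m)]addrA.
  rewrite (@rect_int_splitx _ _ _ (x + l)) ?lerDl //; last 2 first.
  - apply: cont_at_integrable => t tI; apply: cdiff_cont_horiz; apply: dg.
    by rewrite /in_rect /= addrA tI lexx lerDl addr_ge0.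
  - apply: cont_at_integrable => t tI; apply: cdiff_cont_horiz; apply: dg.
    by rewrite /in_rect /= !addrA tI lexx -addrA lerDl addr_ge0.
  have H x' : x <= x' <= x + (l + l) -> seg_integrable y (y + m + m) (fun y => g (x' +i* y)).
    move=> xI; apply: cont_at_integrable => t tI; apply: cdiff_cont_vert; apply: dg.
    by rewrite /in_rect /= xI addrA tI.
  congr (_ + _); apply: rect_int_splity; rewrite ?lerDl //; apply: H; rewrite ?addrA;
    apply/andP; split; by rewrite -?addrA ?lerD2l ?lerDl ?addr_ge0.
pose A := nrm (rect_int g x (x + l) y (y + m)).
pose B := nrm (rect_int g x (x + l) (y + m) (y + m + m)).
pose C := nrm (rect_int g (x + l) (x + l + l) y (y + m)).
pose D := nrm (rect_int g (x + l) (x + l + l) (y + m) (y + m + m)).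
have T : nrm (rect_int g x (x + (l + l)) y (y + (m + m))) <= (A + B) + (C + D).
  rewrite E; apply: le_trans (nrmD _ _) _; apply: lerD; exact: nrmD.
have [?|hA] := leP (nrm (rect_int g x (x + (l + l)) y (y + (m + m)))) (4 * A).
  by exists (x, y); split => //=; lra.
have [?|hB] := leP (nrm (rect_int g x (x + (l + l)) y (y + (m + m)))) (4 * B).
  by exists (x, y + m); split => //=; lra.
have [?|hC] := leP (nrm (rect_int g x (x + (l + l)) y (y + (m + m)))) (4 * C).
  by exists (x + l, y); split => //=; lra.
have [?|hD] := leP (nrm (rect_int g x (x + (l + l)) y (y + (m + m)))) (4 * D).
  by exists (x + l, y + m); split => //=; lra.
by exfalso; lra.
Qed.

Lemma half_pow2 (c : R) n : c / 2 ^+ n = c / 2 ^+ n.+1 + c / 2 ^+ n.+1.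
Proof.
rewrite exprSr invfM mulrA -splitr //.
Qed.

(** Repeated quartering produces nested rectangles, of size [2 ^- n] and with an
    integral of at least [4 ^- n] times the initial one, which shrink to a point.
    Near that point [g] is affine up to an error [o(2 ^- n)]; the affine part
    contributes nothing, and the error contributes [o(4 ^- n)]. *)
Lemma goursat g x1 x2 y1 y2 : x1 <= x2 -> y1 <= y2 ->
  (forall w, in_rect x1 x2 y1 y2 w -> cdiff g w) -> rect_int g x1 x2 y1 y2 = 0.
Proof.
move=> x12 y12 dg; apply/eqP/negPn; rewrite -nrm_gt0; apply/negP.
set d := nrm _ => d0.
set L := x2 - x1; set H := y2 - y1.
have L0 : 0 <= L by rewrite subr_ge0.
have H0 : 0 <= H by rewrite subr_ge0.
have Ln n : 0 <= L / 2 ^+ n by rewrite divr_ge0 // exprn_ge0.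
have Hn n : 0 <= H / 2 ^+ n by rewrite divr_ge0 // exprn_ge0.
pose Q n (p : R * R) := [/\ x1 <= p.1, p.1 + L / 2 ^+ n <= x2, y1 <= p.2,
  p.2 + H / 2 ^+ n <= y2 &
  d <= 4 ^+ n * nrm (rect_int g p.1 (p.1 + L / 2 ^+ n) p.2 (p.2 + H / 2 ^+ n))].
have step (np : nat * (R * R)) : exists p', Q np.1 np.2 ->
   [/\ Q np.1.+1 p', np.2.1 <= p'.1,
     p'.1 + L / 2 ^+ np.1.+1 <= np.2.1 + L / 2 ^+ np.1, np.2.2 <= p'.2 &
     p'.2 + H / 2 ^+ np.1.+1 <= np.2.2 + H / 2 ^+ np.1].
  case: np => n p /=.
  have [Qp|/contrapT Qp] := pselect (~ Q n p); first by exists p.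
  case: (Qp) => q1 q2 q3 q4 q5.
  have [|p' []] := @goursat_step g p.1 p.2 _ _ (Ln n.+1) (Hn n.+1).
    move=> w; rewrite -!half_pow2 => /andP[/andP[w1 w2] /andP[w3 w4]]; apply: dg.
    by rewrite /in_rect (le_trans q1) // (le_trans w2) // (le_trans q3) // (le_trans w4).
  rewrite -!half_pow2 => p1 p2 p3 p4 p5; exists p' => _; split => //; split.
  - exact: le_trans q1 p1.
  - exact: le_trans p2 q2.
  - exact: le_trans q3 p3.
  - exact: le_trans p4 q4.
  - by rewrite (le_trans q5) // exprSr -mulrA ler_pM2l ?exprn_gt0.
have {step} [F HF] := choice step.
pose u := fix u n := if n is m.+1 then F (m, u m) else (x1, y1).
have Qu n : Q n (u n).
  elim: n => [|n IH]; last by have [] := HF (n, u n) IH.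
  by rewrite /Q /= expr0 !divr1 mul1r /L /H !subrKC.
have [X HX] : exists X, forall n, (u n).1 <= X <= (u n).1 + L / 2 ^+ n.
  apply: nested_intervals => n; first by rewrite lerDl.
    by have [] := HF (n, u n) (Qu n).
  by have [] := HF (n, u n) (Qu n).
have [Y HY] : exists Y, forall n, (u n).2 <= Y <= (u n).2 + H / 2 ^+ n.
  apply: nested_intervals => n; first by rewrite lerDl.
    by have [] := HF (n, u n) (Qu n).
  by have [] := HF (n, u n) (Qu n).
set p := X +i* Y.
have /cdiffP[k dk] : cdiff g p.
  apply: dg; rewrite /in_rect /=; move: (HX 0%N) (HY 0%N) => /=.
  by rewrite expr0 !divr1 /L /H !subrKC => -> ->.
pose S := L + H; have S0 : 0 <= S by rewrite addr_ge0.
have S1 : 0 < 8 * (S + 1) ^+ 2 by rewrite mulr_gt0 // exprn_gt0 // ltr_wpDl.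
have [r r0 Hr] := dk _ (divr_gt0 d0 S1).
set e := d / _ in Hr.
have [n Hn'] := exists_small_pow2 S r0.
have [q1 q2 q3 q4 q5] := Qu n.
set a1 := (u n).1 in q1 q2 q5; set a2 := (u n).1 + L / 2 ^+ n in q2 q5.
set b1 := (u n).2 in q3 q4 q5; set b2 := (u n).2 + H / 2 ^+ n in q4 q5.
have a12 : a1 <= a2 by rewrite lerDl.
have b12 : b1 <= b2 by rewrite lerDl.
have dgn w : in_rect a1 a2 b1 b2 w -> cdiff g w.
  move=> /andP[/andP[w1 w2] /andP[w3 w4]]; apply: dg.
  by rewrite /in_rect (le_trans q1) // (le_trans w2) // (le_trans q3) // (le_trans w4).
have wp w : in_rect a1 a2 b1 b2 w -> nrm (w - p) <= S / 2 ^+ n.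
  move=> /andP[/andP[w1 w2] /andP[w3 w4]].
  apply: le_trans (nrm_le_ReIm _) _; rewrite /S mulrDl.
  move: (HX n) (HY n); rewrite -/a1 -/a2 -/b1 -/b2 => /andP[X1 X2] /andP[Y1 Y2].
  have La : L / 2 ^+ n = a2 - a1 by rewrite /a2 /a1 addrAC subrr add0r.
  have Lb : H / 2 ^+ n = b2 - b1 by rewrite /b2 /b1 addrAC subrr add0r.
  apply: lerD; rewrite ?Re_subc ?Im_subc /= ler_norml; apply/andP; split; lra.
pose aff w := (g p - k * p) + k * w.
pose err w := g w - aff w.
have daff w : cdiff aff w.
  apply: cdiffD; first exact: cdiff_cst.
  by apply: cdiffM; [exact: cdiff_cst|exact: cdiff_id].
have bI w : on_bdry a1 a2 b1 b2 w -> in_rect a1 a2 b1 b2 w by case/andP.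
have E : rect_int g a1 a2 b1 b2 = rect_int err a1 a2 b1 b2.
  have -> : rect_int g a1 a2 b1 b2 = rect_int (fun w => aff w + err w) a1 a2 b1 b2.
    by apply: eq_rect_int => // w _; rewrite /err addrC subrK.
  rewrite rect_intD; first by rewrite rect_int_affine // add0r.
  - by apply: rect_integrable_cdiff.
  - by apply: rect_integrable_cdiff => // w /bI/dgn; move/cdiffB; apply.
have B : nrm (rect_int err a1 a2 b1 b2) <= 4 * (e * (S / 2 ^+ n)) * (S / 2 ^+ n).
  have -> : S / 2 ^+ n = (a2 - a1) + (b2 - b1).
    by rewrite /S mulrDl /a2 /a1 /b2 /b1; ring.
  apply: nrm_rect_int_le => //.
    by apply: rect_integrable_cdiff => // w /bI/dgn; move/cdiffB; apply.
  move=> w /bI wI; have := Hr (w - p) (le_lt_trans (wp _ wI) Hn').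
  rewrite subrKC => h1.
  have -> : err w = g w - g p - k * (w - p) by rewrite /err /aff; ring.
  apply: le_trans h1 _; rewrite ler_pM2l ?divr_gt0 //.
  have -> : a2 - a1 + (b2 - b1) = S / 2 ^+ n.
    by rewrite /S mulrDl /a2 /a1 /b2 /b1; ring.
  exact: wp.
move: q5; rewrite E => q5.
have : d <= 4 ^+ n * (4 * (e * (S / 2 ^+ n)) * (S / 2 ^+ n)).
  by apply: le_trans q5 _; rewrite ler_pM2l ?exprn_gt0.
have -> : 4 ^+ n * (4 * (e * (S / 2 ^+ n)) * (S / 2 ^+ n)) = 4 * e * S ^+ 2.
  have -> : (4 : R) = 2 * 2 by rewrite -natrM.
  rewrite exprMn; field; by rewrite expf_neq0.
have eS : e * (8 * (S + 1) ^+ 2) = d by rewrite /e divfK // lt0r_neq0.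
have e0 : 0 < e by rewrite divr_gt0.
nra.
Qed.

End Goursat.

(** * Cauchy's formula on rectangles *)

Section CauchyFormula.
Variable R : realType.
Notation mu := (@lebesgue_measure R).
Notation Re := (@complex.Re R).
Notation Im := (@complex.Im R).
Implicit Types (f g h : R[i] -> R[i]) (x y a b s : R) (k w z : R[i]).

(** The region between the two rectangles is cut into four rectangles which avoid
    [a +i* b], and the integral vanishes on each of them. *)
Lemma rect_int_shrink g a b s x1 x2 y1 y2 : 0 < s ->
  x1 <= a - s -> a + s <= x2 -> y1 <= b - s -> b + s <= y2 ->
  (forall w, w != a +i* b -> cdiff g w) ->
  rect_int g x1 x2 y1 y2 = rect_int g (a - s) (a + s) (b - s) (b + s).
Proof.
move=> s0 xa ax yb by2 dg.
have aa : a - s <= a + s by lra.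
have bb : b - s <= b + s by lra.
have Hh u v y : y != b -> seg_integrable u v (fun x => g (x +i* y)).
  move=> yb'; apply: cont_at_integrable => t _; apply: cdiff_cont_horiz; apply: dg.
  by apply: contra_neq yb' => -[].
have Hv u v x : x != a -> seg_integrable u v (fun y => g (x +i* y)).
  move=> xa'; apply: cont_at_integrable => t _; apply: cdiff_cont_vert; apply: dg.
  by apply: contra_neq xa' => -[].
have nea u : u <= a - s -> u != a by move=> ua; apply/eqP => ?; lra.
have nea' u : a + s <= u -> u != a by move=> ua; apply/eqP => ?; lra.
have neb u : u <= b - s -> u != b by move=> ua; apply/eqP => ?; lra.
have neb' u : b + s <= u -> u != b by move=> ua; apply/eqP => ?; lra.
have ax2 : a - s <= x2 by lra.
have by3 : b - s <= y2 by lra.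
have y12 : y1 <= y2 by lra.
rewrite (@rect_int_splitx _ g x1 (a - s) x2) ?Hh ?neb ?neb' //.
rewrite (@rect_int_splitx _ g (a - s) (a + s) x2) ?Hh ?neb ?neb' //.
rewrite (@rect_int_splity _ g (a - s) (a + s) y1 (b - s) y2) ?Hv ?nea ?nea' //.
rewrite (@rect_int_splity _ g (a - s) (a + s) (b - s) (b + s) y2) ?Hv ?nea ?nea' //.
have G u1 u2 v1 v2 : u1 <= u2 -> v1 <= v2 ->
    [|| u2 <= a - s, a + s <= u1, v2 <= b - s | b + s <= v1] -> rect_int g u1 u2 v1 v2 = 0.
  move=> u12 v12 out; apply: goursat => // w /andP[/andP[w1 w2] /andP[w3 w4]].
  by apply: dg; apply/eqP => E; move: w1 w2 w3 w4; rewrite E /= => *;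
    case/or4P: out => ?; lra.
rewrite (G x1) ?lexx ?orbT // (G (a + s)) ?lexx ?orbT //.
rewrite (G _ _ y1) ?lexx ?orbT // (G _ _ (b + s)) ?lexx ?orbT //.
by rewrite add0r !addr0 add0r.
all: by [apply: Hh; apply: neb|apply: Hh; apply: neb'|apply: Hv; apply: nea|apply: Hv; apply: nea'].
Qed.

(** Pairing opposite sides exhibits cancellations before any integral is computed. *)
Lemma rect_int_diff g x1 x2 y1 y2 : rect_integrable g x1 x2 y1 y2 ->
  rect_int g x1 x2 y1 y2 =
  seg_int x1 x2 (fun x => g (x +i* y1) - g (x +i* y2)) +
  'i * seg_int y1 y2 (fun y => g (x2 +i* y) - g (x1 +i* y)).
Proof.
move=> [g1 g2 g3 g4].
have B a b (u v : R -> R[i]) : seg_integrable a b u -> seg_integrable a b v ->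
    seg_int a b (fun t => u t - v t) = seg_int a b u - seg_int a b v.
  move=> iu iv; rewrite -mulN1r -seg_intZ // -seg_intD //; last exact: seg_integrableZ.
  by apply: eq_seg_int => t _; rewrite mulN1r.
by rewrite !B // /rect_int; ring.
Qed.

(** The primitive is [atan ((t - a) / s)], which takes the values [- pi / 4] and
    [pi / 4] at the end points. *)
Lemma integral_poisson_kernel a s : 0 < s ->
  \int[mu]_(t in `[a - s, a + s]) (s / ((t - a) ^+ 2 + s ^+ 2)) = pi / 2.
Proof.
move=> s0; have sn0 : s != 0 by rewrite gt_eqF.
have den t : (t - a) ^+ 2 + s ^+ 2 != 0.
  by rewrite gt_eqF // ltr_wpDl ?sqr_ge0 // exprn_gt0.
have dF t : is_derive (t : R) (1 : R) (fun t => atan ((t - a) / s)) (s / ((t - a) ^+ 2 + s ^+ 2)).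
  have d1 : is_derive (t : R) (1 : R) (fun t : R => (t - a) / s) (s^-1).
    have -> : (fun t : R => (t - a) / s) = (fun t => s^-1 *: (t - a)).
      by apply/funext => u; rewrite /GRing.scale /= mulrC.
    apply: is_derive_eq; by rewrite subr0 /GRing.scale /= mulr1.
  apply: is_derive_eq (is_derive1_comp (is_derive1_atan _) d1) _.
  by field; rewrite sn0 den.
have := @continuous_FTC2 R (fun t => s / ((t - a) ^+ 2 + s ^+ 2))
  (fun t => atan ((t - a) / s)) (a - s) (a + s).
rewrite /Rintegral => ->.
- have -> : (a + s - a) / s = 1 by field.
  have -> : (a - s - a) / s = - 1 by field.
  by rewrite /= atanN atan1; field.
- by lra.
- apply: continuous_subspaceT => t.
  apply: cvgM; first exact: cvg_cst.
  apply: cvgV => //; apply: cvgD; last exact: cvg_cst.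
  by apply: cvgM; apply: cvgB; [exact: cvg_id|exact: cvg_cst|exact: cvg_id|exact: cvg_cst].
- have cF t : {for t, continuous (fun t => atan ((t - a) / s))}.
    by apply: differentiable_continuous; apply/derivable1_diffP; have [] := dF t.
  split => //=.
  - exact: cvg_at_right_filter (cF _).
  - exact: cvg_at_left_filter (cF _).
- by move=> t _; rewrite derive1E; have [_ ->] := dF t.
Qed.

Lemma cdiff_kernel z w : w != z -> cdiff (fun u => (u - z)^-1) w.
Proof.
move=> wz; apply: (@cdiffV _ (fun u => u - z)); first by rewrite subr_eq0.
by apply: cdiffB; [exact: cdiff_id|exact: cdiff_cst].
Qed.

(** The sum over opposite sides of a square of [(w - z)^-1] is twice a Poisson
    kernel; the logarithmic parts cancel. *)
Lemma rect_int_kernel a b s : 0 < s ->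
  rect_int (fun w => (w - (a +i* b))^-1) (a - s) (a + s) (b - s) (b + s) = 2 * pi%:C * 'i.
Proof.
move=> s0.
rewrite rect_int_diff; last first.
  apply: rect_integrable_cdiff; [lra|lra|] => w /andP[/andP[/andP[w1 w2] /andP[w3 w4]] wb].
  apply: cdiff_kernel; apply/eqP => E; move: w1 w2 w3 w4 wb.
  by rewrite E /= => ? ? ? ? /or4P[]/eqP; lra.
have den t : (t ^+ 2 + s ^+ 2) != 0.
  by rewrite gt_eqF // ltr_wpDl ?sqr_ge0 // exprn_gt0.
have I a' : mu.-integrable `[a' - s, a' + s] (EFin \o (fun t => s / ((t - a') ^+ 2 + s ^+ 2))).
  apply: continuous_compact_integrable; first exact: segment_compact.
  apply: continuous_subspaceT => t; apply: cvgM; first exact: cvg_cst.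
  apply: cvgV => //; apply: cvgD; last exact: cvg_cst.
  by apply: cvgM; apply: cvgB; [exact: cvg_id|exact: cvg_cst|exact: cvg_id|exact: cvg_cst].
have P a' k : seg_int (a' - s) (a' + s) (fun t => k * (s / ((t - a') ^+ 2 + s ^+ 2))%:C) = k * (pi / 2)%:C.
  rewrite seg_intZ; last first.
    split; first exact: I.
    by apply: eq_integrable (integrable0 _ _) => // t _.
  congr (_ * _); apply: complex_ext; rewrite /= ?integral_poisson_kernel //.
  by rewrite Rintegral_cst // mul0r.
rewrite (@eq_seg_int _ _ _ _ (fun t => 2 * 'i * (s / ((t - a) ^+ 2 + s ^+ 2))%:C)); last first.
  move=> t _; apply: complex_ext; rewrite ?(Re_subc,Im_subc) /=;
    field; by rewrite ?sqrrN -?expr2 ?den ?addr0.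
rewrite P (@eq_seg_int _ _ _ _ (fun t => 2 * (s / ((t - b) ^+ 2 + s ^+ 2))%:C)); last first.
  move=> t _; apply: complex_ext; rewrite ?(Re_subc,Im_subc) /=;
    field; by rewrite ?sqrrN -?expr2 ?den ?addr0.
rewrite P; have -> : pi%:C = 2 * (pi / 2)%:C :> R[i].
  by apply: complex_ext; rewrite ?Re_mulc ?Im_mulc /=; field.
by ring.
Qed.

(** Shrink the contour to a small square of side [2 s] around [z]: the constant
    [f z] contributes the value of the kernel integral, and the difference
    quotient of [f] at [z] is bounded, so the rest is at most a multiple of [s]. *)
Lemma cauchy_rectangle f z x1 x2 y1 y2 :
  x1 < Re z -> Re z < x2 -> y1 < Im z -> Im z < y2 -> (forall w, cdiff f w) ->
  rect_int (fun w => f w * (w - z)^-1) x1 x2 y1 y2 = 2 * pi%:C * 'i * f z.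
Proof.
case: z => a b /= xa ax yb b2 df.
set z := a +i* b; set g := fun w => _.
have dg w : w != z -> cdiff g w.
  by move=> wz; apply: cdiffM; [exact: df|exact: cdiff_kernel].
apply/eqP; rewrite -subr_eq0 -nrm_eq0 eq_le nrm_ge0 andbT; apply/ler_addgt0Pr => e e0.
rewrite add0r.
have /cdiffP[d /(_ _ ltr01)[r r0 Hr]] := df z.
set M := 1 + nrm d; have M0 : 0 < M by rewrite ltr_pwDl ?nrm_ge0.
pose m := Num.min (Num.min (a - x1) (x2 - a)) (Num.min (b - y1) (y2 - b)).
have m0 : 0 < m by rewrite /m !lt_min !subr_gt0 xa ax yb b2.
pose s := Num.min m (Num.min (r / 3) (e / (16 * M))).
have s0 : 0 < s by rewrite lt_min m0 lt_min !divr_gt0 // mulr_gt0.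
have [sm sr se] : [/\ s <= m, s <= r / 3 & s <= e / (16 * M)].
  by clearbody m; rewrite /s; split; rewrite ge_min ?lexx // ge_min lexx ?orbT.
have [sx1 sx2 sy1 sy2] : [/\ s <= a - x1, s <= x2 - a, s <= b - y1 & s <= y2 - b].
  by split; apply: le_trans sm _; rewrite /m !ge_min lexx ?orbT.
clearbody s.
rewrite (@rect_int_shrink g a b s) //; try lra.
have bz w : on_bdry (a - s) (a + s) (b - s) (b + s) w -> w != z.
  move=> /andP[/andP[/andP[w1 w2] /andP[w3 w4]] wb]; apply/eqP => E.
  by move: w1 w2 w3 w4 wb; rewrite E /= => ? ? ? ? /or4P[]/eqP; lra.
have ik : rect_integrable (fun w => (w - z)^-1) (a - s) (a + s) (b - s) (b + s).
  by apply: rect_integrable_cdiff; [lra|lra|] => w /bz; exact: cdiff_kernel.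
pose q w := (f w - f z) * (w - z)^-1.
have iq : rect_integrable q (a - s) (a + s) (b - s) (b + s).
  apply: rect_integrable_cdiff; [lra|lra|] => w /bz wz; apply: cdiffM; last exact: cdiff_kernel.
  by apply: cdiffB; [exact: df|exact: cdiff_cst].
have -> : rect_int g (a - s) (a + s) (b - s) (b + s) =
    rect_int q (a - s) (a + s) (b - s) (b + s) + f z * (2 * pi%:C * 'i).
  rewrite -(@rect_int_kernel a b s) // -rect_intZ // -rect_intD //; last exact: rect_integrableZ.
  by apply: eq_rect_int; [lra|lra|] => w _; rewrite /q /g; ring.
rewrite (mulrC (f z)) addrK.
apply: (@le_trans _ _ (4 * M * ((a + s - (a - s)) + (b + s - (b - s))))).
  apply: nrm_rect_int_le; [lra|lra|exact: iq|] => w wb.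
  have wz := bz _ wb.
  have ws : nrm (w - z) <= 2 * s.
    move: wb => /andP[/andP[/andP[w1 w2] /andP[w3 w4]] _].
    apply: le_trans (nrm_le_ReIm _) _; rewrite mulr_natl mulr2n Re_subc Im_subc /=.
    by apply: lerD; rewrite ler_norml; apply/andP; split; lra.
  have := Hr (w - z); rewrite subrKC => /(_ _) H.
  rewrite /q nrmM nrmV ler_pdivrMr ?nrm_gt0 ?subr_eq0 // /M mulrDl.
  rewrite -[f w - f z](subrK (d * (w - z))).
  apply: le_trans (nrmD _ _) _; rewrite nrmM lerD2r; apply: H.
  by apply: le_lt_trans ws _; lra.
have : s * (16 * M) <= e by rewrite -ler_pdivlMr // mulr_gt0.
by lra.
Qed.

End CauchyFormula.

(** * Consequences of the Cauchy formula *)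

Section CauchyEstimates.
Variable R : realType.
Notation mu := (@lebesgue_measure R).
Notation Re := (@complex.Re R).
Notation Im := (@complex.Im R).
Implicit Types (f g : R[i] -> R[i]) (a b r s : R) (h k w z : R[i]).

(** In the estimates below, dividing by this constant can only improve a bound. *)
Lemma nrm_2pii : 1 <= nrm (2 * pi%:C * 'i : R[i]).
Proof.
rewrite !nrmM nrm_i mulr1 nrmR (ger0_norm (pi_ge0 R)).
have -> : nrm (2 : R[i]) = 2.
  have -> : (2 : R[i]) = (2 : R)%:C by rewrite -[RHS]/(real_complex R 2) rmorphMn rmorph1.
  by rewrite nrmR ger0_norm.
by have := pi_ge2 R; lra.
Qed.

Lemma bdry_dist a b r x1 x2 y1 y2 w : 0 < r ->
  x1 <= a - r -> a + r <= x2 -> y1 <= b - r -> b + r <= y2 ->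
  on_bdry x1 x2 y1 y2 w -> r <= nrm (w - (a +i* b)).
Proof.
move=> r0 xa ax yb b2 /andP[_ wb].
have hR := Re_le_nrm (w - (a +i* b)); have hI := Im_le_nrm (w - (a +i* b)).
rewrite Re_subc Im_subc /= in hR hI.
have [n1 n2] := (ler_norm (Re w - a), ler_norm (- (Re w - a))).
have [n3 n4] := (ler_norm (Im w - b), ler_norm (- (Im w - b))).
rewrite normrN in n2; rewrite normrN in n4.
by case/or4P: wb => /eqP E; lra.
Qed.

Lemma bdry_dist_le a b r w :
  in_rect (a - r) (a + r) (b - r) (b + r) w -> nrm (w - (a +i* b)) <= 2 * r.
Proof.
move=> /andP[/andP[w1 w2] /andP[w3 w4]].
apply: le_trans (nrm_le_ReIm _) _; rewrite mulr_natl mulr2n Re_subc Im_subc /=.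
by apply: lerD; rewrite ler_norml; apply/andP; split; lra.
Qed.

(** The point of a second order estimate in terms of the maximum of [|f|] alone is
    that it survives pointwise limits.  It follows from Cauchy's formula at [z] and
    [z + h] on one square, since [(w - z - h)^-1 - (w - z)^-1 - h (w - z)^-2] equals
    [h^2 (w - z)^-2 (w - z - h)^-1]. *)
Lemma cauchy_taylor f z r (M : R) : entire f -> 0 < r ->
  (forall w, nrm (w - z) <= 4 * r -> nrm (f w) <= M) ->
  exists2 k, nrm k <= 8 * M / r &
    forall h, nrm h <= r -> nrm (f (z + h) - f z - k * h) <= 8 * M * (nrm h / r) ^+ 2.
Proof.
case: z => a b ef r0 fM; set z := a +i* b.
have r20 : 0 < 2 * r by lra.
pose I (g : R[i] -> R[i]) := rect_int g (a - 2 * r) (a + 2 * r) (b - 2 * r) (b + 2 * r).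
pose B w := on_bdry (a - 2 * r) (a + 2 * r) (b - 2 * r) (b + 2 * r) w.
have Bge w : B w -> 2 * r <= nrm (w - z) by apply: bdry_dist.
have BM w : B w -> nrm (f w) <= M.
  move=> /andP[/bdry_dist_le wb _]; apply: fM; apply: le_trans wb _; lra.
have M0 : 0 <= M by apply: le_trans (fM z _); rewrite ?nrm_ge0 // subrr nrm0; lra.
have Bz w : B w -> w != z.
  by move=> /Bge; apply: contraTneq => ->; rewrite subrr nrm0 -ltNge.
have Bzh h w : nrm h <= r -> B w -> r <= nrm (w - (z + h)).
  move=> hr /Bge wz; rewrite opprD addrA; apply: le_trans (ler_nrmB _ _); lra.
have Bzh' h w : nrm h <= r -> B w -> w != z + h.
  by move=> hr /(Bzh h w hr); apply: contraTneq => ->; rewrite subrr nrm0 -ltNge.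
have Int g : (forall w, B w -> cdiff g w) ->
    rect_integrable g (a - 2 * r) (a + 2 * r) (b - 2 * r) (b + 2 * r).
  by move=> dg; apply: rect_integrable_cdiff => //; lra.
have Bd g N : (forall w, B w -> cdiff g w) -> (forall w, B w -> nrm (g w) <= N) ->
    nrm (I g) <= 32 * r * N.
  move=> dg gN; apply: le_trans (nrm_rect_int_le _ _ (Int _ dg) gN) _; lra.
set c : R[i] := 2 * pi%:C * 'i.
have c1 : 1 <= nrm c := nrm_2pii.
have c0 : c != 0 by rewrite -nrm_gt0; lra.
have Cf h : nrm h <= r -> I (fun w => f w * (w - (z + h))^-1) = c * f (z + h).
  move=> hr; have [h1 h2] := (Re_le_nrm h, Im_le_nrm h).
  have [n1 n2] := (ler_norm (Re h), ler_norm (- Re h)); rewrite normrN in n2.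
  have [n3 n4] := (ler_norm (Im h), ler_norm (- Im h)); rewrite normrN in n4.
  by apply: cauchy_rectangle => //; rewrite ?(Re_addc, Im_addc) /=; lra.
pose g2 w := f w * ((w - z)^-1 * (w - z)^-1).
have dg2 w : B w -> cdiff g2 w.
  by move=> /Bz wz; apply: cdiffM; [exact: ef|apply: cdiffM; exact: cdiff_kernel].
have nc (k N : R[i]) (x : R) : nrm N <= x -> nrm (c^-1 * N) <= x.
  move=> Nx; rewrite nrmM nrmV mulrC ler_pdivrMr ?(lt_le_trans ltr01) //.
  by rewrite (le_trans Nx) // ler_peMr // (le_trans _ Nx) // nrm_ge0.
exists (c^-1 * I g2).
  apply: nc => //; apply: le_trans (Bd _ (M / (4 * r ^+ 2)) dg2 _) _; last first.
    by rewrite le_eqVlt; apply/orP; left; apply/eqP; field; rewrite gt_eqF.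
  move=> w Bw; rewrite /g2 !nrmM nrmV; apply: ler_pM; rewrite ?nrm_ge0 ?BM //.
    by rewrite mulr_ge0 // invr_ge0 nrm_ge0.
  have -> : (4 * r ^+ 2)^-1 = (2 * r)^-1 * (2 * r)^-1 by field; rewrite gt_eqF.
  have ? := Bge _ Bw.
  by apply: ler_pM; rewrite ?invr_ge0 ?nrm_ge0 // lef_pV2 ?posrE // (lt_le_trans r20).
move=> h hr.
pose e w := h ^+ 2 * (g2 w * (w - (z + h))^-1).
have de w : B w -> cdiff e w.
  move=> Bw; apply: cdiffM; first exact: cdiff_cst.
  by apply: cdiffM; [exact: dg2|apply: cdiff_kernel; exact: Bzh'].
have dz0 w : B w -> cdiff (fun w => f w * (w - z)^-1) w.
  by move=> /Bz wz; apply: cdiffM; [exact: ef|exact: cdiff_kernel].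
have E : I (fun w => f w * (w - (z + h))^-1) =
    I (fun w => f w * (w - z)^-1) + (h * I g2 + I e).
  rewrite -rect_intZ; last exact: Int.
  rewrite -rect_intD; [|exact: rect_integrableZ (Int _ dg2)|exact: Int].
  rewrite -rect_intD; [|exact: Int|]; last first.
    by apply: rect_integrableD; [exact: rect_integrableZ (Int _ dg2)|exact: Int].
  apply: eq_rect_int; [lra|lra|] => w Bw; rewrite /e /g2.
  by field; rewrite !subr_eq0 Bz // Bzh'.
rewrite Cf // in E; have E0 := Cf 0; rewrite addr0 nrm0 in E0.
rewrite E0 ?(ltW r0) // in E.
have -> : f (z + h) - f z - c^-1 * I g2 * h = c^-1 * I e.
  rewrite -[f (z + h)](mulKf c0) E mulrDr mulKf //; ring.
apply: nc => //; apply: le_trans (Bd _ (nrm h ^+ 2 * (M / (4 * r ^+ 2) * r^-1)) de _) _; last first.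
  by rewrite le_eqVlt; apply/orP; left; apply/eqP; field; rewrite gt_eqF.
move=> w Bw; rewrite /e nrmM (expr2 h) nrmM -expr2 ler_wpM2l ?exprn_ge0 ?nrm_ge0 //.
rewrite /g2 !nrmM !nrmV; apply: ler_pM; rewrite ?mulr_ge0 ?invr_ge0 ?nrm_ge0 //; last first.
  by rewrite lef_pV2 ?posrE ?(lt_le_trans r0) // Bzh.
apply: ler_pM; rewrite ?nrm_ge0 ?BM ?mulr_ge0 ?invr_ge0 ?nrm_ge0 //.
have -> : (4 * r ^+ 2)^-1 = (2 * r)^-1 * (2 * r)^-1 by field; rewrite gt_eqF.
have ? := Bge _ Bw.
by apply: ler_pM; rewrite ?invr_ge0 ?nrm_ge0 // lef_pV2 ?posrE // (lt_le_trans r20).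
Qed.

(** On the disc of radius [r] the second order remainder is at most of the order of
    [r * (|h| / r)^2].  The coefficient of [h] may depend on [r]; comparing with
    [h = 1] eliminates it. *)
Lemma liouville_affine f (A B : R) : entire f -> 0 <= A -> 0 <= B ->
  (forall w, nrm (f w) <= A * nrm w + B) -> exists c d, f = affine c d.
Proof.
move=> ef A0 B0 fAB; exists (f 1 - f 0), (f 0); apply/funext => h; rewrite /affine.
apply/eqP; rewrite -subr_eq0 -nrm_eq0 eq_le nrm_ge0 andbT; apply/ler_addgt0Pr => e e0.
rewrite add0r.
set n := nrm h; have n0 : 0 <= n by exact: nrm_ge0.
pose N := 8 * (4 * A + B) * (n ^+ 2 + n).
have N0 : 0 <= N by rewrite /N !mulr_ge0 ?addr_ge0 ?exprn_ge0 ?mulr_ge0.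
pose r := 1 + n + N / e.
have Ne : 0 <= N / e by rewrite divr_ge0 // ltW.
have r1 : 1 <= r by rewrite /r -addrA lerDl addr_ge0.
have r0 : 0 < r by exact: lt_le_trans r1.
have [|k _ H] := @cauchy_taylor f 0 r ((4 * A + B) * r) ef r0.
  move=> w; rewrite subr0 => wr; apply: le_trans (fAB w) _.
  have : A * nrm w <= A * (4 * r) by rewrite ler_wpM2l.
  have : B <= B * r by rewrite ler_peMr.
  lra.
have H1 := H 1; rewrite add0r nrm1 mulr1 in H1; have {}H1 := H1 r1.
have H2 := H h; rewrite add0r -/n in H2.
have {}H2 := H2 (ltac:(rewrite /r; lra)).
have -> : f h - ((f 1 - f 0) * h + f 0) = (f h - f 0 - k * h) - (f 1 - f 0 - k) * h by ring.
apply: le_trans (nrmB _ _) _; rewrite nrmM -/n.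
apply: le_trans (lerD H2 (ler_wpM2r n0 H1)) _.
have -> : 8 * ((4 * A + B) * r) * (n / r) ^+ 2 + 8 * ((4 * A + B) * r) * (1 / r) ^+ 2 * n
    = N / r by rewrite /N; field; rewrite gt_eqF.
rewrite ler_pdivrMr // mulrC -ler_pdivrMr // /r; lra.
Qed.

(** The four sides move independently of each other, so that each can later be
    chosen by averaging in one variable. *)
Lemma submean_sides f a b r x1 x2 y1 y2 : entire f -> 0 < r ->
  a - 2 * r <= x1 <= a - r -> a + r <= x2 <= a + 2 * r ->
  b - 2 * r <= y1 <= b - r -> b + r <= y2 <= b + 2 * r ->
  nrm (f (a +i* b)) <= 2 / r *
   (\int[mu]_(x in `[x1, x2]) nrm (f (x +i* y1)) + \int[mu]_(y in `[y1, y2]) nrm (f (x2 +i* y))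
  + \int[mu]_(x in `[x1, x2]) nrm (f (x +i* y2)) + \int[mu]_(y in `[y1, y2]) nrm (f (x1 +i* y))).
Proof.
move=> ef r0 /andP[x1a x1b] /andP[x2a x2b] /andP[y1a y1b] /andP[y2a y2b].
set z := a +i* b.
have x12 : x1 <= x2 by lra.
have y12 : y1 <= y2 by lra.
have Bz w : on_bdry x1 x2 y1 y2 w -> r <= nrm (w - z) by apply: bdry_dist.
pose g w := f w * (w - z)^-1.
have gi : rect_integrable g x1 x2 y1 y2.
  apply: rect_integrable_cdiff => // w /Bz wz; apply: cdiffM; first exact: ef.
  by apply: cdiff_kernel; rewrite -subr_eq0 -nrm_gt0 (lt_le_trans r0).
have := @cauchy_rectangle R f z x1 x2 y1 y2.
have -> : x1 < Re z by rewrite /=; lra. have -> : Re z < x2 by rewrite /=; lra.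
have -> : y1 < Im z by rewrite /=; lra. have -> : Im z < y2 by rewrite /=; lra.
move=> /(_ isT isT isT isT ef) E.
apply: (@le_trans _ _ (nrm (rect_int g x1 x2 y1 y2))).
  by rewrite E nrmM ler_peMl ?nrm_ge0 // nrm_2pii.
have [g1 g2 g3 g4] := gi.
have gB w : on_bdry x1 x2 y1 y2 w -> nrm (g w) <= r^-1 * nrm (f w).
  move=> /Bz wz; rewrite /g nrmM nrmV mulrC ler_wpM2r ?nrm_ge0 // lef_pV2 ?posrE //.
  exact: lt_le_trans wz.
have H u v (l : R -> R[i]) : u <= v -> (forall t, cont_at (fun t => f (l t)) t) ->
    seg_integrable u v (g \o l) -> (forall t, u <= t <= v -> on_bdry x1 x2 y1 y2 (l t)) ->
    nrm (seg_int u v (g \o l)) <= 2 / r * \int[mu]_(t in `[u, v]) nrm (f (l t)).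
  move=> uv cl il bl.
  have ci : mu.-integrable `[u, v] (EFin \o (fun t => nrm (f (l t)))).
    apply: continuous_compact_integrable; first exact: segment_compact.
    apply: continuous_subspaceT => t; apply/cvgrPdist_lt => e /(cl t)[s s0 K].
    exists s => //= t' tt'; rewrite distrC (le_lt_trans (ler_dist_nrm _ _)) //.
    by apply: K; rewrite distrC.
  rewrite -mulrA -RintegralZl //; apply: nrm_seg_int_le => //.
    by apply: eq_integrable (integrableZl _ r^-1 ci) => // t _.
  by move=> t /bl /gB.
rewrite /rect_int; apply: le_trans (nrmB _ _) _; rewrite nrmM nrm_i mul1r !mulrDr.
apply: lerD; last first.
  apply: (H _ _ (fun y => x1 +i* y)) => //.
    by move=> t; apply: cdiff_cont_vert; exact: ef.
  by move=> t tI; rewrite /on_bdry /in_rect /= tI lexx x12 eqxx.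
apply: le_trans (nrmB _ _) _; apply: lerD; last first.
  apply: (H _ _ (fun x => x +i* y2)) => //.
    by move=> t; apply: cdiff_cont_horiz; exact: ef.
  by move=> t tI; rewrite /on_bdry /in_rect /= tI lexx y12 eqxx !orbT.
apply: le_trans (nrmD _ _) _; rewrite nrmM nrm_i mul1r; apply: lerD.
  apply: (H _ _ (fun x => x +i* y1)) => //.
    by move=> t; apply: cdiff_cont_horiz; exact: ef.
  by move=> t tI; rewrite /on_bdry /in_rect /= tI lexx y12 eqxx !orbT.
apply: (H _ _ (fun y => x2 +i* y)) => //.
  by move=> t; apply: cdiff_cont_vert; exact: ef.
by move=> t tI; rewrite /on_bdry /in_rect /= tI lexx x12 eqxx !orbT.
Qed.

End CauchyEstimates.

(** * Area means of entire functions *)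

Section PlaneMeasure.
Variable R : realType.
Notation mu := (@lebesgue_measure R).
Notation T := (measurableTypeR R).
Notation mu2 := (@lebesgue_measure R \x @lebesgue_measure R)%E.
Implicit Types (f g : R[i] -> R[i]) (a b c d e r s x y : R) (h k z : R[i]).

Definition cont2 (F : R * R -> R) := forall p (e : R), 0 < e -> exists2 r : R, 0 < r &
  forall q, `|q.1 - p.1| < r -> `|q.2 - p.2| < r -> `|F q - F p| < e.

Let obox (a b c d : R) : set (R * R) := `]a, b[ `*` `]c, d[.

(** An open subset of the plane is a countable union of boxes with rational
    vertices. *)
Lemma cont2_measurable (F : R * R -> R) : cont2 F -> measurable_fun [set: T * T] (F : T * T -> R).
Proof.
move=> cF mD; apply: (measurability _ (RGenOInfty.measurableE R)) => //.
move=> /= _ [_ [x ->] <-]; apply: measurableI => //.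
pose U := F @^-1` `]x, +oo[.
pose B (a b c d : rat) := if `[< obox (ratr a) (ratr b) (ratr c) (ratr d) `<=` U >]
  then obox (ratr a) (ratr b) (ratr c) (ratr d) else set0.
have -> : F @^-1` `]x, +oo[ = \bigcup_a \bigcup_b \bigcup_c \bigcup_d B a b c d.
  apply/seteqP; split => [p|p [a _ [b _ [c _ [d _]]]]]; last first.
    by rewrite /B; case: asboolP => // H /H.
  rewrite /= in_itv /= andbT => xp.
  have [r r0 Hr] := cF p (F p - x) (ltac:(by rewrite subr_gt0)).
  have rat u : exists a b : rat, [/\ u - r < ratr a, ratr a < u, u < ratr b & ratr b < u + r].
    have /rat_in_itvoo[a] : u - r < u by rewrite ltrBlDr ltrDl.
    have /rat_in_itvoo[b] : u < u + r by rewrite ltrDl.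
    by rewrite !in_itv /= => /andP[? ?] /andP[? ?]; exists a, b.
  have [a [b [a1 a2 b1 b2]]] := rat p.1; have [c [d [c1 c2 d1 d2]]] := rat p.2.
  exists a => //; exists b => //; exists c => //; exists d => //.
  rewrite /B; case: asboolP => [_|[]]; first by split; rewrite /= in_itv /= ?a2 ?c2.
  move=> q [] /=; rewrite !in_itv /= => /andP[q1 q2] /andP[q3 q4].
  have : `|F q - F p| < F p - x.
    by apply: Hr; rewrite ltr_norml; apply/andP; split; lra.
  by rewrite /U /= in_itv /= andbT ltr_norml => /andP[] ? _; lra.
apply: bigcupT_measurable_rat => a; apply: bigcupT_measurable_rat => b.
apply: bigcupT_measurable_rat => c; apply: bigcupT_measurable_rat => d.
by rewrite /B; case: ifP => // _; apply: measurableX; exact: measurable_itv.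
Qed.

Lemma cont2_nrm f : (forall z, cdiff f z) -> cont2 (fun w => nrm (f (w.1 +i* w.2))).
Proof.
move=> df p e e0; have [r r0 H] := cdiff_cont (df (p.1 +i* p.2)) e0.
exists (r / 2) => [|q q1 q2]; first by rewrite divr_gt0.
apply: le_lt_trans (ler_dist_nrm _ _) _.
have -> : q.1 +i* q.2 = p.1 +i* p.2 + ((q.1 - p.1) +i* (q.2 - p.2)).
  by apply: complex_ext; rewrite ?(Re_addc,Im_addc) /=; ring.
by apply: H; apply: le_lt_trans (nrm_pair _ _) _; lra.
Qed.

(** Squares replace discs: they suit both the rectangular contours and iterated
    integration. *)
Definition qbox a b r : set (R * R) := `[a - r, a + r] `*` `[b - r, b + r].

(** A function whose integral is less than [c * (v - u)] cannot be at least [c] on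
    all of [u, v]. *)
Lemma exists_below (G : T -> \bar R) (u v c : R) : u < v ->
  measurable_fun (setT : set T) G -> (forall x, 0 <= G x)%E -> 0 <= c ->
  (\int[mu]_x G x < (c * (v - u))%:E)%E ->
  exists2 x, u <= x <= v & (G x < c%:E)%E.
Proof.
move=> uv mG G0 c0 Gc.
have [[x [xI xc]]|H] := pselect (exists x, u <= x <= v /\ (G x < c%:E)%E); first by exists x.
exfalso; move: Gc; apply/negP; rewrite -leNgt.
apply: (@le_trans _ _ (\int[mu]_(x in `[u, v]) G x)%E); last first.
  by apply: ge0_subset_integral => //.
have -> : ((c * (v - u))%:E = \int[mu]_(x in `[u, v]) (cst c%:E x))%E.
  by rewrite integral_cst //= lebesgue_measure_itv /= lte_fin uv EFinM.
apply: ge0_le_integral => //.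
  by apply: measurable_funTS.
move=> x /=; rewrite in_itv /= => xI; rewrite leNgt; apply/negP => xc.
by apply: H; exists x.
Qed.

Let lt4 a b c d e : a < e -> b < e -> c < e -> d < e -> a + b + c + d < 4 * e.
Proof. by lra. Qed.

Let lt_half a : 0 <= a -> a < a / 2 -> False.
Proof. by lra. Qed.

(** Each side of the contour can be placed, within a strip of width [r], where the
    integral of [|f|] along it is at most the mean over the strip. *)
Lemma area_submean f a b r : entire f -> 0 < r ->
  ((nrm (f (a +i* b)))%:E <= (16 / r ^+ 2)%:E *
    \int[mu2]_(w in qbox a b (2 * r)) (nrm (f (w.1 +i* w.2)))%:E)%E.
Proof.
move=> ef r0.
pose F (w : T * T) := (nrm (f (w.1 +i* w.2)))%:E.
pose Q : set (T * T) := qbox a b (2 * r).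
have mF : measurable_fun [set: T * T] F.
  by apply/measurable_EFinP; apply: cont2_measurable; exact: cont2_nrm.
have mQ : measurable Q by apply: measurableX; exact: measurable_itv.
have F0 w : (0 <= F w)%E by rewrite lee_fin nrm_ge0.
rewrite -/F; set J := (\int[mu2]_(w in _) _)%E.
pose H := F \_ Q.
have mH : measurable_fun [set: T * T] H.
  by apply/(measurable_restrictT _ _).1 => //; exact: measurable_funTS.
have H0 w : (0 <= H w)%E by apply: erestrict_ge0.
have JH : J = (\int[mu2]_w H w)%E by rewrite /J integral_mkcond.
rewrite leNgt; apply/negP => Jlt.
set K := r ^+ 2 * nrm (f (a +i* b)) / 16.
have JK : (J < K%:E)%E.
  move: Jlt; rewrite /K; have : (0 <= J)%E by rewrite JH integral_ge0.
  case: J {JH} => [j| |] //= j0; last first.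
    by rewrite gt0_muley ?lte_fin ?divr_gt0 ?exprn_gt0.
  rewrite -EFinM !lte_fin => jl; rewrite ltr_pdivlMr // mulrC -ltr_pdivrMl ?exprn_gt0 //.
  by rewrite mulrCA mulrA mulrC mulrA (mulrC _ 16) mulrAC.
have K0 : 0 < K by rewrite -lte_fin; apply: le_lt_trans JK; rewrite JH integral_ge0.
have Kr : (K%:E = (K / r * r)%:E)%E by rewrite divfK // lt0r_neq0.
pose V (x : T) := (\int[mu]_y H (x, y))%E.
pose W (y : T) := (\int[mu]_x H (x, y))%E.
have JV : J = (\int[mu]_x V x)%E by rewrite JH fubini_tonelli1.
have JW : J = (\int[mu]_x W x)%E by rewrite JH fubini_tonelli2.
have mV : measurable_fun [set: T] V by exact: measurable_fun_fubini_tonelli_F.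
have mW : measurable_fun [set: T] W by exact: measurable_fun_fubini_tonelli_G.
have V0 x : (0 <= V x)%E by exact: integral_ge0.
have W0 x : (0 <= W x)%E by exact: integral_ge0.
have Kr0 : 0 <= K / r by rewrite divr_ge0 // ltW.
have pickV u : exists2 x, u <= x <= u + r & (V x < (K / r)%:E)%E.
  apply: exists_below => //; first by rewrite ltrDl.
  by rewrite (addrC u) addrK -Kr -JV.
have pickW u : exists2 x, u <= x <= u + r & (W x < (K / r)%:E)%E.
  apply: exists_below => //; first by rewrite ltrDl.
  by rewrite (addrC u) addrK -Kr -JW.
have [x1 x1I Vx1] := pickV (a - 2 * r); have [x2 x2I Vx2] := pickV (a + r).
have [y1 y1I Wy1] := pickW (b - 2 * r); have [y2 y2I Wy2] := pickW (b + r).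
have I1 : a - 2 * r <= x1 <= a - r by move: x1I => /andP[? ?]; apply/andP; split; lra.
have I2 : a + r <= x2 <= a + 2 * r by move: x2I => /andP[? ?]; apply/andP; split; lra.
have I3 : b - 2 * r <= y1 <= b - r by move: y1I => /andP[? ?]; apply/andP; split; lra.
have I4 : b + r <= y2 <= b + 2 * r by move: y2I => /andP[? ?]; apply/andP; split; lra.
have := submean_sides ef r0 I1 I2 I3 I4.
have side (l : T -> T * T) u v : (forall t, cont_at (fun t => f ((l t).1 +i* (l t).2)) t) ->
    measurable_fun [set: T] (H \o l) ->
    (forall t, u <= t <= v -> Q (l t)) -> (\int[mu]_t H (l t) < (K / r)%:E)%E ->
    \int[mu]_(t in `[u, v]) nrm (f ((l t).1 +i* (l t).2)) < K / r.
  move=> cl ml lQ; apply: contraTT; rewrite -!leNgt -lee_fin => KI.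
  apply: (le_trans KI).
  have ci : mu.-integrable `[u, v] (EFin \o (fun t => nrm (f ((l t).1 +i* (l t).2)))).
    apply: continuous_compact_integrable; first exact: segment_compact.
    apply: continuous_subspaceT => t; apply/cvgrPdist_lt => e /(cl t)[s s0 K'].
    exists s => //= t' tt'; rewrite distrC (le_lt_trans (ler_dist_nrm _ _)) //.
    by apply: K'; rewrite distrC.
  rewrite /Rintegral fineK; last exact: integrable_fin_num.
  rewrite (eq_integral (H \o l)); last first.
    by move=> t /set_mem /=; rewrite in_itv /= => /lQ lt; rewrite /H patchE mem_set.
  by apply: ge0_subset_integral => // t _; exact: H0.
have s1 : \int[mu]_(x in `[x1, x2]) nrm (f (x +i* y1)) < K / r.
  apply: (side (fun x => (x, y1))) => //.
  - by move=> t; apply: cdiff_cont_horiz; exact: ef.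
  - exact: measurableT_comp.
  - move=> t /andP[? ?]; move: I1 I2 I3 => /andP[? ?] /andP[? ?] /andP[? ?].
    by split; rewrite /= in_itv /=; apply/andP; split; lra.
have s2 : \int[mu]_(x in `[x1, x2]) nrm (f (x +i* y2)) < K / r.
  apply: (side (fun x => (x, y2))) => //.
  - by move=> t; apply: cdiff_cont_horiz; exact: ef.
  - exact: measurableT_comp.
  - move=> t /andP[? ?]; move: I1 I2 I4 => /andP[? ?] /andP[? ?] /andP[? ?].
    by split; rewrite /= in_itv /=; apply/andP; split; lra.
have s3 : \int[mu]_(y in `[y1, y2]) nrm (f (x1 +i* y)) < K / r.
  apply: (side (fun y => (x1, y))) => //.
  - by move=> t; apply: cdiff_cont_vert; exact: ef.
  - exact: measurable_fun_pair2.
  - move=> t /andP[? ?]; move: I1 I3 I4 => /andP[? ?] /andP[? ?] /andP[? ?].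
    by split; rewrite /= in_itv /=; apply/andP; split; lra.
have s4 : \int[mu]_(y in `[y1, y2]) nrm (f (x2 +i* y)) < K / r.
  apply: (side (fun y => (x2, y))) => //.
  - by move=> t; apply: cdiff_cont_vert; exact: ef.
  - exact: measurable_fun_pair2.
  - move=> t /andP[? ?]; move: I2 I3 I4 => /andP[? ?] /andP[? ?] /andP[? ?].
    by split; rewrite /= in_itv /=; apply/andP; split; lra.
set S := (X in 2 / r * X) => fS.
have SK : S < 4 * (K / r) by exact: lt4 s1 s4 s2 s3.
have : nrm (f (a +i* b)) < 2 / r * (4 * (K / r)).
  by apply: le_lt_trans fS _; rewrite ltr_pM2l // divr_gt0.
have -> : 2 / r * (4 * (K / r)) = nrm (f (a +i* b)) / 2.
  by rewrite /K; field; rewrite gt_eqF.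
exact: lt_half (nrm_ge0 _).
Qed.

End PlaneMeasure.

(** * Area means of powers: local estimate *)

Section SubharmonicPowers.
Variable R : realType.
Notation T := (measurableTypeR R).
Notation mu2 := (@lebesgue_measure R \x @lebesgue_measure R)%E.
Implicit Types (f g : R[i] -> R[i]) (a b p r s t m x y : R) (h k z : R[i]).

Lemma cont2_continuous (F : R * R -> R) : cont2 F -> continuous F.
Proof.
move=> cF q; apply/cvgrPdist_lt => e /(cF q)[r r0 H].
exists (ball q.1 r, ball q.2 r); first by split; exact: nbhsx_ballx.
move=> [u v] [/= uq vq]; rewrite distrC; apply: H => /=; by rewrite distrC.
Qed.

Lemma compact_qbox a b r : compact (qbox a b r : set (R * R)).
Proof. by apply: compact_setX; exact: segment_compact. Qed.

Lemma measurable_qbox a b r : measurable (qbox a b r : set (T * T)).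
Proof. by apply: measurableX; exact: measurable_itv. Qed.

Lemma entire_bounded_box f a b r : entire f -> 0 <= r ->
  exists2 N, 0 <= N & forall w, qbox a b r w -> nrm (f (w.1 +i* w.2)) <= N.
Proof.
move=> ef r0; have [||c _ cN] := @compact_EVT_max _ R
  (fun w : R * R => nrm (f (w.1 +i* w.2))) (qbox a b r) _ (@compact_qbox a b r).
- by exists (a, b); split; rewrite /= in_itv /= lerBlDr lerDl r0.
- by apply: continuous_subspaceT; apply: cont2_continuous; exact: cont2_nrm.
exists (nrm (f (c.1 +i* c.2))); first exact: nrm_ge0.
by move=> w wQ; apply: cN; rewrite inE.
Qed.

(** Compares [t] with [t ^ p] for all [p > 0] at once: either [t <= s], or
    [(t / s) ^ p] is at least 1. *)
Lemma le_split_powR p s t m : 0 < p -> 0 < s -> 0 <= t -> t <= m ->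
  t <= s + m / s `^ p * t `^ p.
Proof.
move=> p0 s0 t0 tm; have m0 := le_trans t0 tm.
have sp : 0 < s `^ p by rewrite powR_gt0.
have [ts|st] := leP t s.
  by rewrite (le_trans ts) // lerDl mulr_ge0 ?powR_ge0 ?divr_ge0 ?powR_ge0.
apply: ler_wpDl; first exact: ltW.
rewrite mulrAC -mulrA; apply: le_trans tm _; rewrite ler_peMr // ler_pdivlMr // mul1r.
by apply: ge0_ler_powR; rewrite ?nnegrE ?(ltW p0) ?(ltW s0) ?(ltW st).
Qed.

Lemma mu2_qbox a b r : 0 < r -> mu2 (qbox a b r) = (4 * r ^+ 2)%:E.
Proof.
move=> r0; rewrite /qbox product_measure1E; [|exact: measurable_itv..].
rewrite /= !lebesgue_measure_itv /= !lte_fin.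
have -> : a - r < a + r by lra. have -> : b - r < b + r by lra.
by rewrite -!EFinB -EFinM; congr EFin; ring.
Qed.

Lemma measurable_nrm_powR f p : entire f ->
  measurable_fun [set: T * T] (fun w => ((nrm (f (w.1 +i* w.2))) `^ p)%:E).
Proof.
move=> ef; apply/measurable_EFinP.
apply: (measurableT_comp (@measurable_powR R p)).
by apply: cont2_measurable; exact: cont2_nrm.
Qed.

(** The term proportional to [s] can be absorbed in the left-hand side when [s] is
    a small multiple of the value of [|f|] at the centre. *)
Lemma submean_local f p a b r s m : 0 < p -> 0 < r -> 0 < s -> entire f ->
  (forall w, qbox a b (2 * r) w -> nrm (f (w.1 +i* w.2)) <= m) ->
  ((nrm (f (a +i* b)))%:E <= (256 * s)%:E + (16 * m / (r ^+ 2 * s `^ p))%:E *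
    \int[mu2]_(w in qbox a b (2 * r)) (nrm (f (w.1 +i* w.2)) `^ p)%:E)%E.
Proof.
move=> p0 r0 s0 ef fm.
have m0 : 0 <= m.
  apply: le_trans (fm (a, b) _); first exact: nrm_ge0.
  by split; rewrite /= in_itv /=; apply/andP; split; lra.
have sp : 0 < s `^ p by rewrite powR_gt0.
have B0 : 0 <= m / s `^ p by rewrite divr_ge0 // ltW.
have mp := measurable_nrm_powR p ef.
apply: le_trans (area_submean a b ef r0) _.
apply: (@le_trans _ _ ((16 / r ^+ 2)%:E * \int[mu2]_(w in qbox a b (2 * r))
    (s%:E + (m / s `^ p)%:E * (nrm (f (w.1 +i* w.2)) `^ p)%:E))%E).
  apply: lee_wpmul2l; first by rewrite lee_fin divr_ge0 // exprn_ge0 // ltW.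
  apply: ge0_le_integral => //.
  - exact: measurable_qbox.
  - by move=> w _; rewrite lee_fin nrm_ge0.
  - apply: measurable_funTS; apply/measurable_EFinP.
    by apply: cont2_measurable; exact: cont2_nrm.
  - apply: measurable_funTS; apply: emeasurable_funD => //.
    by apply: emeasurable_funM.
  - move=> w /fm wm; rewrite -EFinM -EFinD lee_fin; apply: le_split_powR => //.
    exact: nrm_ge0.
rewrite ge0_integralD; [|exact: measurable_qbox|by move=> w _; rewrite lee_fin ltW
  |by []|by move=> w _; rewrite -EFinM lee_fin mulr_ge0 // powR_ge0
  |by apply: measurable_funTS; apply: emeasurable_funM].
rewrite ge0_integralZl_EFin; [|exact: measurable_qbox
  |by move=> w _; rewrite lee_fin powR_ge0|exact: measurable_funTS|by []].
rewrite integral_cst; last exact: measurable_qbox.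
rewrite [X in (_ * (_ * X + _))%E]mu2_qbox; last by lra.
set J := (\int[mu2]_(w in _) _)%E.
rewrite muleDr ?ge0_adde_def ?inE //; last 2 first.
- by rewrite -EFinM lee_fin !mulr_ge0 ?exprn_ge0 ?(ltW s0) ?mulr_ge0 ?(ltW r0).
- rewrite mule_ge0 ?lee_fin // integral_ge0 // => w _; by rewrite lee_fin powR_ge0.
rewrite muleA -!EFinM; apply: leeD.
  by rewrite lee_fin le_eqVlt; apply/orP; left; apply/eqP; field; rewrite gt_eqF.
rewrite muleA -EFinM le_eqVlt; apply/orP; left; apply/eqP; congr (_%:E * _)%E.
by field; rewrite !gt_eqF.
Qed.

End SubharmonicPowers.

(** * Area means of powers: maximal point argument *)

Section PointEvaluation.
Variable R : realType.
Notation mu2 := (@lebesgue_measure R \x @lebesgue_measure R)%E.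
Implicit Types (f g : R[i] -> R[i]) (a b p r s t m x y : R) (h k z : R[i]).

Let dist_box (c w : R * R) := Num.max `|w.1 - c.1| `|w.2 - c.2|.

Let dist_boxP (c w : R * R) r : (dist_box c w <= r) = (`|w.1 - c.1| <= r) && (`|w.2 - c.2| <= r).
Proof. by rewrite /dist_box ge_max. Qed.

Let dist_box_tri (c w v : R * R) : dist_box c w <= dist_box c v + dist_box v w.
Proof.
rewrite dist_boxP; apply/andP; split.
- apply: le_trans (ler_distD v.1 _ _) _; rewrite addrC.
  by apply: lerD; rewrite /dist_box le_max lexx.
- apply: le_trans (ler_distD v.2 _ _) _; rewrite addrC.
  by apply: lerD; rewrite /dist_box le_max lexx orbT.
Qed.

Let qboxE a b r (w : R * R) : qbox a b r w <-> dist_box (a, b) w <= r.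
Proof.
rewrite dist_boxP /= !ler_distl /qbox; split => [[/=]|/andP[]].
  by rewrite !in_itv /= => -> ->.
by move=> ? ?; split; rewrite /= in_itv.
Qed.

(** Consider a point [v] that nearly maximizes [dl w ^ (2 / p) * |f w|], where
    [dl w] is the distance from [w] to the boundary of the square.  On the square
    around [v] of half size [dl v / 2] the values of [|f|] are at most a constant
    times [|f v|], so the local estimate applies at [v]; the exponent [2 / p] is the
    one for which the powers of [dl v] cancel. *)
Lemma submean_powR p : 0 < p -> exists2 C : R, 0 < C & forall f a b, entire f ->
  ((nrm (f (a +i* b)) `^ p)%:E <=
    C%:E * \int[mu2]_(w in qbox a b 4) (nrm (f (w.1 +i* w.2)) `^ p)%:E)%E.
Proof.
move=> p0; pose k := 2 / p; have k0 : 0 < k by rewrite divr_gt0.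
pose L := 2 * 2 `^ k; have L0 : 0 < L by rewrite mulr_gt0 // powR_gt0.
(* [2 ^- 9] halves the factor 256 of [submean_local], so that the linear term is
   at most half of the left-hand side. *)
have [e e0 e1] : exists2 e : R, 0 < e & 2 ^+ 9 * e = 1.
  exists (2 ^+ 9)^-1; first by rewrite invr_gt0 exprn_gt0.
  by rewrite mulfV // expf_neq0.
have ep : 0 < e `^ p by rewrite powR_gt0.
pose C := 2 `^ p * (2 ^+ 9 * L / e `^ p).
have C0 : 0 < C by rewrite mulr_gt0 ?powR_gt0 ?divr_gt0 ?mulr_gt0 ?exprn_gt0.
exists C => // f a b ef.
pose F (w : R * R) := nrm (f (w.1 +i* w.2)).
have F0 w : 0 <= F w by exact: nrm_ge0.
pose Q : set (R * R) := qbox a b 4.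
set J := (\int[mu2]_(w in _) _)%E.
have J0 : (0 <= J)%E by apply: integral_ge0 => w _; rewrite lee_fin powR_ge0.
have mp := measurable_nrm_powR p ef.
case EJ : J J0 => [I| |] // I0; last by rewrite gt0_muley ?lte_fin // leey.
rewrite lee_fin in I0; rewrite -EFinM lee_fin.
pose dl w := 4 - dist_box (a, b) w.
pose u w := dl w `^ k * F w.
have [N N0 FN] := entire_bounded_box a b ef (ler0n _ 4).
have dl4 w : dl w <= 4 by rewrite /dl lerBlDr lerDl /dist_box le_max normr_ge0.
have dl0 w : Q w -> 0 <= dl w by move/qboxE; rewrite /dl subr_ge0.
have Qc : Q (a, b) by apply/qboxE; rewrite /dist_box /= !subrr !normr0 maxxx.
have hs : has_sup (u @` Q).
  split; first by exists (u (a, b)); exists (a, b).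
  exists (4 `^ k * N) => _ [w wQ <-]; apply: ler_pM; rewrite ?powR_ge0 ?F0 ?FN //.
  by apply: ge0_ler_powR; rewrite ?nnegrE ?(ltW k0) ?dl0.
set S := sup (u @` Q).
have uS w : Q w -> u w <= S by move=> wQ; apply: sup_upper_bound => //; exists w.
have u00 : F (a, b) <= u (a, b).
  rewrite /u /dl /dist_box /= !subrr !normr0 maxxx subr0 ler_peMl //.
  have := @ler_powR R 4 (ler1n _ _) 0 k (ltW k0); by rewrite powRr0.
have FS : F (a, b) <= S := le_trans u00 (uS _ Qc).
have [S0|S0] := leP S 0.
  have -> : nrm (f (a +i* b)) = 0.
    by apply/eqP; rewrite eq_le nrm_ge0 andbT; apply: le_trans FS S0.
  by rewrite powR0 ?gt_eqF // mulr_ge0 // ltW.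
have [_ [v vQ <-]] : exists2 y, (u @` Q) y & S - S / 2 < y.
  by apply: sup_adherent; rewrite ?divr_gt0.
have -> : S - S / 2 = S / 2 by field.
move=> vS.
have uv0 : 0 < u v by apply: lt_trans vS; rewrite divr_gt0.
have Fv0 : 0 < F v.
  by rewrite lt_neqAle F0 andbT eq_sym; apply: contraTneq uv0; rewrite /u => ->; rewrite mulr0 ltxx.
have dv0 : 0 < dl v.
  rewrite lt_neqAle dl0 // andbT eq_sym; apply: contraTneq uv0; rewrite /u => ->.
  by rewrite powR0 ?gt_eqF // mul0r ltxx.
pose r := dl v / 4; have r0 : 0 < r by rewrite divr_gt0.
have QQ w : qbox v.1 v.2 (2 * r) w -> Q w /\ dl v / 2 <= dl w.
  move/qboxE; have -> : (v.1, v.2) = v by case: (v).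
  move=> wv; have tri := dist_box_tri (a, b) w v.
  have D : dl v / 2 <= dl w.
    by move: wv tri; rewrite /r /dl; move: (dist_box _ w) (dist_box _ v) (dist_box v w) => x y z; lra.
  split => //; apply/qboxE; rewrite -subr_ge0; apply: le_trans D.
  by rewrite divr_ge0 // ltW.
have FL w : qbox v.1 v.2 (2 * r) w -> F w <= L * F v.
  move=> /QQ[wQ dw].
  have h1 : (dl v / 2) `^ k * F w <= S.
    apply: le_trans (uS _ wQ); rewrite /u ler_wpM2r //.
    by apply: ge0_ler_powR; rewrite ?nnegrE ?(ltW k0) ?dl0 // divr_ge0 // ltW.
  have h2 : (dl v / 2) `^ k * F w <= 2 * (dl v `^ k * F v).
    apply: le_trans h1 _; rewrite -ler_pdivrMl // mulrC; exact: ltW.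
  have h3 : dl v `^ k = (dl v / 2) `^ k * 2 `^ k.
    by rewrite -powRM ?divfK // divr_ge0 // ltW.
  have h4 : 0 < (dl v / 2) `^ k by rewrite powR_gt0 // divr_gt0.
  rewrite -(ler_pM2l h4); apply: le_trans h2 _; rewrite h3 /L.
  by rewrite le_eqVlt; apply/orP; left; apply/eqP; ring.
have s0 : 0 < e * F v by rewrite mulr_gt0.
have := submean_local p0 r0 s0 ef FL.
set J' := (\int[mu2]_(w in _) _)%E => loc.
have JJ : (J' <= J)%E.
  apply: ge0_subset_integral => //; try exact: measurable_qbox.
  - exact: measurable_funTS.
  - by move=> w _; rewrite lee_fin powR_ge0.
  - by move=> w /QQ[].
have sp0 : 0 < (e * F v) `^ p by rewrite powR_gt0.
have c0 : 0 < r ^+ 2 * (e * F v) `^ p by rewrite mulr_gt0 // exprn_gt0.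
have {}loc : F v <= 256 * (e * F v) + 16 * (L * F v) / (r ^+ 2 * (e * F v) `^ p) * I.
  rewrite -lee_fin EFinD [X in (_ <= _ + X)%E]EFinM -EJ; apply: le_trans loc _.
  rewrite [X in (X <= _)%E]/= leeD2l // lee_wpmul2l // lee_fin divr_ge0 ?(ltW c0) //.
  by rewrite !mulr_ge0 // ltW.
have main : dl v ^+ 2 * F v `^ p <= 2 ^+ 9 * L / e `^ p * I.
  have l1 : F v / 2 <= 16 * (L * F v) / (r ^+ 2 * (e * F v) `^ p) * I.
    have E : 256 * (e * F v) = 2 ^+ 9 * e * F v / 2 by field.
    by move: loc; rewrite E e1 mul1r; move: (16 * _ / _ * _) => X; lra.
  have l2 : F v / 2 * (r ^+ 2 * (e * F v) `^ p) <= 16 * (L * F v) * I.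
    by rewrite -ler_pdivlMr // mulrAC.
  move: l2; rewrite powRM ?(ltW e0) // /r => l2.
  rewrite -(ler_pM2l (mulr_gt0 Fv0 ep)).
  have := ler_wpM2l (ler0n R 32) l2.
  have -> : 32 * (F v / 2 * ((dl v / 4) ^+ 2 * (e `^ p * F v `^ p))) =
     F v * e `^ p * (dl v ^+ 2 * F v `^ p) by field.
  move/le_trans; apply; rewrite le_eqVlt; apply/orP; left; apply/eqP.
  by field; rewrite gt_eqF.
have uvp : u v `^ p = dl v ^+ 2 * F v `^ p.
  rewrite /u powRM ?powR_ge0 // -powRrM /k divfK ?gt_eqF // powR_mulrn //.
  exact: ltW.
rewrite -uvp in main.
have u2 : 0 <= 2 * u v by apply: mulr_ge0 => //; exact: ltW.
apply: (@le_trans _ _ ((2 * u v) `^ p)).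
  apply: ge0_ler_powR; rewrite ?nnegrE ?(ltW p0) ?nrm_ge0 ?u2 //.
  by apply: (le_trans FS); rewrite -ler_pdivrMl // mulrC; exact: ltW.
rewrite powRM ?(ltW uv0) // /C -(mulrA (2 `^ p)); apply: ler_wpM2l; first exact: powR_ge0.
exact: main.
Qed.

End PointEvaluation.

(** * Fock norms and point evaluations *)

Section FockNorm.
Variable R : realType.
Notation mu := (@lebesgue_measure R).
Notation T := (measurableTypeR R).
Notation mu2 := (@lebesgue_measure R \x @lebesgue_measure R)%E.
Implicit Types (f g : R[i] -> R[i]) (a b c p q r s t m x y u v : R) (h k z : R[i]).

(** The density of a normal law of variance [1 / (2 c)], without its constant. *)
Lemma gauss1 c u : 0 < c ->
  (\int[mu]_x (expR (- (c * (x - u) ^+ 2)))%:E = (Num.sqrt (pi / c))%:E)%E.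
Proof.
move=> c0; pose s := (Num.sqrt (2 * c))^-1.
have s0 : 0 < s by rewrite invr_gt0 sqrtr_gt0 mulr_gt0.
have s2 : s ^+ 2 = (2 * c)^-1 by rewrite /s exprVn sqr_sqrtr // mulr_ge0 // ltW.
have pk : normal_peak s = (Num.sqrt (pi / c))^-1.
  rewrite /normal_peak s2; congr ((Num.sqrt _)^-1).
  by rewrite -mulr_natr; field; rewrite gt_eqF.
have pk0 : 0 < Num.sqrt (pi / c) by rewrite sqrtr_gt0 divr_gt0 // pi_gt0.
have E x : expR (- (c * (x - u) ^+ 2)) = Num.sqrt (pi / c) * normal_pdf u s x.
  rewrite normal_pdfE ?gt_eqF //= pk [RHS]mulrA mulfV ?gt_eqF // mul1r /normal_fun s2.
  by congr expR; rewrite -mulr_natr; field; rewrite gt_eqF.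
under eq_integral do rewrite E EFinM.
rewrite ge0_integralZl_EFin //.
- by rewrite integral_normal_pdf mule1.
- by move=> x _; rewrite lee_fin normal_pdf_ge0.
- by apply/measurable_EFinP; exact: measurable_normal_pdf.
Qed.

Lemma cont2_gauss c u v :
  cont2 (fun w : R * R => expR (- (c * ((w.1 - u) ^+ 2 + (w.2 - v) ^+ 2)))).
Proof.
have cE : continuous (fun z : R * R => expR (- (c * ((z.1 - u) ^+ 2 + (z.2 - v) ^+ 2)))).
  move=> p; apply: (@continuous_comp _ _ _
    (fun z : R * R => - (c * ((z.1 - u) ^+ 2 + (z.2 - v) ^+ 2))) expR);
    last exact: continuous_expR.
  apply: cvgN; apply: cvgM; first exact: cvg_cst.
  by apply: cvgD; apply: cvgM; apply: cvgB; try exact: cvg_cst;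
    [exact: cvg_fst|exact: cvg_fst|exact: cvg_snd|exact: cvg_snd].
move=> p e e0; have /cvgrPdist_lt/(_ e e0)[[A B] /= [/nbhs_ballP[r1 r10 H1] /nbhs_ballP[r2 r20 H2]] H] := cE p.
exists (Num.min r1 r2); first by rewrite lt_min r10.
move=> [x y] /=; rewrite !lt_min => /andP[h1 _] /andP[_ h2].
rewrite distrC; apply: (H (x, y)); split => /=; [apply: H1|apply: H2];
  by rewrite /ball /= distrC.
Qed.

Lemma gauss2 c u v : 0 < c ->
  (\int[mu2]_w (expR (- (c * ((w.1 - u) ^+ 2 + (w.2 - v) ^+ 2))))%:E = (pi / c)%:E)%E.
Proof.
move=> c0.
have m2 : measurable_fun [set: T * T] (fun w => (expR (- (c * ((w.1 - u) ^+ 2 + (w.2 - v) ^+ 2))))%:E).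
  by apply/measurable_EFinP; apply: cont2_measurable; exact: cont2_gauss.
have mg v' : measurable_fun [set: T] (fun y : T => (expR (- (c * (y - v') ^+ 2)))%:E).
  apply/measurable_EFinP; apply: (measurableT_comp (@measurable_expR R)).
  apply: continuous_measurable_fun => y; apply: cvgN; apply: cvgM; first exact: cvg_cst.
  by apply: cvgM; apply: cvgB; try exact: cvg_cst; exact: cvg_id.
rewrite fubini_tonelli1 //.
rewrite /fubini_F /=.
have E x y : expR (- (c * ((x - u) ^+ 2 + (y - v) ^+ 2))) =
    expR (- (c * (x - u) ^+ 2)) * expR (- (c * (y - v) ^+ 2)).
  by rewrite -expRD mulrDr opprD.
under eq_integral => x _.
  under eq_integral do rewrite E EFinM.
  rewrite ge0_integralZl_EFin ?expR_ge0 //.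
  rewrite gauss1 // muleC.
  over.
rewrite ge0_integralZl_EFin ?sqrtr_ge0 //.
by rewrite gauss1 // -EFinM -expr2 sqr_sqrtr // divr_ge0 ?pi_ge0 // ltW.
Qed.

Definition fock_int p f : \bar R :=
  (\int[mu2]_(w in [set: _]) ((nrm (f (w.1 +i* w.2)) `^ p
        * expR (- (p * nrm (w.1 +i* w.2) ^+ 2 / 2)))%:E))%E.

Lemma fock_normE p f : fock_norm p f = (((p / (2 * pi))%:E * fock_int p f) `^ p^-1)%E.
Proof. by []. Qed.

Lemma fock_int_ge0 p f : (0 <= fock_int p f)%E.
Proof. by apply: integral_ge0 => w _; rewrite lee_fin mulr_ge0 ?powR_ge0 ?expR_ge0. Qed.

Lemma fock_norm_ge0 p f : (0 <= fock_norm p f)%E. Proof. exact: poweR_ge0. Qed.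

Lemma fock_norm_pow p f : 0 < p ->
  (fock_norm p f `^ p = (p / (2 * pi))%:E * fock_int p f)%E.
Proof.
move=> p0; rewrite fock_normE -poweRrM mulVf ?gt_eqF // poweRe1 // mule_ge0 ?fock_int_ge0 //.
by rewrite lee_fin divr_ge0 ?mulr_ge0 ?pi_ge0 // ltW.
Qed.

Lemma poweR_le (X Y : \bar R) r : 0 <= r -> (0 <= X)%E -> (X <= Y)%E -> (X `^ r <= Y `^ r)%E.
Proof.
move=> r0 X0 XY; apply: gt0_ler_poweR => //; rewrite in_itv /= ?X0 ?leey //.
by rewrite (le_trans X0 XY).
Qed.

(** Estimates are carried out on the integral, where they are additive. *)
Lemma fock_norm_leP p f m : 0 < p -> 0 <= m ->
  (fock_norm p f <= m%:E)%E <-> ((p / (2 * pi))%:E * fock_int p f <= (m `^ p)%:E)%E.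
Proof.
move=> p0 m0; rewrite -fock_norm_pow //; split => H.
  by rewrite -poweR_EFin; apply: poweR_le => //; [exact: ltW|exact: fock_norm_ge0].
have := @poweR_le _ _ p^-1 _ (poweR_ge0 _ _) H.
rewrite invr_ge0 (ltW p0) => /(_ isT).
rewrite -poweRrM mulfV ?gt_eqF // poweRe1 ?fock_norm_ge0 // poweR_EFin.
by rewrite -powRrM mulfV ?gt_eqF // powRr1.
Qed.

Lemma measurable_fock p f : entire f -> measurable_fun [set: T * T]
  (fun w => (nrm (f (w.1 +i* w.2)) `^ p * expR (- (p * nrm (w.1 +i* w.2) ^+ 2 / 2)))%:E).
Proof.
move=> ef; apply/measurable_EFinP; apply: measurable_funM.
  by apply/measurable_EFinP; exact: measurable_nrm_powR.
apply: (eq_measurable_fun (fun w : T * T => expR (- (p / 2 * ((w.1 - 0) ^+ 2 + (w.2 - 0) ^+ 2))))).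
  by move=> w _; rewrite nrm_sqr /= !subr0 mulrAC.
by apply: cont2_measurable; exact: cont2_gauss.
Qed.

(** On the square of half size 4 around [z] the weight is at least
    [exp (- p (|z| + 8)^2 / 2)]. *)
Lemma fock_eval p : 0 < p -> exists2 C : R, 0 < C & forall f m, entire f -> 0 <= m ->
  (fock_norm p f <= m%:E)%E -> forall z, nrm (f z) <= C * expR ((nrm z + 8) ^+ 2 / 2) * m.
Proof.
move=> p0; have [C C0 HC] := submean_powR p0.
have pp0 : 0 < p / (2 * pi) :> R by rewrite divr_gt0 // mulr_gt0 // pi_gt0.
pose K := C / (p / (2 * pi)); have K0 : 0 < K by rewrite divr_gt0.
exists (K `^ p^-1) => [|f m ef m0 fm [a b]]; first by rewrite powR_gt0.
have /(fock_norm_leP f p0 m0) fI := fm.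
set n := nrm (a +i* b) + 8.
have n0 : 0 <= n by rewrite addr_ge0 ?nrm_ge0.
have key : nrm (f (a +i* b)) `^ p <= K * expR (p * n ^+ 2 / 2) * m `^ p.

  rewrite -lee_fin; apply: le_trans (HC f a b ef) _.
  have -> : (K * expR (p * n ^+ 2 / 2) * m `^ p)%:E =
    (C%:E * ((expR (p * n ^+ 2 / 2))%:E * ((p / (2 * pi))^-1%:E * (m `^ p)%:E)))%E.
    by rewrite -!EFinM /K; congr EFin; ring.
  rewrite lee_pmul2l //.
  have fI' : (fock_int p f <= ((p / (2 * pi))^-1)%:E * (m `^ p)%:E)%E.
    rewrite -(@lee_pmul2l _ ((p / (2 * pi))%:E)) ?lte_fin //.
    by rewrite -!EFinM mulrA mulfV ?gt_eqF // mul1r.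
  apply: (@le_trans _ _ ((expR (p * n ^+ 2 / 2))%:E * fock_int p f)%E); last first.
    by rewrite lee_pmul2l // lte_fin expR_gt0.
  rewrite /fock_int -ge0_integralZl_EFin ?expR_ge0 //; last 2 first.
  - by move=> w _; rewrite lee_fin mulr_ge0 ?powR_ge0 ?expR_ge0.
  - exact: measurable_fock.
  apply: (@le_trans _ _ (\int[mu2]_(w in qbox a b 4) ((expR (p * n ^+ 2 / 2))%:E *
     (nrm (f (w.1 +i* w.2)) `^ p * expR (- (p * nrm (w.1 +i* w.2) ^+ 2 / 2)))%:E))%E).
    apply: ge0_le_integral.
    - exact: measurable_qbox.
    - by move=> w _; rewrite lee_fin powR_ge0.
    - by apply: measurable_funTS; exact: measurable_nrm_powR.
    - by apply: measurable_funTS; apply: emeasurable_funM => //; exact: measurable_fock.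
    - move=> w wQ; rewrite -EFinM lee_fin mulrCA ler_peMr ?powR_ge0 // -expRD.
      rewrite -expR0 ler_expR -mulrBl -mulrBr mulr_ge0 // mulr_ge0 ?(ltW p0) // subr_ge0.
      rewrite ler_sqr ?nnegrE ?nrm_ge0 // /n -lerBlDl.
      apply: le_trans (ler_nrmB _ _) _.
      have wr : in_rect (a - 4) (a + 4) (b - 4) (b + 4) (w.1 +i* w.2).
        by case: wQ => /=; rewrite !in_itv /= /in_rect /= => -> ->.
      by apply: le_trans (bdry_dist_le wr) _; lra.
  apply: ge0_subset_integral => //.
  - exact: measurable_qbox.
  - by apply: emeasurable_funM => //; exact: measurable_fock.
  - by move=> w _; rewrite -EFinM lee_fin !mulr_ge0 ?powR_ge0 ?expR_ge0.
clearbody K.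
have pi0 : 0 <= p^-1 by rewrite invr_ge0 ltW.
have := @ge0_ler_powR R _ pi0 _ _ _ _ key.
rewrite !nnegrE => /(_ (powR_ge0 _ _)).
have e0 : 0 <= expR (p * n ^+ 2 / 2) by exact: expR_ge0.
rewrite !mulr_ge0 ?(ltW K0) ?powR_ge0 // => /(_ isT).
rewrite -powRrM mulfV ?gt_eqF // powRr1 ?nrm_ge0 //.
rewrite powRM ?mulr_ge0 ?(ltW K0) ?powR_ge0 // powRM ?(ltW K0) //.
rewrite -[(m `^ p) `^ _]powRrM mulfV ?gt_eqF // powRr1 //.
have -> : expR (p * n ^+ 2 / 2) `^ p^-1 = expR (n ^+ 2 / 2).
  rewrite /powR gt_eqF ?expR_gt0 // expRK; congr expR; field; exact: lt0r_neq0.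
by [].
Qed.

End FockNorm.

(** * Normalized reproducing kernels *)

Section Kernels.
Variable R : realType.
Notation Re := (@complex.Re R).
Notation Im := (@complex.Im R).
Implicit Types (f g : R[i] -> R[i]) (p q r s t m x y : R) (a b c d h k z w : R[i]).

Lemma fock_norm_scale q f g t : 0 < q -> 0 <= t -> entire g ->
  (forall z, nrm (f z) = t * nrm (g z)) -> (fock_norm q f = t%:E * fock_norm q g)%E.
Proof.
move=> q0 t0 eg fg; rewrite !fock_normE.
have -> : (fock_int q f = (t `^ q)%:E * fock_int q g)%E.
  rewrite /fock_int -ge0_integralZl_EFin ?powR_ge0 //; last 2 first.
  - by move=> w _; rewrite lee_fin mulr_ge0 ?powR_ge0 ?expR_ge0.
  - exact: measurable_fock.
  by apply: eq_integral => w _; rewrite -EFinM fg powRM ?nrm_ge0 // -mulrA.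
have q2 : 0 <= q / (2 * pi) by rewrite divr_ge0 ?mulr_ge0 ?pi_ge0 // ltW.
have X0 : (0 <= (q / (2 * pi))%:E * fock_int q g)%E by apply: mule_ge0; rewrite ?fock_int_ge0 ?lee_fin.
rewrite muleCA [LHS]poweRM ?lee_fin ?powR_ge0 //.
by rewrite poweR_EFin -powRrM mulfV ?gt_eqF // powRr1.
Qed.

(** All upper bounds for Fock norms below come from pointwise bounds that leave
    some Gaussian decay. *)
Lemma fock_norm_gauss_bound q g (e dl : R) : 0 < q -> 0 <= e -> 0 < dl -> entire g ->
  (forall z, nrm (g z) <= e * expR ((2^-1 - dl) * nrm z ^+ 2)) ->
  (fock_norm q g <= (e * ((2 * dl)^-1) `^ q^-1)%:E)%E.
Proof.
move=> q0 e0 dl0 eg gB; have q1 : 0 <= q^-1 by rewrite invr_ge0 ltW.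
apply/fock_norm_leP => //; first by rewrite mulr_ge0 ?powR_ge0.
rewrite powRM ?powR_ge0 // -powRrM mulVf ?gt_eqF // powRr1; last first.
  by rewrite invr_ge0 mulr_ge0 // ltW.
have qd : 0 < q * dl by rewrite mulr_gt0.
apply: (@le_trans _ _ ((q / (2 * pi))%:E * ((e `^ q)%:E * (pi / (q * dl))%:E))%E); last first.
  rewrite -!EFinM lee_fin le_eqVlt; apply/orP; left; apply/eqP.
  have := pi_gt0 R; move: (@pi R) => P P0; field.
  by rewrite !gt_eqF.
apply: lee_wpmul2l; first by rewrite lee_fin divr_ge0 ?mulr_ge0 ?pi_ge0 // ltW.
rewrite -(gauss2 0 0 qd) -ge0_integralZl_EFin ?powR_ge0 //; last first.
  by apply/measurable_EFinP; apply: cont2_measurable; exact: cont2_gauss.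
apply: ge0_le_integral => //.
- by move=> w _; rewrite lee_fin mulr_ge0 ?powR_ge0 ?expR_ge0.
- exact: measurable_fock.
- apply: emeasurable_funM => //.
  by apply/measurable_EFinP; apply: cont2_measurable; exact: cont2_gauss.
move=> w _; rewrite -EFinM lee_fin.
have := @ge0_ler_powR R q (ltW q0) _ _ _ _ (gB (w.1 +i* w.2)).
rewrite !nnegrE => /(_ (nrm_ge0 _)); rewrite mulr_ge0 ?expR_ge0 // => /(_ isT).
rewrite powRM ?expR_ge0 // => H; apply: le_trans (ler_wpM2r (expR_ge0 _) H) _.
rewrite -(mulrA (e `^ q)); apply: ler_wpM2l; first exact: powR_ge0.
rewrite /powR gt_eqF ?expR_gt0 // expRK -expRD ler_expR.
rewrite !subr0 nrm_sqr /= le_eqVlt; apply/orP; left; apply/eqP; by field.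
Qed.

(** The reproducing kernel of the Hilbert case [p = 2] at [w], divided by its norm. *)
Definition kern w z : R[i] := cexp (w^* * z - (nrm w ^+ 2 / 2)%:C).

Lemma entire_kern w : entire (kern w).
Proof.
have -> : kern w = @cexp R \o affine (w^*) (- (nrm w ^+ 2 / 2)%:C) by [].
by apply: entire_comp; [exact: entire_cexp|exact: entire_affine].
Qed.

Lemma nrm_kern w z : nrm (kern w z) = expR (Re (w^* * z) - nrm w ^+ 2 / 2).
Proof. by rewrite /kern nrm_cexp Re_subc. Qed.

(** After multiplication by the weight the modulus of [kern w] is the Gaussian
    centred at [w]. *)
Lemma fock_norm_kern p w : 0 < p -> fock_norm p (kern w) = 1%E.
Proof.
move=> p0; rewrite fock_normE.
have -> : fock_int p (kern w) = (pi / (p / 2))%:E.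
  rewrite -(gauss2 (Re w) (Im w)) ?divr_gt0 //; apply: eq_integral => z _.
  rewrite nrm_kern /powR gt_eqF ?expR_gt0 // expRK -expRD; congr (expR _)%:E.
  by rewrite !nrm_sqr; case: w => u v /=; field.
have -> : ((p / (2 * pi))%:E * (pi / (p / 2))%:E = 1)%E.
  rewrite -EFinM; congr EFin; have := pi_gt0 R; move: (@pi R) => P P0.
  by field; rewrite !gt_eqF.
by rewrite poweR1r.
Qed.

(** Composition with an affine map turns kernels into multiples of kernels; the
    scalar factor decides which maps induce bounded operators. *)
Lemma kern_affine w c d z : nrm (kern w (affine c d z)) =
  expR (Re (w^* * d) - (1 - nrm c ^+ 2) * nrm w ^+ 2 / 2) * nrm (kern (c^* * w) z).
Proof.
rewrite !nrm_kern -expRD nrmM nrmJ exprMn; congr expR; rewrite /affine !nrm_sqr.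
by case: w c d z => [w1 w2] [c1 c2] [d1 d2] [z1 z2] /=; field.
Qed.

Lemma fock_norm_kern_affine q w c d : 0 < q -> fock_norm q (kern w \o affine c d) =
  (expR (Re (w^* * d) - (1 - nrm c ^+ 2) * nrm w ^+ 2 / 2))%:E.
Proof.
move=> q0; rewrite (fock_norm_scale q0 (expR_ge0 _) (@entire_kern (c^* * w)) (kern_affine w c d)).
by rewrite fock_norm_kern // mule1.
Qed.

Lemma kern_fin p w : 0 < p -> (fock_norm p (kern w) < +oo)%E.
Proof. by move=> p0; rewrite fock_norm_kern // ltry. Qed.

Definition fock_kern p (p0 : 0 < p) w : fock p := Fock (@entire_kern w) (kern_fin w p0).

Lemma op_norm_ge p q (U : fock p -> (R[i] -> R[i])) (f : fock p) :
  (fock_norm p f <= 1)%E -> (fock_norm q (U f) <= op_norm q U)%E.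
Proof. by move=> f1; apply: ereal_sup_ubound; exists f. Qed.

Lemma comp_op_kern p q (S : comp_op p q) (phi : R[i] -> R[i]) : 0 < p -> 0 < q ->
  induced_by S phi -> exists2 M, 0 <= M & op_norm q (fun f : fock p => S f : R[i] -> R[i]) = M%:E /\
  forall w, (fock_norm q (kern w \o phi) <= M%:E)%E.
Proof.
move=> p0 q0 iS.
have H w : (fock_norm q (kern w \o phi) <= op_norm q (fun f : fock p => S f : R[i] -> R[i]))%E.
  rewrite -(iS (fock_kern p0 w)); apply: (@op_norm_ge p q (fun g : fock p => fock_fun (S g)) (fock_kern p0 w)).
  by rewrite fock_norm_kern.
have S0 : (0 <= op_norm q (fun f : fock p => S f : R[i] -> R[i]))%E := le_trans (fock_norm_ge0 _ _) (H 0).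
case E : (op_norm q _) S0 (comp_op_bounded S) H => [M| |] // S0 _ H.
by exists M.
Qed.

(** For [w = t d] with [t] real, the image of the kernel has norm [exp (t |d|^2)]. *)
Lemma unimodular_bounded p q (S : comp_op p q) c d : 0 < p -> 0 < q ->
  induced_by S (affine c d) -> nrm c = 1 -> d = 0.
Proof.
move=> p0 q0 iS c1; have [M M0 [_ HM]] := comp_op_kern p0 q0 iS.
apply/eqP; rewrite -nrm_eq0; apply/negPn/negP => d0.
have d2 : 0 < nrm d ^+ 2 by rewrite exprn_gt0 // lt_neqAle eq_sym d0 nrm_ge0.
(* At this point the image of the kernel has norm [exp M], which exceeds [M]. *)
have := HM ((M / nrm d ^+ 2)%:C * d).
rewrite fock_norm_kern_affine // c1 expr1n subrr !mul0r subr0 lee_fin.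
have -> : Re (((M / nrm d ^+ 2)%:C * d)^* * d) = M.
  have H x : Re ((x%:C * d)^* * d) = x * nrm d ^+ 2.
    by rewrite nrm_sqr; case: (d) => ? ? /=; ring.
  by rewrite H divfK // gt_eqF.
by have := expR_ge1Dx M; lra.
Qed.

(** The image of [kern (phi z)] takes at [z] a value of modulus [exp (|phi z|^2 / 2)],
    and a point evaluation bounds it by a multiple of [exp ((|z| + 8)^2 / 2)]; so
    [|phi z| - |z|] is bounded above. *)
Lemma bounded_symbol_affine p q (S : comp_op p q) (phi : R[i] -> R[i]) : 0 < p -> 0 < q ->
  entire phi -> induced_by S phi -> exists c d, phi = affine c d.
Proof.
move=> p0 q0 ephi iS; have [M M0 [_ HM]] := comp_op_kern p0 q0 iS.
have [C C0 HC] := fock_eval q0.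
(* The summand 1 makes the logarithm of [B] nonnegative. *)
pose B := 1 + C * M; have B1 : 1 <= B by rewrite lerDl mulr_ge0 // ltW.
have L0 : 0 <= ln B by rewrite ln_ge0.
apply: (@liouville_affine _ phi 1 (8 + ln B)) => //; first by rewrite addr_ge0.
move=> z; set n := nrm z; set m := nrm (phi z).
have n0 : 0 <= n by exact: nrm_ge0.
have := HC (kern (phi z) \o phi) M (entire_comp (@entire_kern (phi z)) ephi) M0 (HM _) z.
rewrite [nrm (_ z)]nrm_kern mulJ_nrm /= -/m -/n => H.
have {}H : expR (m ^+ 2 / 2) <= expR (ln B + (n + 8) ^+ 2 / 2).
  rewrite expRD lnK ?posrE ?(lt_le_trans ltr01) //.
  have -> : m ^+ 2 / 2 = m ^+ 2 - m ^+ 2 / 2 by field.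
  apply: le_trans H _; rewrite mulrAC ler_wpM2r ?expR_ge0 // /B lerDr //.
move: H; rewrite ler_expR => H.
have m0 : 0 <= m by exact: nrm_ge0.
clearbody m n.
rewrite mul1r -ler_sqr ?nnegrE ?addr_ge0 //.
move: L0 H; move: (ln B) => L L0 H; nra.
Qed.

End Kernels.

(** * Distance to a rotation *)

Section LowerBound.
Variable R : realType.
Notation mu2 := (@lebesgue_measure R \x @lebesgue_measure R)%E.
Notation T := (measurableTypeR R).
Notation Re := (@complex.Re R).
Notation Im := (@complex.Im R).
Implicit Types (p q r s m x y : R) (a b c d h k z w u v : R[i]).

(** If [be <= eta * al], then [al - be] is at least [(1 - eta) * al].  Otherwise
    [al * al] is at most [eta^-1 * (al * be)] and the last term dominates.  A
    geometric mean of [al] and [be] is used because the product of two Gaussians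
    is again a Gaussian. *)
Lemma powR_dist_lb q (eta al be : R) : 0 < q -> 0 < eta -> eta < 1 -> 0 <= al -> 0 <= be ->
  (1 - eta) `^ q * al `^ q <=
  `|al - be| `^ q + (eta `^ (q / 2))^-1 * (al * be) `^ (q / 2).
Proof.
move=> q0 e0 e1 a0 b0; have q2 : 0 < q / 2 by rewrite divr_gt0.
have ep : 0 < eta `^ (q / 2) by rewrite powR_gt0.
have e1' : 0 <= 1 - eta by rewrite subr_ge0 ltW.
have [be_le|be_gt] := leP be (eta * al).
  apply: ler_wpDr; first by rewrite mulr_ge0 ?powR_ge0 // invr_ge0 powR_ge0.
  rewrite -powRM //; apply: ge0_ler_powR; rewrite ?nnegrE ?(ltW q0) ?mulr_ge0 //.
  by apply: le_trans (ler_norm _); lra.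
apply: ler_wpDl; first exact: powR_ge0.
rewrite [leRHS]mulrC ler_pdivlMr //.
have aa : al `^ q = (al * al) `^ (q / 2).
  rewrite powRM // -powRD; first by rewrite -splitr.
  by rewrite -splitr gt_eqF.
have h1 : (1 - eta) `^ q <= 1.
  have := @ge0_ler_powR R q (ltW q0) (1 - eta) 1; rewrite !nnegrE powR1; apply=> //.
  by lra.
rewrite aa; apply: (@le_trans _ _ ((al * al) `^ (q / 2) * eta `^ (q / 2))).
  by rewrite ler_wpM2r ?powR_ge0 // ler_piMl ?powR_ge0.
rewrite -powRM ?mulr_ge0 ?(ltW e0) //.
apply: ge0_ler_powR; rewrite ?nnegrE ?(ltW q2) ?mulr_ge0 ?(ltW e0) //.
by rewrite -mulrA ler_wpM2l // mulrC ltW.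
Qed.

Lemma kern_weight v z : nrm (kern v z) * expR (- (nrm z ^+ 2 / 2)) =
  expR (- (2^-1 * ((Re z - Re v) ^+ 2 + (Im z - Im v) ^+ 2))).
Proof.
rewrite nrm_kern -expRD; congr expR; rewrite !nrm_sqr.
by case: v z => [? ?] [? ?] /=; field.
Qed.

(** The parallelogram identity
    [|z - u|^2 + |z - v|^2 = 2 |z - (u + v) / 2|^2 + |u - v|^2 / 2]. *)
Lemma two_gaussians q (lam : R) u v z (al be : R) : 0 <= lam ->
  al = expR (- (2^-1 * ((Re z - Re u) ^+ 2 + (Im z - Im u) ^+ 2))) ->
  be = lam * expR (- (2^-1 * ((Re z - Re v) ^+ 2 + (Im z - Im v) ^+ 2))) ->
  (al * be) `^ (q / 2) = lam `^ (q / 2) * expR (- (q / 8 * nrm (u - v) ^+ 2)) *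
   expR (- (q / 2 * ((Re z - Re ((u + v) / 2)) ^+ 2 + (Im z - Im ((u + v) / 2)) ^+ 2))).
Proof.
move=> l0 -> ->; rewrite mulrCA powRM ?mulr_ge0 ?expR_ge0 // -mulrA; congr (_ * _).
rewrite -!expRD {1}/powR gt_eqF ?expR_gt0 // expRK; congr expR.
have -> : (u + v) / 2 = (2^-1)%:C * (u + v).
  by rewrite mulrC fmorphV; congr (_^-1 * _); rewrite -[LHS]/(2%:R) -(rmorph_nat (real_complex R)).
by rewrite nrm_sqr; case: u v z => [? ?] [? ?] [? ?] /=; field.
Qed.

(** Integrate [powR_dist_lb] with [al] and [be] the weighted moduli of the two
    functions.  The factor [exp (- q / 8 * |u - v|^2)] is what makes two kernels with
    distant centres almost orthogonal, for every exponent. *)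
Lemma difference_kern q a c d w (eta : R) : 0 < q -> 0 < eta -> eta < 1 -> nrm a = 1 ->
  (((1 - eta) `^ q)%:E <= fock_norm q (fun z => kern w (affine a 0 z) - kern w (affine c d z))%R `^ q +
   ((eta `^ (q / 2))^-1 * (fine (fock_norm q (kern w \o affine c d)) `^ (q / 2) *
     expR (- (q / 8 * (nrm (a - c) * nrm w) ^+ 2))))%:E)%E.
Proof.
move=> q0 e0 e1 a1; have q2 : 0 < q / 2 by rewrite divr_gt0.
rewrite fock_norm_kern_affine //=; set lam := expR _.
have lam0 : 0 <= lam by exact: expR_ge0.
have ep : 0 < eta `^ (q / 2) by rewrite powR_gt0.
pose u := a^* * w; pose v := c^* * w.
have uv : nrm (a - c) * nrm w = nrm (u - v).
  by rewrite /u /v -mulrBl -rmorphB nrmM nrmJ.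
pose D z := kern w (affine a 0 z) - kern w (affine c d z).
have eD : entire D.
  have -> : D = ((kern w \o affine a 0) \- (kern w \o affine c d))%R by [].
  exact: (entireB (entire_comp (@entire_kern R w) (@entire_affine R a 0))
    (entire_comp (@entire_kern R w) (@entire_affine R c d))).
pose K := (eta `^ (q / 2))^-1 * (lam `^ (q / 2) * expR (- (q / 8 * nrm (u - v) ^+ 2))).
have K0 : 0 <= K by rewrite !mulr_ge0 ?invr_ge0 ?powR_ge0 ?expR_ge0.
rewrite uv -/K -/D fock_norm_pow //.
pose G v' := fun t : T * T => expR (- (q / 2 * ((t.1 - Re v') ^+ 2 + (t.2 - Im v') ^+ 2))).
have mG v' : measurable_fun [set: T * T] (fun t => (G v' t)%:E).
  by apply/measurable_EFinP; apply: cont2_measurable; exact: cont2_gauss.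
have IG v' : (\int[mu2]_t (G v' t)%:E = (pi / (q / 2))%:E)%E by exact: gauss2.
have G0 v' t : 0 <= G v' t by exact: expR_ge0.
have point (t : T * T) : (1 - eta) `^ q * G u t <=
    nrm (D (t.1 +i* t.2)) `^ q * expR (- (q * nrm (t.1 +i* t.2) ^+ 2 / 2)) + K * G ((u + v) / 2) t.
  set z := t.1 +i* t.2.
  pose E := expR (- (nrm z ^+ 2 / 2)); have E0 : 0 <= E by exact: expR_ge0.
  pose al := nrm (kern w (affine a 0 z)) * E.
  pose be := nrm (kern w (affine c d z)) * E.
  have al0 : 0 <= al by rewrite mulr_ge0 ?nrm_ge0.
  have be0 : 0 <= be by rewrite mulr_ge0 ?nrm_ge0.
  have alE : al = expR (- (2^-1 * ((Re z - Re u) ^+ 2 + (Im z - Im u) ^+ 2))).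
    rewrite -kern_weight /al kern_affine a1 expr1n subrr !mul0r subr0 mulr0.
    by rewrite [Re 0]/= expR0 mul1r.
  have beE : be = lam * expR (- (2^-1 * ((Re z - Re v) ^+ 2 + (Im z - Im v) ^+ 2))).
    by rewrite -kern_weight /be kern_affine; exact/esym/mulrA.
  have := powR_dist_lb q0 e0 e1 al0 be0.
  rewrite (two_gaussians q lam0 alE beE) => H.
  have -> : G u t = al `^ q.
    rewrite alE /powR gt_eqF ?expR_gt0 // expRK /G /z /=; congr expR; by ring.
  apply: le_trans H _; rewrite [_^-1 * _]mulrA -/K lerD2r.
  have -> : expR (- (q * nrm z ^+ 2 / 2)) = E `^ q.
    by rewrite /E /powR gt_eqF ?expR_gt0 // expRK; congr expR; ring.
  rewrite -powRM ?nrm_ge0 //; apply: ge0_ler_powR; rewrite ?nnegrE ?(ltW q0) ?mulr_ge0 ?nrm_ge0 //.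
  by rewrite /al /be -mulrBl normrM (ger0_norm E0) ler_wpM2r // /D ler_dist_nrm.
have int : (((1 - eta) `^ q)%:E * (pi / (q / 2))%:E <=
    fock_int q D + K%:E * (pi / (q / 2))%:E)%E.
  rewrite -{1}(IG u) -(IG ((u + v) / 2)) /fock_int.
  rewrite -ge0_integralZl_EFin ?powR_ge0 //; last by move=> t _; rewrite lee_fin.
  rewrite -ge0_integralZl_EFin //; last by move=> t _; rewrite lee_fin.
  rewrite -ge0_integralD //; last 4 first.
  - by move=> t _; rewrite lee_fin mulr_ge0 ?powR_ge0 ?expR_ge0.
  - exact: measurable_fock.
  - by move=> t _; rewrite -EFinM lee_fin mulr_ge0.
  - exact: emeasurable_funM.
  apply: ge0_le_integral => //.
  - by move=> t _; rewrite -EFinM lee_fin mulr_ge0 ?powR_ge0.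
  - exact: emeasurable_funM.
  - by apply: emeasurable_funD; [exact: measurable_fock|exact: emeasurable_funM].
  - by move=> t _; rewrite -!EFinM -EFinD lee_fin; exact: point.
have P0 := pi_gt0 R.
have cc : q / (2 * pi) * (pi / (q / 2)) = 1.
  by move: P0; move: (@pi R) => P P0; field; rewrite !gt_eqF.
have c0 : 0 <= q / (2 * pi) :> R by rewrite divr_ge0 ?mulr_ge0 ?(ltW P0) // ltW.
have := lee_wpmul2l (x := (q / (2 * pi))%:E) c0 int.
rewrite muleDr ?ge0_adde_def ?inE ?fock_int_ge0 //; last by rewrite -EFinM lee_fin mulr_ge0 // divr_ge0 ?(ltW q2) // ltW.
have E1 x : ((q / (2 * pi))%:E * (x%:E * (pi / (q / 2))%:E) = x%:E)%E.
  by rewrite -!EFinM mulrCA cc mulr1.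
by rewrite !E1.

Qed.

(** The centres of the two Gaussians are at distance [|a - c| |w|], while the norm of
    the second function stays below the norm of [S]; so the interaction term in
    [difference_kern] tends to 0 as [w] tends to infinity. *)
Lemma diff_norm_ge1 p q (U S : comp_op p q) a c d : 0 < p -> 0 < q -> nrm a = 1 -> c != a ->
  induced_by U (affine a 0) -> induced_by S (affine c d) ->
  (1 <= op_norm q (op_diff U S))%E.
Proof.
move=> p0 q0 a1 ca iU iS.
have [M M0 [_ HM]] := comp_op_kern p0 q0 iS.
have HD w : (fock_norm q (fun z => kern w (affine a 0 z) - kern w (affine c d z))%R <= op_norm q (op_diff U S))%E.
  have -> : (fun z => kern w (affine a 0 z) - kern w (affine c d z)) = op_diff U S (fock_kern p0 w).
    by rewrite /op_diff (iU (fock_kern p0 w)) (iS (fock_kern p0 w)).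
  by apply: op_norm_ge; rewrite fock_norm_kern.
have N0 : (0 <= op_norm q (op_diff U S))%E := le_trans (fock_norm_ge0 _ _) (HD 0).
case: (op_norm q (op_diff U S)) N0 HD => [N| |] // N0 HD; last by rewrite leey.
rewrite lee_fin in N0; rewrite lee_fin.
have eta_bound (eta : R) : 0 < eta -> eta < 1 -> (1 - eta) `^ q <= N `^ q.
  move=> e0 e1; apply/ler_addgt0Pr => eps eps0.
  pose Dc := (eta `^ (q / 2))^-1 * M `^ (q / 2).
  have D0 : 0 <= Dc by rewrite mulr_ge0 ?invr_ge0 ?powR_ge0.
  pose ka := q / 8 * nrm (a - c) ^+ 2.
  have ka0 : 0 < ka.
    by rewrite mulr_gt0 ?divr_gt0 // exprn_gt0 // nrm_gt0 subr_eq0 eq_sym.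
  (* This [w] makes the exponent in [difference_kern] equal to [- (Dc / eps)], and
   [exp x] exceeds [x]. *)
pose w : R[i] := (Num.sqrt (Dc / (eps * ka)))%:C.
  have w2 : nrm w ^+ 2 = Dc / (eps * ka).
    by rewrite nrmR real_normK ?num_real // sqr_sqrtr // divr_ge0 // mulr_ge0 // ltW.
  have := difference_kern c d w q0 e0 e1 a1.
  set X := (fock_norm q _ `^ q)%E.
  have XN : (X <= (N `^ q)%:E)%E.
    by rewrite -poweR_EFin; apply: poweR_le; rewrite ?(ltW q0) ?fock_norm_ge0 ?HD.
  move=> H; rewrite -lee_fin; apply: le_trans H _; rewrite EFinD; apply: leeD => //.
  rewrite lee_fin.
  have fM : fine (fock_norm q (kern w \o affine c d)) `^ (q / 2) <= M `^ (q / 2).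
    have hw := HM w; move: hw; rewrite fock_norm_kern_affine // lee_fin /= => hw.
    by apply: ge0_ler_powR; rewrite ?nnegrE ?expR_ge0 // divr_ge0 // ltW.
  apply: (@le_trans _ _ (Dc * expR (- (q / 8 * (nrm (a - c) * nrm w) ^+ 2)))).
    rewrite /Dc -[leRHS]mulrA; apply: ler_wpM2l; first by rewrite invr_ge0 powR_ge0.
    by apply: ler_wpM2r; first exact: expR_ge0.
  have -> : q / 8 * (nrm (a - c) * nrm w) ^+ 2 = Dc / eps.
    by rewrite exprMn w2 /ka; field; rewrite ?gt_eqF // nrm_gt0 subr_eq0 eq_sym.
  rewrite expRN ler_pdivrMr ?expR_gt0 // mulrC -ler_pdivrMr //.
  by apply: le_trans (expR_ge1Dx _); rewrite lerDr.
apply/ler_addgt0Pr => eps eps0.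
have [e1|e1] := ltP eps 1; last by lra.
rewrite -lerBlDr leNgt; apply/negP => NB.
have := eta_bound eps eps0 e1; rewrite leNgt => /negP; apply.
apply: gt0_ltr_powR; rewrite ?nnegrE // subr_ge0 ltW //.
Qed.

Lemma fock_ext p (f g : fock p) : (f : R[i] -> R[i]) = g -> f = g.
Proof.
case: f => f ef nf; case: g => g eg ng /= E; subst g.
by rewrite (Prop_irrelevance ef eg) (Prop_irrelevance nf ng).
Qed.

Lemma comp_op_ext p q (U S : comp_op p q) (phi : R[i] -> R[i]) :
  induced_by U phi -> induced_by S phi -> S = U.
Proof.
move=> iU iS.
have ES : comp_op_fun S = comp_op_fun U.
  by apply/funext => f; apply: fock_ext; rewrite (iS f) (iU f).
case: U S iU iS ES => [U sU bU] [S sS bS] /= _ _ E; subst S.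
by rewrite (Prop_irrelevance sU sS) (Prop_irrelevance bU bS).
Qed.

End LowerBound.

(** * Symbols that contract *)

Section Contraction.
Variable R : realType.
Implicit Types (f g : R[i] -> R[i]) (p q r s m x : R) (a b c d h k z w u v : R[i]).

Lemma entire_comp_affine f a b : entire f -> entire (f \o affine a b).
Proof. by move=> ef; exact: (entire_comp ef (@entire_affine R a b)). Qed.

(** By [fock_eval] this class contains a ball of the Fock space.  Unlike that ball, it
    is visibly closed under pointwise limits. *)
Definition growth_class (A : R) f := entire f /\
  forall z, nrm (f z) <= A * expR ((nrm z + 8) ^+ 2 / 2).

Lemma growth_taylor (A : R) f z : 0 <= A -> growth_class A f ->
  exists2 k, nrm k <= 8 * (A * expR ((nrm z + 12) ^+ 2 / 2)) &
    forall h, nrm h <= 1 ->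
      nrm (f (z + h) - f z - k * h) <= 8 * (A * expR ((nrm z + 12) ^+ 2 / 2)) * nrm h ^+ 2.
Proof.
move=> A0 [ef fA].
have [|k k1 k2] := @cauchy_taylor R f z 1 (A * expR ((nrm z + 12) ^+ 2 / 2)) ef ltr01.
  move=> w wz; apply: le_trans (fA w) _; rewrite ler_wpM2l // ler_expR.
  rewrite ler_wpM2r // ler_sqr ?nnegrE ?addr_ge0 ?nrm_ge0 //.
  have := nrmD (w - z) z; rewrite subrK => H; lra.
by exists k => [|h /k2]; rewrite ?divr1 in k1 * => //; rewrite divr1.
Qed.

Lemma growth_lipschitz (A : R) f z h : 0 <= A -> growth_class A f -> nrm h <= 1 ->
  nrm (f (z + h) - f z) <= 16 * (A * expR ((nrm z + 12) ^+ 2 / 2)) * nrm h.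
Proof.
move=> A0 fA h1; have [k k1 k2] := growth_taylor z A0 fA.
rewrite -[f (z + h) - f z](subrK (k * h)); apply: le_trans (nrmD _ _) _.
have := k2 _ h1; move: k1; set B := 8 * _ => k1 {}k2.
have -> : 16 * (A * expR ((nrm z + 12) ^+ 2 / 2)) * nrm h = B * nrm h + B * nrm h.
  by rewrite /B; ring.
have h0 := nrm_ge0 h; have B0 : 0 <= B := le_trans (nrm_ge0 _) k1.
apply: lerD; last by rewrite nrmM ler_wpM2r.
by apply: le_trans k2 _; rewrite expr2 mulrA ler_piMr // mulr_ge0.
Qed.

(** The cross term [2 s n be] is absorbed in half of the gap between [n^2] and
    [s^2 n^2]. *)
Lemma contraction_weight s (be : R) : 0 <= s -> s < 1 -> 0 <= be ->
  exists dl L : R, [/\ 0 < dl, dl <= 2^-1 & forall n : R, 0 <= n ->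
    (s * n + be) ^+ 2 / 2 <= (2^-1 - dl) * n ^+ 2 + L].
Proof.
move=> s0 s1 b0; have s2 : 0 < 1 - s ^+ 2 by rewrite subr_gt0 expr_lt1.
(* [th] is half of the gap [1 - s ^+ 2]; the other half is left as decay. *)
pose th := (1 - s ^+ 2) / 2; have th0 : 0 < th by rewrite divr_gt0.
exists (th / 2), ((be ^+ 2 / th + be ^+ 2) / 2); split; first by rewrite divr_gt0.
  by rewrite /th; have := sqr_ge0 s; lra.
move=> n n0.
have key : 2 * (s * n) * be <= th * n ^+ 2 + be ^+ 2 / th.
  rewrite -(ler_pM2r th0) [leRHS]mulrDl divfK ?gt_eqF //.
  have h1 : 2 * (n * be) * th <= (th * n) ^+ 2 + be ^+ 2.
    by have := sqr_ge0 (th * n - be); rewrite sqrrB; lra.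
  have h2 : 2 * (s * n) * be * th <= 2 * (n * be) * th.
    have : s * (n * be * th) <= n * be * th by apply: ler_piMl; [exact: mulr_ge0 (mulr_ge0 n0 b0) (ltW th0)|exact: ltW].
    lra.
  apply: le_trans h2 (le_trans h1 _); rewrite le_eqVlt; apply/orP; left; apply/eqP; ring.
have E : s ^+ 2 = 1 - 2 * th by rewrite /th; field.
have -> : (s * n + be) ^+ 2 = s ^+ 2 * n ^+ 2 + 2 * (s * n) * be + be ^+ 2 by ring.
rewrite E; move: key; move: (be ^+ 2 / th) (n ^+ 2) (2 * (s * n) * be) (be ^+ 2) => X Y Z W; lra.
Qed.

Lemma affine_weight a b (be : R) : nrm a < 1 -> 0 <= be -> exists dl L : R,
  [/\ 0 < dl, dl <= 2^-1 & forall z, expR ((nrm (affine a b z) + be) ^+ 2 / 2) <=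
    expR L * expR ((2^-1 - dl) * nrm z ^+ 2)].
Proof.
move=> a1 b0; have bb : 0 <= nrm b + be by rewrite addr_ge0 ?nrm_ge0.
have [dl [L [dl0 dl2 H]]] := contraction_weight (nrm_ge0 a) a1 bb.
exists dl, L; split=> // z; rewrite -expRD ler_expR [leRHS]addrC.
apply: (le_trans _ (H _ (nrm_ge0 z))); rewrite ler_wpM2r // ler_sqr ?nnegrE ?addr_ge0 ?mulr_ge0 ?nrm_ge0 //.
rewrite addrA lerD2r; apply: le_trans (nrmD _ _) _; by rewrite nrmM.
Qed.

(** The composite grows more slowly than the weight decays, for every exponent [q]. *)
Lemma growth_comp_norm q a b : 0 < q -> nrm a < 1 -> exists2 K : R, 0 <= K &
  forall (A : R) f, 0 <= A -> growth_class A f -> (fock_norm q (f \o affine a b) <= (A * K)%:E)%E.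
Proof.
move=> q0 a1; have [dl [L [dl0 dl2 H]]] := affine_weight b a1 (ler0n R 8).
exists (expR L * ((2 * dl)^-1) `^ q^-1) => [|A f A0 [ef fA]].
  by rewrite mulr_ge0 ?expR_ge0 ?powR_ge0.
have AL : 0 <= A * expR L by rewrite mulr_ge0 ?expR_ge0.
rewrite mulrA.
apply: (@fock_norm_gauss_bound R q (f \o affine a b) _ dl q0 AL dl0 (entire_comp_affine ef)).
move=> z; apply: le_trans (fA _) _; rewrite -mulrA; exact: ler_wpM2l.
Qed.

Lemma fock_growth p : 0 < p -> exists2 C : R, 0 < C & forall (f : fock p) (M : R), 0 <= M ->
  (fock_norm p f <= M%:E)%E -> growth_class (C * M) f.
Proof.
move=> p0; have [C C0 H] := fock_eval p0; exists C => // f M M0 fM.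
split; first exact: fock_entire.
by move=> z; rewrite mulrAC; apply: H => //; exact: fock_entire.
Qed.

Lemma op_norm_le p q (U : fock p -> (R[i] -> R[i])) (K : R) :
  (forall f : fock p, (fock_norm p f <= 1)%E -> (fock_norm q (U f) <= K%:E)%E) ->
  (op_norm q U <= K%:E)%E.
Proof. by move=> H; apply: ge_ereal_sup => _ [f f1 <-]; exact: H. Qed.

Lemma fock_finite p (f : fock p) : exists2 M : R, 0 <= M & fock_norm p f = M%:E.
Proof.
have := fock_norm_fin f; have := fock_norm_ge0 p f.
by case: (fock_norm p f) => [M| |] // M0 _; exists M.
Qed.

Lemma contraction_comp_op p q a b : 0 < p -> 0 < q -> nrm a < 1 ->
  exists S : comp_op p q, induced_by S (affine a b).
Proof.
move=> p0 q0 a1; have [C C0 HC] := fock_growth p0.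
have [K K0 HK] := growth_comp_norm b q0 a1.
have ent (f : fock p) : entire (f \o affine a b).
  exact: (entire_comp_affine (@fock_entire _ _ f)).
have fin (f : fock p) : (fock_norm q (f \o affine a b) < +oo)%E.
  have [M M0 fM] := fock_finite f.
  apply: le_lt_trans (HK (C * M) f _ _) (ltry _); first by rewrite mulr_ge0 // ltW.
  by apply: HC => //; rewrite fM.
pose S (f : fock p) : fock q := Fock (ent f) (fin f).
have iS : induced_by S (affine a b) by [].
have bS : (op_norm q (fun f : fock p => S f : R[i] -> R[i]) < +oo)%E.
  apply: (@le_lt_trans _ _ (C * 1 * K)%:E); last exact: ltry.
  apply: op_norm_le => f f1; apply: HK; first by rewrite mulr_ge0 // ltW.
  exact: HC.
exists (CompOp (ex_intro2 _ _ _ (@entire_affine R a b) iS) bS).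
by [].
Qed.

(** Functions of the unit ball are Lipschitz on unit discs, with a constant that
    still leaves some Gaussian decay after composition. *)
Lemma contraction_near p q a b : 0 < p -> 0 < q -> nrm a < 1 -> exists2 K : R, 0 <= K &
  forall b' (U S : comp_op p q), nrm (b' - b) <= 1 ->
    induced_by U (affine a b) -> induced_by S (affine a b') ->
    (op_norm q (op_diff U S) <= (nrm (b' - b) * K)%:E)%E.
Proof.
move=> p0 q0 a1; have [C C0 HC] := fock_growth p0.
have [dl [L [dl0 dl2 H]]] := affine_weight b a1 (ler0n R 12).
exists (16 * C * expR L * ((2 * dl)^-1) `^ q^-1) => [|b' U S b1 iU iS].
  by rewrite !mulr_ge0 ?expR_ge0 ?powR_ge0 // ltW.
apply: op_norm_le => f f1; rewrite mulrA.
have fC : growth_class C f by rewrite -(mulr1 C); exact: HC.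
have -> : op_diff U S f = ((f \o affine a b) \- (f \o affine a b'))%R.
  by rewrite /op_diff (iU f) (iS f).
have ef := @fock_entire _ _ f.
have CL : 0 <= nrm (b' - b) * (16 * C * expR L).
  by rewrite !mulr_ge0 ?nrm_ge0 ?expR_ge0 // ltW.
apply: (@fock_norm_gauss_bound R q _ _ dl q0 CL dl0
  (entireB (entire_comp_affine ef) (entire_comp_affine ef))).
move=> z; rewrite /= [leLHS]nrmBC.
have -> : affine a b' z = affine a b z + (b' - b) by rewrite /affine; ring.
apply: le_trans (growth_lipschitz _ (ltW C0) fC b1) _.
have -> : nrm (b' - b) * (16 * C * expR L) * expR ((2^-1 - dl) * nrm z ^+ 2) =
  16 * (C * (expR L * expR ((2^-1 - dl) * nrm z ^+ 2))) * nrm (b' - b) by ring.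
by rewrite ler_wpM2r ?nrm_ge0 // ler_wpM2l // ler_wpM2l // ltW.
Qed.

Lemma fock_id p : 0 < p -> exists f : fock p, f = id :> (R[i] -> R[i]).
Proof.
move=> p0; have eid : entire (id : R[i] -> R[i]) by exact: cdiff_id.
have fid : (fock_norm p (id : R[i] -> R[i]) < +oo)%E.
  apply: le_lt_trans (ltry _).
  have q4 : 0 < 4^-1 :> R by rewrite invr_gt0.
  apply: (@fock_norm_gauss_bound R p id 1 4^-1 p0 ler01 q4 eid) => z.
  rewrite mul1r /=; apply: le_trans (expR_ge1Dx _).
  by have := sqr_ge0 (nrm z / 2 - 1); rewrite sqrrB; lra.
by exists (Fock eid fid).
Qed.

(** Moving the translation part by a small amount changes the operator, as seen on
    the identity function, but hardly its distance to [U]. *)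
Lemma contraction_approx p q a b (U : comp_op p q) (e : R) : 0 < p -> 0 < q -> nrm a < 1 ->
  0 < e -> induced_by U (affine a b) -> exists b' (S : comp_op p q),
  [/\ induced_by S (affine a b'), affine a b' <> affine a b, S <> U &
      (op_norm q (op_diff U S) < e%:E)%E].
Proof.
move=> p0 q0 a1 e0 iU; have [K K0 HK] := @contraction_near p q a b p0 q0 a1.
pose t := Num.min 1 (e / (K + 1)).
have K1 : 0 < K + 1 by rewrite ltr_wpDl.
have t0 : 0 < t by rewrite lt_min ltr01 divr_gt0.
have t1 : t <= 1 by rewrite ge_min lexx.
have te : t * (K + 1) <= e by rewrite -ler_pdivlMr // ge_min lexx orbT.
clearbody t; pose b' := b + t%:C.
have bb : nrm (b' - b) = t by rewrite /b' addrC addKr nrmR ger0_norm // ltW.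
have [S iS] := @contraction_comp_op p q a b' p0 q0 a1.
have neq : affine a b' <> affine a b.
  move=> /(congr1 (fun F => F 0)); rewrite /affine !mulr0 !add0r => E.
  by move: bb; rewrite E subrr nrm0 => t0'; rewrite -t0' ltxx in t0.
exists b', S; split => //.
  move=> SU; apply: neq; have [f fE] := fock_id p0.
  by have := iS f; rewrite SU (iU f) fE.
have := HK b' U S; rewrite bb => /(_ t1 iU iS) H; apply: le_lt_trans H _.
rewrite lte_fin; apply: lt_le_trans te; by rewrite ltr_pM2l // ltrDl.
Qed.

End Contraction.

(** * Limits of entire functions along ultrafilters *)

Section Compactness.
Variable R : realType.
Notation Re := (@complex.Re R).
Notation Im := (@complex.Im R).
Implicit Types (p q r s m x : R) (a b c d h k z w u v : R[i]).

(** A bounded interval is compact, so the image filter has a cluster point; an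
    ultrafilter converges to each of its cluster points. *)
Lemma ultra_lim_real (X : Type) (G : set_system X) (u : X -> R) (m : R) :
  UltraFilter G -> G [set y | `|u y| <= m] ->
  exists l, forall e : R, 0 < e -> G [set y | `|u y - l| < e].
Proof.
move=> UG Gm; have PG : ProperFilter G by exact: ultra_proper.
have [|l [_ lc]] := @segment_compact R (- m) m (u @ G) _.
  suff : G (u @^-1` `[- m, m]) by [].
  by apply: filterS Gm => y /= H; rewrite in_itv /= -ler_norml.
exists l => e e0; have [//|Gn] := in_ultra_setVsetC [set y | `|u y - l| < e] UG.
have [x [/= Gx lx]] := lc (u @` ~` [set y | `|u y - l| < e]) (ball l e)
  (filterS (@preimage_image _ _ u _) Gn) (nbhsx_ballx _ _ e0).
by case: Gx => y ny yx; exfalso; apply: ny; rewrite /= yx distrC.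
Qed.

Lemma ultra_lim (X : Type) (G : set_system X) (u : X -> R[i]) (m : R) :
  UltraFilter G -> G [set y | nrm (u y) <= m] ->
  exists l, forall e : R, 0 < e -> G [set y | nrm (u y - l) < e].
Proof.
move=> UG Gm; have PG : ProperFilter G by exact: ultra_proper.
have [|l1 H1] := @ultra_lim_real X G (fun y => Re (u y)) m UG.
  by apply: filterS Gm => y /=; apply: le_trans; exact: Re_le_nrm.
have [|l2 H2] := @ultra_lim_real X G (fun y => Im (u y)) m UG.
  by apply: filterS Gm => y /=; apply: le_trans; exact: Im_le_nrm.
exists (l1 +i* l2) => e e0; have e2 : 0 < e / 2 by rewrite divr_gt0.
apply: filterS (filterI (H1 _ e2) (H2 _ e2)) => y [/= y1 y2].
by apply: le_lt_trans (nrm_le_ReIm _) _; rewrite Re_subc Im_subc /= [e]splitr ltrD.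
Qed.

(** The derivatives are bounded as well, so they too have limits, and the second
    order estimates of [growth_taylor] pass to the limit.  They exhibit the limit of
    the derivatives as the derivative of the limit. *)
Lemma growth_ultralimit (X : Type) (G : set_system X) (A : R) (F : X -> R[i] -> R[i]) :
  0 <= A -> UltraFilter G -> G [set y | growth_class A (F y)] ->
  exists2 g, growth_class A g &
    forall z (e : R), 0 < e -> G [set y | nrm (F y z - g z) < e].
Proof.
move=> A0 UG GF; have PG : ProperFilter G by exact: ultra_proper.
have limF z : exists l, forall e : R, 0 < e -> G [set y | nrm (F y z - l) < e].
  apply: (@ultra_lim X G _ (A * expR ((nrm z + 8) ^+ 2 / 2))) => //.
  by apply: filterS GF => y [_ yA]; exact: yA.
have [g gP] := choice limF.
exists g => //.
have gbound z : nrm (g z) <= A * expR ((nrm z + 8) ^+ 2 / 2).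
  apply/ler_addgt0Pr => e e0.
  have [y [[_ yA] ye]] := filter_ex (filterI GF (gP z _ e0)).
  rewrite -[g z](subKr (F y z)); apply: le_trans (nrmB _ _) _.
  by apply: lerD; [exact: yA|exact: ltW].
split => // z; apply/cdiffP.
pose B := 8 * (A * expR ((nrm z + 12) ^+ 2 / 2)).
have B0 : 0 <= B by rewrite /B !mulr_ge0 ?expR_ge0.
have tay y : exists k, growth_class A (F y) -> nrm k <= B /\ forall h, nrm h <= 1 ->
    nrm (F y (z + h) - F y z - k * h) <= B * nrm h ^+ 2.
  have [/(growth_taylor z A0)[k k1 k2]|H] := pselect (growth_class A (F y)); first by exists k.
  by exists 0 => /H.
have [K HK] := choice tay.
have [|d dP] := @ultra_lim X G K B UG.
  by apply: filterS GF => y /HK[].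
have gtay h : nrm h <= 1 -> nrm (g (z + h) - g z - d * h) <= B * nrm h ^+ 2.
  move=> h1; apply/ler_addgt0Pr => e e0; have e3 : 0 < e / 3 by rewrite divr_gt0.
  have [y [[[yA y1] y2] y3]] := filter_ex
    (filterI (filterI (filterI GF (gP (z + h) _ e3)) (gP z _ e3)) (dP _ e3)).
  have [_ /(_ h h1) yt] := HK y yA.
  have -> : g (z + h) - g z - d * h = (F y (z + h) - F y z - K y * h)
    - (F y (z + h) - g (z + h)) + (F y z - g z) + (K y - d) * h by ring.
  have h3 : nrm ((K y - d) * h) <= e / 3.
    by rewrite nrmM; apply: (le_trans _ (ltW y3)); rewrite ler_piMr ?nrm_ge0.
  apply: le_trans (nrmD _ _) _.
  have := nrmD (F y (z + h) - F y z - K y * h - (F y (z + h) - g (z + h))) (F y z - g z).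
  have := nrmB (F y (z + h) - F y z - K y * h) (F y (z + h) - g (z + h)).
  move: y1 y2 yt h3 => /=; lra.
exists d => e e0; have B1 : 0 < B + 1 by rewrite ltr_wpDl.
exists (Num.min 1 (e / (B + 1))); first by rewrite lt_min ltr01 divr_gt0.
move=> h; rewrite lt_min ltr_pdivlMr // => /andP[/ltW h1 h2].
apply: le_trans (gtay h h1) _; rewrite expr2 mulrA ler_wpM2r ?nrm_ge0 //.
apply: (le_trans _ (ltW h2)); rewrite mulrC; apply: ler_wpM2l; first exact: nrm_ge0.
by rewrite lerDl.
Qed.

(** The distance is a power of the norm of the difference, with a positive exponent. *)
Lemma fock_dist_lt p (f g : fock p) (e : R) : 0 < p -> 0 < e ->
  (fock_dist f g < (e `^ Num.min 1 p)%:E)%E -> (fock_norm p (f \- g)%R < e%:E)%E.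
Proof.
move=> p0 e0; rewrite !ltNge; apply: contra => H; rewrite /fock_dist -poweR_EFin.
by apply: poweR_le => //; [rewrite le_min ler01 ltW|rewrite lee_fin ltW].
Qed.

Lemma fock_dist_le p (f g : fock p) (e : R) : 0 < p -> 0 <= e ->
  (fock_norm p (f \- g)%R <= e%:E)%E -> (fock_dist f g <= (e `^ Num.min 1 p)%:E)%E.
Proof.
move=> p0 e0 H; rewrite /fock_dist -poweR_EFin.
by apply: poweR_le => //; [rewrite le_min ler01 ltW|exact: fock_norm_ge0].
Qed.

Lemma small_powR (e s : R) : 0 < e -> 0 < s -> exists2 x, 0 < x & x `^ s < e.
Proof.
move=> e0 s0; exists ((e / 2) `^ s^-1); first by rewrite powR_gt0 // divr_gt0.
by rewrite -powRrM mulVf ?gt_eqF // powRr1 ?divr_ge0 ?(ltW e0) //; lra.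
Qed.

(** Point evaluations are continuous and separate points.  This replaces the triangle
    inequality of [fock_dist] in every topological argument below. *)
Lemma fock_eval_continuous p (f : fock p) z (e : R) : 0 < p -> 0 < e ->
  exists2 r : R, 0 < r & forall g : fock p, (fock_dist f g < r%:E)%E -> nrm (f z - g z) < e.
Proof.
move=> p0 e0; have [C C0 HC] := fock_eval p0.
pose D := C * expR ((nrm z + 8) ^+ 2 / 2).
have D0 : 0 < D by rewrite mulr_gt0 ?expR_gt0.
pose x := e / (2 * D); have x0 : 0 < x by rewrite divr_gt0 // mulr_gt0.
exists (x `^ Num.min 1 p); first by rewrite powR_gt0.
move=> g /(fock_dist_lt p0 x0)/ltW fx.
have := HC (f \- g)%R x (entireB (@fock_entire _ _ f) (@fock_entire _ _ g)) (ltW x0) fx z.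
rewrite -/D => H; apply: le_lt_trans H _.
have -> : D * x = e / 2 by rewrite /x; field; rewrite gt_eqF.
by lra.
Qed.

Lemma open_eval p z (u : R[i]) (e : R) : 0 < p -> open [set y : fock p | nrm (y z - u) < e].
Proof.
move=> p0; have H : metric_open (@fock_dist R p) [set y : fock p | nrm (y z - u) < e].
  move=> x /= xe; have [|r r0 Hr] := @fock_eval_continuous p x z (e - nrm (x z - u)) p0.
    by rewrite subr_gt0.
  exists r => // y /Hr xy; have -> : y z - u = (x z - u) - (x z - y z) by ring.
  by apply: le_lt_trans (nrmB _ _) _; lra.
exact: H.
Qed.

Lemma fock_hausdorff p : 0 < p -> hausdorff_space (fock p).
Proof.
move=> p0 f g clu; apply: fock_ext; apply/funext => z; apply/eqP/negPn/negP => fg.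
pose r := nrm (f z - g z) / 2.
have r0 : 0 < r by rewrite divr_gt0 // nrm_gt0 subr_eq0.
have nf : nbhs f [set y : fock p | nrm (y z - f z) < r].
  by apply: open_nbhs_nbhs; split; [exact: open_eval|rewrite /= subrr nrm0].
have ng : nbhs g [set y : fock p | nrm (y z - g z) < r].
  by apply: open_nbhs_nbhs; split; [exact: open_eval|rewrite /= subrr nrm0].
have [y [/= yf yg]] := clu _ _ nf ng.
have : nrm (f z - g z) < r + r.
  have -> : f z - g z = (y z - g z) - (y z - f z) by ring.
  by apply: le_lt_trans (nrmB _ _) _; lra.
by rewrite /r -splitr ltxx.
Qed.

(** Two regimes.  For [|z| > N] the Gaussian decay common to all functions of the class
    makes any difference small.  The square [qbox 0 0 N] is compact and the functions
    are equicontinuous on it, so pointwise convergence is uniform there. *)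
Lemma growth_uniform q a b (G : set_system (fock q)) (F : fock q -> R[i] -> R[i])
  (A : R) (g : R[i] -> R[i]) (e : R) : 0 <= A -> nrm a < 1 -> 0 < q -> 0 < e ->
  ProperFilter G -> growth_class A g -> G [set y | growth_class A (F y)] ->
  (forall z (e : R), 0 < e -> G [set y | nrm (F y z - g z) < e]) ->
  G [set y | growth_class A (F y) /\
    (fock_norm q ((g \o affine a b) \- (F y \o affine a b))%R <= e%:E)%E].
Proof.
move=> A0 a1 q0 e0 PG gA GA GF.
have [dl [L [dl0 dl2 HL]]] := affine_weight b a1 (ler0n R 8).
pose K := (dl^-1) `^ q^-1; have K0 : 0 < K by rewrite powR_gt0 // invr_gt0.
pose e1 := e / K; have e10 : 0 < e1 by rewrite divr_gt0.
pose D := 2 * (A * expR L); have D0 : 0 <= D by rewrite !mulr_ge0 ?expR_ge0.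
(* For [|z| >= N] the remaining decay [dl / 2 * |z| ^+ 2] exceeds [D / e1]. *)
pose N := 1 + 2 * (D / e1) / dl.
have N1 : 1 <= N by rewrite lerDl !mulr_ge0 ?invr_ge0 ?(ltW e10) ?(ltW dl0).
pose Q : set (R * R) := qbox 0 0 N.
have cQ : near_covering Q by apply/compact_near_coveringP; exact: compact_qbox.
pose P (y : fock q) (w : R * R) := nrm (g (affine a b (w.1 +i* w.2)) - F y (affine a b (w.1 +i* w.2))) < e1.
have GP : \forall y \near G, Q `<=` P y.
  apply: cQ => w0 _.
  set z0 := affine a b (w0.1 +i* w0.2).
  pose M := 16 * (A * expR ((nrm z0 + 12) ^+ 2 / 2)).
  have M0 : 0 <= M by rewrite !mulr_ge0 ?expR_ge0.
  have e3 : 0 < e1 / 3 by rewrite divr_gt0.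
  have M1 : 0 < M + 1 by rewrite ltr_wpDl.
  pose r := Num.min 1 (e1 / 3 / (M + 1)).
  have r0 : 0 < r by rewrite lt_min ltr01 divr_gt0.
  have r1 : r <= 1 by rewrite ge_min lexx.
  have Mr : M * r <= e1 / 3.
    apply: (@le_trans _ _ ((M + 1) * r)); first by rewrite ler_wpM2r ?(ltW r0) // lerDl.
    by rewrite mulrC -ler_pdivlMr // ge_min lexx orbT.
  clearbody r.
  exists ([set w | `|w.1 - w0.1| < r / 2 /\ `|w.2 - w0.2| < r / 2],
    [set y | growth_class A (F y) /\ nrm (F y z0 - g z0) < e1 / 3]); first split => /=.
  - exists (ball w0.1 (r / 2), ball w0.2 (r / 2)) => /=.
      by split; apply: nbhsx_ballx; rewrite divr_gt0.
    by move=> [x y] [/= H1 H2]; rewrite distrC (distrC y).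
  - exact: filterI GA (GF z0 _ e3).
  move=> [w y] [[/= w1 w2] [yA y0]]; rewrite /P.
  have -> : affine a b (w.1 +i* w.2) = z0 + a * ((w.1 - w0.1) +i* (w.2 - w0.2)).
    have -> : (w.1 - w0.1) +i* (w.2 - w0.2) = (w.1 +i* w.2) - (w0.1 +i* w0.2) by [].
    by rewrite /z0 /affine; ring.
  set h := a * _.
  have hr : nrm h <= r.
    rewrite /h nrmM; apply: (@le_trans _ _ (1 * r)); last by rewrite mul1r.
    apply: ler_pM; rewrite ?nrm_ge0 ?(ltW a1) //.
    by apply: le_trans (nrm_pair _ _) _; lra.
  have h1 : nrm h <= 1 by exact: le_trans hr r1.
  have l1 := growth_lipschitz z0 A0 gA h1; have l2 := growth_lipschitz z0 A0 yA h1.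
  rewrite -/M in l1 l2.
  have Mh : M * nrm h <= e1 / 3 by apply: (le_trans _ Mr); rewrite ler_wpM2l.
  have -> : g (z0 + h) - F y (z0 + h) =
    (g (z0 + h) - g z0) - (F y (z0 + h) - F y z0) - (F y z0 - g z0) by ring.
  apply: le_lt_trans (nrmB _ _) _; have := nrmB (g (z0 + h) - g z0) (F y (z0 + h) - F y z0).
  lra.
apply: filterS (filterI GA GP) => y [yA yP]; split => //.
have -> : e = e1 * K by rewrite /e1 divfK // gt_eqF.
rewrite /K; have -> : dl = 2 * (dl / 2) by field.
have d2 : 0 < dl / 2 by rewrite divr_gt0.
apply: (@fock_norm_gauss_bound R q _ _ (dl / 2) q0 (ltW e10) d2
  (entireB (entire_comp_affine gA.1) (entire_comp_affine yA.1))).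
move=> z; rewrite /=; have n0 := nrm_ge0 z.
have [zN|Nz] := leP (nrm z) N.
  apply: (@le_trans _ _ e1).
    have := yP (Re z, Im z); rewrite /P /= -complex_eta => H; apply: ltW; apply: H.
    have [n1 n2] := (Re_le_nrm z, Im_le_nrm z).
    by split; rewrite /= in_itv /= sub0r add0r -ler_norml; apply: (le_trans _ zN).
  have E1 : 1 <= expR ((2^-1 - dl / 2) * nrm z ^+ 2).
    by rewrite -[leLHS]expR0 ler_expR; apply: mulr_ge0; rewrite ?exprn_ge0 //; lra.
  by rewrite ler_peMr ?(ltW e10).
apply: le_trans (nrmB _ _) _.
apply: (@le_trans _ _ (D * expR ((2^-1 - dl) * nrm z ^+ 2))).
  have := lerD (gA.2 (affine a b z)) (yA.2 (affine a b z)).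
  have := ler_wpM2l A0 (HL z); rewrite /D; lra.
have -> : (2^-1 - dl / 2) * nrm z ^+ 2 = (2^-1 - dl) * nrm z ^+ 2 + dl / 2 * nrm z ^+ 2 by field.
rewrite expRD [leRHS]mulrCA [leLHS]mulrC; apply: ler_wpM2l; first exact: expR_ge0.
rewrite [leRHS]mulrC -ler_pdivrMr //; apply: (le_trans _ (expR_ge1Dx _)).
have z1 : 1 <= nrm z by apply: le_trans N1 (ltW Nz).
have h1 : dl / 2 * nrm z <= dl / 2 * nrm z ^+ 2.
  by rewrite ler_wpM2l ?(ltW d2) // expr2 ler_peMl.
have h2 : dl / 2 * N = dl / 2 + D / e1.
  by rewrite /N mulrDr mulr1; congr (_ + _); field; rewrite !gt_eqF.
have h3 : dl / 2 * N <= dl / 2 * nrm z by rewrite ler_wpM2l ?(ltW d2) // ltW.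
move: h1 h2 h3; move: (nrm z ^+ 2) (nrm z) (D / e1) (N) => W Z Y X; lra.
Qed.

End Compactness.

(** * Compact and isolated composition operators *)

Section CompactOrNot.
Variable R : realType.
Notation Re := (@complex.Re R).
Implicit Types (p q r s m x : R) (a b c d h k z w u v : R[i]).

(** An ultrafilter on the image lifts to the class by a choice of preimages, which
    converge pointwise; their composites converge in norm. *)
Lemma growth_image_compact q a b (A : R) : 0 < q -> nrm a < 1 -> 0 <= A ->
  compact [set y : fock q | exists f, growth_class A f /\ (y : R[i] -> R[i]) = f \o affine a b].
Proof.
move=> q0 a1 A0; set K := (X in compact X).
rewrite compact_ultra => G UG GK.
have PG : ProperFilter G by exact: ultra_proper.
have sel (y : fock q) : exists f, K y ->
    growth_class A f /\ (y : R[i] -> R[i]) = f \o affine a b.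
  by have [[f Hf]|nK] := pselect (K y); [exists f|exists id => /nK].
have [F HF] := choice sel.
have GF : G [set y | growth_class A (F y)] by apply: filterS GK => y /HF[].
have [g gA gF] := growth_ultralimit A0 UG GF.
have [N N0 HN] := growth_comp_norm b q0 a1.
have gfin : (fock_norm q (g \o affine a b) < +oo)%E := le_lt_trans (HN A g A0 gA) (ltry _).
pose hh : fock q := Fock (entire_comp_affine gA.1) gfin.
exists hh; split; first by exists g.
move=> V [U [oU Uh UV]]; apply: filterS UV _.
have [e e0 He] := oU hh Uh.
have m0 : 0 < Num.min 1 q :> R by rewrite lt_min ltr01.
have [x x0 xe] := small_powR e0 m0.
have GU := growth_uniform b A0 a1 q0 x0 PG gA GF gF.
apply: filterS (filterI GK GU) => y [yK [_ yx]]; apply: He.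
apply: le_lt_trans (fock_dist_le q0 (ltW x0) _) _; last by rewrite lte_fin; exact: xe.
by have [_ ->] := HF y yK.
Qed.

(** The image of a bounded set lies in a compact set, which is closed since the space
    is Hausdorff. *)
Lemma contraction_compact p q a b (U : comp_op p q) : 0 < p -> 0 < q -> nrm a < 1 ->
  induced_by U (affine a b) -> compact_op U.
Proof.
move=> p0 q0 a1 iU B [M BM]; have [C C0 HC] := fock_growth p0.
pose M' := Num.max M 0; have M0 : 0 <= M' by rewrite le_max lexx orbT.
have CM : 0 <= C * M' by rewrite mulr_ge0 // ltW.
have cK := @growth_image_compact q a b (C * M') q0 a1 CM; set K := (X in compact X) in cK.
have clK : closed K := compact_closed (fock_hausdorff q0) cK.
have sub : U @` B `<=` K.
  move=> _ [f Bf <-]; exists f; split; last exact: iU.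
  by apply: HC => //; apply: le_trans (BM f Bf) _; rewrite lee_fin le_max lexx.
apply: (subclosed_compact (@closed_closure _ _) cK).
by rewrite [X in _ `<=` X]((closure_id K).1 clK); exact: closureS.
Qed.

(** The images [y n] of the kernels at the integers would have a cluster point [l].
    Since [y n] tends to 0 at every point, [l = 0].  But [y n] has norm 1, and the
    complement of the range of [y] is open: near 0 the norms separate, and near a
    nonzero function a point evaluation excludes all but finitely many terms. *)
Lemma unimodular_not_compact p q a (U : comp_op p q) : 0 < p -> 0 < q -> nrm a = 1 ->
  induced_by U (affine a 0) -> ~ compact_op U.
Proof.
move=> p0 q0 a1 iU cU.
pose y (n : nat) : fock q := U (fock_kern p0 n%:R).
have yE n z : nrm (y n z) = nrm (kern (a^* * n%:R) z).
  have -> : y n z = kern n%:R (affine a 0 z) by rewrite /y (iU (fock_kern p0 n%:R)).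
  rewrite kern_affine a1 expr1n subrr !mul0r subr0 mulr0.
  by rewrite [Re 0]/= expR0 mul1r.
have yn n : fock_norm q (y n) = 1%E.
  by rewrite (@fock_norm_scale R q _ (kern (a^* * n%:R)) 1 q0 ler01 (@entire_kern R _))
    ?fock_norm_kern ?mule1 // => z; rewrite mul1r yE.
have ylim z (e : R) : 0 < e -> exists N, forall n, (N <= n)%N -> nrm (y n z) < e.
  move=> e0; exists (Num.truncn (2 * nrm z + 2 + e^-1)).+1 => n Nn.
  have nn : 2 * nrm z + 2 + e^-1 < n%:R by apply: lt_le_trans (truncnS_gt _) _; rewrite ler_nat.
  rewrite yE nrm_kern nrmM nrmJ a1 mul1r.
  have nr : nrm (n%:R : R[i]) = n%:R by rewrite -(rmorph_nat (real_complex R)) nrmR ger0_norm.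
  rewrite nr; have ei : 0 < e^-1 by rewrite invr_gt0.
  have h1 : Re ((a^* * n%:R)^* * z) <= n%:R * nrm z.
    apply: le_trans (ler_norm _) _; apply: le_trans (Re_le_nrm _) _.
    by rewrite nrmM nrmJ nrmM nrmJ a1 mul1r nr.
  apply: (@le_lt_trans _ _ (expR (- e^-1))).
    rewrite ler_expR; have := nrm_ge0 z; move: h1 nn ei; nra.
  rewrite expRN invf_plt ?posrE ?expR_gt0 //.
  by apply: lt_le_trans (expR_ge1Dx _); rewrite ltrDr.
have cl := cU [set fock_kern p0 n%:R | n in [set: nat]].
have {}cl : compact (closure (U @` [set fock_kern p0 n%:R | n in [set: nat]])).
  by apply: cl; exists 1 => _ [n _ <-]; rewrite fock_norm_kern.
have [|l [_ lc]] := cl (y @ \oo) _.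
  by exists 0%N => // n _; apply: subset_closure; exists (fock_kern p0 n%:R) => //; exists n.
have l0 z : l z = 0.
  apply/eqP/negPn/negP => lz; have r0 : 0 < nrm (l z) / 2 by rewrite divr_gt0 // nrm_gt0.
  have [N HN] := ylim z _ r0.
  have nl : nbhs l [set f : fock q | nrm (f z - l z) < nrm (l z) / 2].
    by apply: open_nbhs_nbhs; split; [exact: open_eval|rewrite /= subrr nrm0].
  have [_ [[n /= Nn <-] /= H]] := lc [set y n | n in [set n | (N <= n)%N]] _
    (ltac:(exists N => // n Nn; exists n => //)) nl.
  have := HN n Nn; have := nrmB (y n z) (y n z - l z); rewrite subKr; lra.
pose W : set (fock q) := ~` range y.
have finite_sep (x : fock q) : (forall n, x <> y n) -> forall N, exists2 e : R, 0 < e &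
    forall n, (n < N)%N -> ~ (fock_dist x (y n) < e%:E)%E.
  move=> xy; elim=> [|N [e e0 He]]; first by exists 1.
  have [z xz] : exists z, x z <> y N z.
    apply/existsNP => H; apply: (xy N); apply: fock_ext; exact/funext.
  have d0 : 0 < nrm (x z - y N z) by rewrite nrm_gt0 subr_eq0; exact/eqP.
  have [r r0 Hr] := fock_eval_continuous x z q0 d0.
  exists (Num.min e r); first by rewrite lt_min e0.
  move=> n; rewrite ltnS leq_eqVlt EFin_min lt_min => /orP[/eqP-> /andP[_ /Hr]|/He H /andP[/H]] //.
  by rewrite ltxx.
have oW : metric_open (@fock_dist R q) W.
  move=> x Wx; have xy n : x <> y n by move=> E; apply: Wx; exists n.
  have [x0|[z xz]] : (forall z, x z = 0) \/ exists z, x z <> 0.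
    by have [?|/existsNP ?] := pselect (forall z, x z = 0); [left|right].
  - exists 1 => // f xf [n _ fE]; move: xf; rewrite -fE /fock_dist.
    rewrite (@fock_norm_scale R q _ (y n) 1 q0 ler01 (@fock_entire _ _ (y n))).
      by rewrite yn mule1 poweR1r ltxx.
    by move=> z; rewrite /= x0 sub0r nrmN mul1r.
  - have r0 : 0 < nrm (x z) / 2 by rewrite divr_gt0 // nrm_gt0; apply/eqP.
    have [N HN] := ylim z _ r0.
    have [e1 e10 H1] := finite_sep x xy N.
    have [e2 e20 H2] := fock_eval_continuous x z q0 r0.
    exists (Num.min e1 e2); first by rewrite lt_min e10.
    move=> f + [n _ fE]; rewrite -fE EFin_min lt_min => /andP[f1 /H2 f2].
    have [nN|Nn] := ltnP n N; first exact: (H1 n nN).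
    have := HN n Nn; have := nrmD (x z - y n z) (y n z); rewrite subrK; lra.
have Wl : W l.
  move=> [n _ /(congr1 (fun f : fock q => nrm (f 0)))]; rewrite l0 nrm0 yE nrm_kern => E.
  by have := expR_gt0 (Re ((a^* * n%:R)^* * 0) - nrm (a^* * n%:R) ^+ 2 / 2); rewrite E ltxx.
have nW : nbhs l W by apply: open_nbhs_nbhs; split => //; exact: oW.
have [|f [[n _ <-] Wn]] := lc (range y) W _ nW; first by exists 0%N => // n _; exists n.
by apply: Wn; exists n.
Qed.

(** The open unit ball around [U] is reduced to [U]. *)
Lemma unimodular_isolated p q a (U : comp_op p q) : 0 < p -> 0 < q -> nrm a = 1 ->
  induced_by U (affine a 0) -> isolated [set: comp_op p q] U.
Proof.
move=> p0 q0 a1 iU; split; first by rewrite inE.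
exists [set U]; last by rewrite setIT.
have oU : metric_open (@comp_op_dist R p q) [set U].
  move=> _ ->; exists 1 => // S US; have [phi ephi iS] := comp_op_symbol S.
  have [c [d E]] := bounded_symbol_affine p0 q0 ephi iS; subst phi.
  have [ca|ca] := eqVneq c a.
    subst c; have d0 := unimodular_bounded p0 q0 iS a1; subst d.
    exact: comp_op_ext iU iS.
  exfalso; move: US; apply/negP; rewrite -leNgt /comp_op_dist.
  rewrite -[X in (X <= _)%E](poweR1r (Num.min 1 q)).
  by apply: poweR_le; rewrite ?le_min ?ler01 ?(ltW q0) //; exact: diff_norm_ge1 iU iS.
by apply: open_nbhs_nbhs; split => //; exact: oU.
Qed.

Lemma contraction_not_isolated p q a b (U : comp_op p q) : 0 < p -> 0 < q -> nrm a < 1 ->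
  induced_by U (affine a b) -> ~ isolated [set: comp_op p q] U.
Proof.
move=> p0 q0 a1 iU [_ [V [W [oW WU WV]] VU]].
have [e e0 He] := oW U WU.
have m0 : 0 < Num.min 1 q :> R by rewrite lt_min ltr01.
have [x x0 xe] := small_powR e0 m0.
have [b' [S [iS _ SU Sx]]] := contraction_approx p0 q0 a1 x0 iU.
apply: SU; have : (V `&` setT) S.
  split => //; apply: WV; apply: He; apply: (@le_lt_trans _ _ (x `^ Num.min 1 q)%:E).
    rewrite /comp_op_dist -poweR_EFin; apply: poweR_le (ltW m0) _ (ltW Sx).
    apply: (@le_trans _ _ (fock_norm q (op_diff U S (fock_kern p0 0)))); first exact: fock_norm_ge0.
    by apply: op_norm_ge; rewrite fock_norm_kern.
  by rewrite lte_fin.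
by rewrite VU.
Qed.

End CompactOrNot.

Theorem theorem4p6 (R : realType) (p q : R) (a b : R[i]) (T : comp_op p q)
    (hp : 0 < p) (hpq : p <= q) (ha : `|a| <= 1)
    (hT : induced_by T (affine a b)) :
  [/\ isolated [set: comp_op p q] T <-> ~ compact_op T,
      ~ compact_op T <-> (`|a| = 1 /\ b = 0) &
      ~ compact_op T <->
        (forall (c d : R[i]) (S : comp_op p q),
           affine c d <> affine a b -> induced_by S (affine c d) ->
           (1 <= op_norm q (op_diff T S))%E)].
Proof.
have hq : 0 < q := lt_le_trans hp hpq.
have norm1 : `|a| = 1 <-> nrm a = 1.
  by rewrite normr_nrm; split => [[]|->].
have : nrm a <= 1 by rewrite -lecR -normr_nrm.
rewrite le_eqVlt => /predU1P[a1|a1].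
  have b0 : b = 0 := unimodular_bounded hp hq hT a1; subst b.
  have nc := unimodular_not_compact hp hq a1 hT.
  have iso := unimodular_isolated hp hq a1 hT.
  have a1' : `|a| = 1 by apply/norm1.
  do 2 split => //; move=> _ c d S neq iS.
  have [ca|ca] := eqVneq c a; last exact: (diff_norm_ge1 hp hq a1 ca hT iS).
  by subst c; case: neq; rewrite (unimodular_bounded hp hq iS a1).
have co := contraction_compact hp hq a1 hT.
split; split => //.
- by move=> iso; case: (contraction_not_isolated hp hq a1 hT iso).
- by move=> [/norm1 a1']; rewrite a1' ltxx in a1.
- move=> H; have [b' [S [iS neq _ lt1]]] := contraction_approx hp hq a1 ltr01 hT.
  by have := H _ _ _ neq iS; rewrite leNgt lt1.
Qed.
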